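(* Let $d\ge 1$ and assume $1<p<\infty$ and $1<s\le1+\frac dp$. Then for any $M>0$, there exist $f,g\in\mathcal S(\mathbb R^d)$ such that $$\|J^sf\|_p+\|g\|_\infty+\|J^{s-1}g\|_p+\|\partial f\|_{\mathrm{BMO}}\le1,$$ but $$\|J^s(fg)-fJ^sg\|_p>M.$$
   Context: $\mathcal S(\mathbb R^d)$ is the space of Schwartz functions, $\|\cdot\|_p$ the $L^p(\mathbb R^d)$ norm. $J^s=(1-\Delta)^{s/2}$ is the Fourier multiplier with symbol $(1+|\xi|^2)^{s/2}$. $\partial=(\partial_1,\dots,\partial_d)$ is the gradient; norms of vector-valued functions are taken componentwise. The BMO norm is $\|u\|_{\mathrm{BMO}}=\sup_Q\frac1{|Q|}\int_Q|u-u_Q|\,dy$ ($u_Q$ the average over $Q$, supremum over all cubes $Q\subset\mathbb R^d$). *)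

(* Defs.v *)
From HB Require Import structures.
From mathcomp Require Import all_boot all_order all_algebra.
From mathcomp Require Import complex.
From mathcomp Require Import all_classical all_reals all_analysis.

Set Implicit Arguments.
Unset Strict Implicit.
Unset Printing Implicit Defensive.

Import Order.TTheory GRing.Theory Num.Theory.
Import numFieldNormedType.Exports.

Local Open Scope classical_set_scope.
Local Open Scope ring_scope.
Local Open Scope complex_scope.

(* The sigma-algebra on row vectors generated by the coordinates; over a
   realType this is the Borel sigma-algebra of R^n. *)
Definition measure_rV_display : measure_display -> measure_display.
Proof. exact. Qed.

Section measurable_rV.
Context {d} {T : measurableType d}.
Variable n : nat.

Let coord : 'I_n -> 'rV[T]_n -> T := fun i x => x ord0 i.

Let rV_set0 : g_sigma_preimage coord set0.
Proof. exact: sigma_algebra0. Qed.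

Let rV_setC A : g_sigma_preimage coord A -> g_sigma_preimage coord (~` A).
Proof. exact: sigma_algebraC. Qed.

Let rV_bigcup (F : _^nat) : (forall i, g_sigma_preimage coord (F i)) ->
  g_sigma_preimage coord (\bigcup_i (F i)).
Proof. exact: sigma_algebra_bigcup. Qed.

HB.instance Definition _ := @isMeasurable.Build (measure_rV_display d)
  'rV[T]_n (g_sigma_preimage coord) rV_set0 rV_setC rV_bigcup.

End measurable_rV.

Lemma measurable_coord d (T : measurableType d) n (i : 'I_n) :
  measurable_fun [set: 'rV[T]_n] (fun x : 'rV[T]_n => x ord0 i).
Proof.
move=> _ Y mY; rewrite setTI; apply: sub_sigma_algebra => /=.
rewrite -bigcup_seq/=; exists i => /=; first by rewrite mem_index_enum.
by exists Y => //; rewrite setTI.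
Qed.

Lemma measurable_fun_rV d1 d2 (T1 : measurableType d1) (T2 : measurableType d2)
    n (f : T1 -> 'rV[T2]_n) :
  (forall i, measurable_fun [set: T1] (fun x => f x ord0 i)) ->
  measurable_fun [set: T1] f.
Proof.
move=> mf _ Y mY; rewrite setTI.
suff : measurable `<=` [set A | measurable (f @^-1` A)] by exact.
apply: smallest_sub => [|A/=]; first split => /=.
- by rewrite preimage_set0.
- by move=> A mA; rewrite setTD preimage_setC; exact: measurableC.
- by move=> F mF; rewrite preimage_bigcup; exact: bigcup_measurable.
rewrite -bigcup_seq => -[i _ [B mB <-]].
by rewrite setTI -[X in measurable X]setTI; exact: mf.
Qed.

Section lebesgue_measure_rV.
Variable R : realType.

Section step.
Variables (n : nat) (m : {sigma_finite_measure set 'rV[R]_n -> \bar R}).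

Definition cons_rV (xy : measurableTypeR R * 'rV[R]_n) : 'rV[R]_n.+1 :=
  row_mx (const_mx xy.1 : 'rV_1) xy.2.

Lemma measurable_cons_rV :
  measurable_fun [set: measurableTypeR R * 'rV[R]_n] cons_rV.
Proof.
apply: measurable_fun_rV => i; rewrite /cons_rV.
case: (split_ordP (i : 'I_(1 + n))) => j ->.
  under eq_fun do rewrite (@row_mxEl _ 1 1 n) mxE.
  exact: measurable_fst.
under eq_fun do rewrite (@row_mxEr _ 1 1 n).
exact: (measurableT_comp (measurable_coord j) measurable_snd).
Qed.

Definition uncons_rV (x : 'rV[R]_n.+1) : measurableTypeR R * 'rV[R]_n :=
  (x ord0 ord0, \row_j x ord0 (lift ord0 j)).

Lemma measurable_uncons_rV : measurable_fun [set: 'rV[R]_n.+1] uncons_rV.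
Proof.
apply/measurable_fun_pairP; split; first exact: measurable_coord.
apply: measurable_fun_rV => i; rewrite /comp /uncons_rV/=.
by under eq_fun do rewrite mxE; exact: measurable_coord.
Qed.

Lemma cons_rVK : cancel cons_rV uncons_rV.
Proof.
case=> a x; rewrite /uncons_rV /cons_rV /=; congr pair.
  have -> : ord0 = lshift n ord0 :> 'I_(1 + n) by exact/val_inj.
  by apply: etrans (row_mxEl _ _ _ _) _; rewrite mxE.
apply/rowP => j; rewrite mxE.
have -> : lift ord0 j = rshift 1 j :> 'I_(1 + n) by exact/val_inj.
exact: row_mxEr.
Qed.

Definition lebesgue_step : set 'rV[R]_n.+1 -> \bar R :=
  pushforward (lebesgue_measure \x m)%E cons_rV.

Let lebesgue_step0 : (lebesgue_step set0 = 0)%E.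
Proof. by rewrite /lebesgue_step /pushforward preimage_set0 measure0. Qed.

Let lebesgue_step_ge0 A : (0 <= lebesgue_step A)%E.
Proof. by rewrite /lebesgue_step /pushforward; exact: integral_ge0. Qed.

Let lebesgue_step_sigma_additive : semi_sigma_additive lebesgue_step.
Proof.
move=> F mF tF mUF; rewrite /lebesgue_step /pushforward preimage_bigcup.
apply: measure_semi_sigma_additive.
- by move=> k; rewrite -[X in measurable X]setTI; exact: measurable_cons_rV.
- apply/trivIsetP => /= i j _ _ ij; rewrite -preimage_setI.
  by move/trivIsetP : tF => /(_ _ _ _ _ ij) ->//; rewrite preimage_set0.
- rewrite -preimage_bigcup -[X in measurable X]setTI.
  exact: measurable_cons_rV.
Qed.

HB.instance Definition _ := isMeasure.Build _ _ _ lebesgue_step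
  lebesgue_step0 lebesgue_step_ge0 lebesgue_step_sigma_additive.

Let lebesgue_step_sigma_finite : sigma_finite setT lebesgue_step.
Proof.
have /sigma_finiteP[F [FT ndF Foo]] := sigma_finiteT (@lebesgue_measure R).
have /sigma_finiteP[G [GT ndG Goo]] := sigma_finiteT m.
exists (fun k => uncons_rV @^-1` (F k `*` G k)).
  rewrite -preimage_bigcup (_ : \bigcup_k _ = setT) ?preimage_setT//.
  rewrite -subTset => -[x y] _.
  have [i _ Fix] : (\bigcup_k F k) x by rewrite -FT.
  have [j _ Gjy] : (\bigcup_k G k) y by rewrite -GT.
  exists (maxn i j) => //; split => /=.
    by move: x Fix; exact/subsetPset/ndF/leq_maxl.
  by move: y Gjy; exact/subsetPset/ndG/leq_maxr.
move=> k; have [mF Fk] := Foo k; have [mG Gk] := Goo k; split.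
  rewrite -[X in measurable X]setTI; apply: measurable_uncons_rV => //.
  exact: measurableX.
rewrite /lebesgue_step /pushforward -comp_preimage (_ : _ \o _ = id).
  by rewrite preimage_id product_measure1E// lte_mul_pinfty// ge0_fin_numE.
exact/funext/cons_rVK.
Qed.

HB.instance Definition _ := Measure_isSigmaFinite.Build _ _ _ lebesgue_step
  lebesgue_step_sigma_finite.

End step.

Fixpoint lebesgue_rV n : {sigma_finite_measure set 'rV[R]_n -> \bar R} :=
  if n is n'.+1 then lebesgue_step (lebesgue_rV n') else \d_(0 : 'rV[R]_0).

End lebesgue_measure_rV.

Section function_spaces.
Variables (R : realType) (d : nat).
Implicit Types (f : 'rV[R]_d -> R[i]) (x xi : 'rV[R]_d) (A : set 'rV[R]_d).

Local Notation normc := ComplexField.Normc.normc.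
Local Notation mu := (lebesgue_rV R d).

Definition dot x xi : R := \sum_(j < d) x ord0 j * xi ord0 j.

Definition expi (t : R) : R[i] := cos t +i* sin t.

(* Rintegral is total; the value is the integral of f over A when f is
   integrable on A, which is the only case used. *)
Definition cintegral A f : R[i] :=
  Rintegral mu A (fun x => complex.Re (f x)) +i* Rintegral mu A (fun x => complex.Im (f x)).

(* The numField R[i] is not a normed module over R in the library, so calculus
   on R[i]-valued functions goes through real and imaginary parts. *)
Definition ccontinuous f :=
  continuous (fun x => complex.Re (f x)) /\ continuous (fun x => complex.Im (f x)).

Definition cderivable f x (v : 'rV[R]_d) :=
  derivable (fun x => complex.Re (f x)) x v /\ derivable (fun x => complex.Im (f x)) x v.

Definition partial (j : 'I_d) f x : R[i] :=
  'D_(delta_mx ord0 j) (fun x => complex.Re (f x)) x +i*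
  'D_(delta_mx ord0 j) (fun x => complex.Im (f x)) x.

(* [:: j1; ...; jk] stands for the operator d_j1 ... d_jk. *)
Definition partials (b : seq 'I_d) f := foldr partial f b.

Definition smooth f := forall b : seq 'I_d,
  ccontinuous (partials b f) /\
  forall (j : 'I_d) x, cderivable (partials b f) x (delta_mx ord0 j).

Definition schwartz f := smooth f /\
  forall (a : 'I_d -> nat) (b : seq 'I_d), exists C : R, forall x,
    (\prod_(j < d) `|x ord0 j| ^+ a j) * normc (partials b f x) <= C.

(* Normalization for which (1 - Delta) has symbol 1 + |xi|^2. *)
Definition fourier f xi : R[i] :=
  cintegral setT (fun x => f x * expi (- dot x xi)).

Definition inv_fourier f x : R[i] :=
  ((2 * pi) ^- d)%:C * cintegral setT (fun xi => f xi * expi (dot x xi)).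

Definition fourier_multiplier (m : 'rV[R]_d -> R) f : 'rV[R]_d -> R[i] :=
  inv_fourier (fun xi => (m xi)%:C * fourier f xi).

(* J^s = (1 - Delta)^(s/2). *)
Definition bessel (s : R) : ('rV[R]_d -> R[i]) -> 'rV[R]_d -> R[i] :=
  fourier_multiplier (fun xi => (1 + dot xi xi) `^ (s / 2)).

Definition cLnorm (p : \bar R) f : \bar R :=
  Lnorm mu p (fun x => (normc (f x))%:E).

Definition cube (a : 'rV[R]_d) (l : R) : set 'rV[R]_d :=
  [set x | forall j, a ord0 j <= x ord0 j <= a ord0 j + l].

Definition average A f : R[i] := ((fine (mu A))^-1)%:C * cintegral A f.

Definition mean_oscillation A f : \bar R :=
  ((mu A)^-1 * \int[mu]_(x in A) (normc (f x - average A f))%:E)%E.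

Definition bmo_norm f : \bar R :=
  ereal_sup [set r | exists (a : 'rV[R]_d) (l : R),
    0 < l /\ r = mean_oscillation (cube a l) f].

(* BMO norm of the gradient, as the sum of the norms of its components. *)
Definition bmo_grad f : \bar R := (\sum_(j < d) bmo_norm (partial j f))%E.

End function_spaces.

(* Main.v *)
From HB Require Import structures.
Require Import Defs.
From mathcomp Require Import all_boot all_order all_algebra.
From mathcomp Require Import complex ring lra zify.
From mathcomp Require Import all_classical all_reals all_analysis.
From mathcomp Require Import measurable_realfun ess_sup_inf.

(** Both functions are built from Gaussian wave packets
    G(x) = exp(-t |x|^2 / 2 + i a x_0).

    The function f is a lacunary sum of N packets, c 2^-k times the packet of
    frequency 2^k and width 2^-k. The gradients of its terms are dilates of one
    profile, all of height c. They add up in phase at the origin, so that the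
    derivative of f along x_0 is of size c N there ([packet_head_ge]); but the mean
    oscillation of the k-th term over a cube of side l is at most of order
    c min(2^k l, 1 / (2^k l)), which is summable in k, so that the BMO norm of the
    gradient is of order c ([lacunary_oscillation], [bmo_grad_packet]). As
    s <= 1 + d/p, the k-th term of J^s f is no larger than a bump normalized in L^p
    at scale 2^-k, and at each point such bumps form a sequence that first grows and
    then decays geometrically, so that the L^p norm of J^s f is of order c N^(1/p)
    only ([cLnorm_lacunary], [cLnorm_bessel_packet]). With c of order N^(-1/p) both
    norms are bounded while c N = N^(1 - 1/p) is as large as desired.

    The function g is a single packet of width del and very high frequency lam, with
    the amplitude that makes the L^p norm of J^(s-1) g of order 1
    ([cLnorm_bessel_probe]); its sup norm then tends to 0 as lam grows, because
    s > 1. To leading order in lam the commutator J^s (f g) - f J^s g is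
    s lam^(s-1) g times (1/i) the derivative of f along x_0 ([bwave_asymp],
    [bwave_commutator], [commutator_expansion]). Once N is fixed, del is taken so
    small that this derivative stays of size c N on the cube of side del, then lam so
    large that the error is negligible: the L^p norm of the commutator over that cube
    is of order c N ([commutator_lower]).

    The bounds on J^s of a packet are explicit because its Fourier transform is a
    Gaussian centred at (a, 0, ..., 0) ([bessel_sum_wave]). The expansion in lam is
    the first-order Taylor expansion of the symbol at that centre
    ([symb_remainder]). The decay of J^s of a packet is obtained by d integrations by
    parts in the frequency variable ([transform_derivative], [bwave_decay]); the
    derivatives of the symbol, rescaled to the width r of the packet, become singular
    at the origin as r tends to 0, and d is the largest number of derivatives for
    which the singularity remains integrable for every order of the potential
    ([symbol_factor_le]). Decay of order d suffices, since its p-th power is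
    integrable for p > 1. *)

Set Implicit Arguments.
Unset Strict Implicit.
Unset Printing Implicit Defensive.

Import Order.TTheory GRing.Theory Num.Theory.
Import numFieldNormedType.Exports.

Local Open Scope classical_set_scope.
Local Open Scope ring_scope.
Local Open Scope complex_scope.

(** * Integration over row vectors, coordinate by coordinate *)

Section integral_mono.
Local Open Scope ereal_scope.
Context d (T : measurableType d) (R : realType).
Variable mu : {measure set T -> \bar R}.

Import HBNNSimple.

(** No measurability is required: the integral of a nonnegative function is a
    supremum over the simple functions below it. *)
Lemma ge0_integral_mono (D : set T) (f g : T -> \bar R) :
  (forall x, D x -> 0 <= f x) -> (forall x, D x -> f x <= g x) ->
  \int[mu]_(x in D) f x <= \int[mu]_(x in D) g x.
Proof.
move=> f0 fg; rewrite [leLHS]integral_mkcond [leRHS]integral_mkcond.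
have f0' x : 0 <= (f \_ D) x by exact: erestrict_ge0.
have g0' x : 0 <= (g \_ D) x.
  by apply: erestrict_ge0 => y Dy; apply: (le_trans (f0 _ Dy)); exact: fg.
rewrite !ge0_integralTE//; apply: ereal_sup_le => _ [h hf <-].
exists h => // x.
by apply: (le_trans (hf x)); exact: lee_restrict.
Qed.

End integral_mono.

Lemma measurable_funE d (T : measurableType d) (R : realType) (D : set T)
  (g : T -> R) : measurable_fun D g -> measurable_fun D (fun x => (g x)%:E).
Proof. by move=> mg; exact/measurable_EFinP. Qed.

Section rV_integral.
Variable R : realType.
Local Notation mu n := (lebesgue_rV R n).
Local Notation leb := (@lebesgue_measure R).

Lemma rV_ext n (x y : 'rV[R]_n) : (forall i, x ord0 i = y ord0 i) -> x = y.
Proof. by move=> xy; apply/rowP => i; exact: xy. Qed.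

Definition consr n (v : R) (y : 'rV[R]_n) : 'rV[R]_n.+1 := cons_rV (v, y).

Lemma consr0 n v (y : 'rV[R]_n) : consr v y ord0 ord0 = v.
Proof.
have -> : ord0 = lshift n ord0 :> 'I_(1 + n) by exact/val_inj.
by rewrite /consr /cons_rV (@row_mxEl _ 1 1 n) mxE.
Qed.

Lemma consrS n v (y : 'rV[R]_n) j : consr v y ord0 (lift ord0 j) = y ord0 j.
Proof.
have -> : lift ord0 j = rshift 1 j :> 'I_(1 + n) by exact/val_inj.
by rewrite /consr /cons_rV (@row_mxEr _ 1 1 n).
Qed.

Lemma ge0_integral_cons n (f : 'rV[R]_n.+1 -> \bar R) :
  measurable_fun [set: 'rV[R]_n.+1] f -> (forall x, 0 <= f x)%E ->
  (\int[mu n.+1]_x f x = \int[leb]_v \int[mu n]_y f (consr v y))%E.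
Proof.
move=> mf f0.
rewrite [LHS](@ge0_integral_pushforward _ _ _ _ _ _
  (measurable_cons_rV (R:=R) (n:=n)) _ setT f)//.
rewrite preimage_setT fubini_tonelli1//; last by move=> x; exact: f0.
exact: measurableT_comp mf (measurable_cons_rV (R:=R) (n:=n)).
Qed.

Section fubini_cons.
Variables (n : nat) (f : 'rV[R]_n.+1 -> R).
Hypothesis fi : (mu n.+1).-integrable [set: 'rV[R]_n.+1] (EFin \o f).

Let mf : measurable_fun [set: 'rV[R]_n.+1] (EFin \o f).
Proof. by have /integrableP[] := fi. Qed.

Let mfc : measurable_fun setT ((EFin \o f) \o @cons_rV R n).
Proof. exact: measurableT_comp mf (measurable_cons_rV (R:=R) (n:=n)). Qed.

Let fci : (leb \x mu n)%E.-integrable setT ((EFin \o f) \o @cons_rV R n).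
Proof.
apply/integrableP; split => //.
move: fi => /integrableP[_].
rewrite (@ge0_integral_pushforward _ _ _ _ _ _
  (measurable_cons_rV (R:=R) (n:=n)) _ setT (fun x => `|(f x)%:E|%E))//.
exact: measurableT_comp.
Qed.

Lemma integral_cons :
  (\int[mu n.+1]_x (f x)%:E = \int[leb]_v \int[mu n]_y (f (consr v y))%:E)%E.
Proof.
rewrite [RHS](integral12_prod_meas1 fci).
by rewrite [LHS](@integral_pushforward _ _ _ _ _ _
  (measurable_cons_rV (R:=R) (n:=n)) _ _ (fun x => (f x)%:E)).
Qed.

Lemma integral_cons_sym :
  (\int[mu n.+1]_x (f x)%:E = \int[mu n]_y \int[leb]_v (f (consr v y))%:E)%E.
Proof.
rewrite [RHS](integral21_prod_meas1 fci).
by rewrite [LHS](@integral_pushforward _ _ _ _ _ _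
  (measurable_cons_rV (R:=R) (n:=n)) _ _ (fun x => (f x)%:E)).
Qed.

Lemma ae_integrable_cons :
  {ae leb, forall v, (mu n).-integrable [set: 'rV[R]_n]
                       (EFin \o (fun y => f (consr v y)))}.
Proof. exact: (ae_integrable1 fci). Qed.

Lemma measurable_integral_cons :
  measurable_fun [set: measurableTypeR R]
    (fun v => \int[mu n]_y (f (consr v y))%:E)%E.
Proof. exact: (measurable_fubini_F fci). Qed.

End fubini_cons.

Lemma measurable_prod_coord n (h : 'I_n -> R -> R) :
  (forall j, measurable_fun [set: R] (h j)) ->
  measurable_fun [set: 'rV[R]_n] (fun x => \prod_j h j (x ord0 j)).
Proof.
move=> mh; apply: measurable_prod => j _.
exact: (measurableT_comp (mh j) (measurable_coord j)).
Qed.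

Lemma ge0_integral_prod n (h : 'I_n -> R -> R) (c : 'I_n -> R) :
  (forall j, measurable_fun [set: R] (h j)) -> (forall j v, 0 <= h j v) ->
  (forall j, \int[leb]_v (h j v)%:E = (c j)%:E)%E ->
  (\int[mu n]_x (\prod_j h j (x ord0 j))%:E = (\prod_j c j)%:E)%E.
Proof.
elim: n h c => [|n IH] h c mh h0 hc.
  rewrite /= integral_dirac//; last exact: measurable_funE (measurable_prod_coord mh).
  by rewrite diracE mem_set// mul1e !big_ord0.
rewrite ge0_integral_cons//; last 2 first.
- exact: measurable_funE (measurable_prod_coord mh).
- by move=> x; rewrite lee_fin; exact: prodr_ge0.
transitivity (\int[leb]_v ((h ord0 v)%:E * (\prod_j c (lift ord0 j))%:E))%E.
  apply: eq_integral => v _.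
  rewrite -(IH (fun j => h (lift ord0 j)))// -ge0_integralZl//; last 3 first.
  - apply: measurable_funE.
    exact: (measurable_prod_coord (h := fun j => h (lift ord0 j))).
  - by move=> x _; rewrite lee_fin; exact: prodr_ge0.
  - by rewrite lee_fin.
  apply: eq_integral => y _; rewrite big_ord_recl consr0 EFinM.
  by congr (_ * (_)%:E)%E; apply: eq_bigr => j _; rewrite consrS.
rewrite ge0_integralZr//; last 3 first.
- exact: measurable_funE (mh ord0).
- by move=> x _; rewrite lee_fin.
- rewrite lee_fin; apply: prodr_ge0 => j _; rewrite -lee_fin -hc.
  by apply: integral_ge0 => v _; rewrite lee_fin.
by rewrite hc big_ord_recl EFinM.
Qed.

Lemma ge0_integral_prod_le n (h : 'I_n -> R -> R) (c : 'I_n -> R) :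
  (forall j, measurable_fun [set: R] (h j)) -> (forall j v, 0 <= h j v) ->
  (forall j, \int[leb]_v (h j v)%:E <= (c j)%:E)%E ->
  (\int[mu n]_x (\prod_j h j (x ord0 j))%:E <= (\prod_j c j)%:E)%E.
Proof.
move=> mh h0 hc; pose c' j := fine (\int[leb]_v (h j v)%:E)%E.
have i0 j : (0 <= \int[leb]_v (h j v)%:E)%E.
  by apply: integral_ge0 => v _; rewrite lee_fin.
have ic j : (\int[leb]_v (h j v)%:E = (c' j)%:E)%E.
  by rewrite fineK// ge0_fin_numE// (le_lt_trans (hc j))// ltry.
rewrite (ge0_integral_prod mh h0 ic) lee_fin; apply: ler_prod => j _.
by rewrite -!lee_fin -ic i0 hc.
Qed.

Definition tailr n (x : 'rV[R]_n.+1) : 'rV[R]_n := \row_j x ord0 (lift ord0 j).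

Lemma tailr_consr n v (y : 'rV[R]_n) : tailr (consr v y) = y.
Proof. by apply/rV_ext => j; rewrite mxE consrS. Qed.

Lemma measurable_tailr n : measurable_fun [set: 'rV[R]_n.+1] (@tailr n).
Proof.
apply: measurable_fun_rV => j; under eq_fun do rewrite mxE.
exact: measurable_coord.
Qed.

Section integral_mul_cons.
Variables (n : nat) (u : R -> R) (w : 'rV[R]_n -> R).
Hypotheses (ui : leb.-integrable [set: measurableTypeR R] (EFin \o u))
  (wi : (mu n).-integrable [set: 'rV[R]_n] (EFin \o w)).
Let f := fun x : 'rV[R]_n.+1 => u (x ord0 ord0) * w (tailr x).

Let mu_ : measurable_fun [set: R] u.
Proof. by have /integrableP[/measurable_EFinP] := ui. Qed.
Let mw : measurable_fun [set: 'rV[R]_n] w.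
Proof. by have /integrableP[/measurable_EFinP] := wi. Qed.

Let mf : measurable_fun [set: 'rV[R]_n.+1] f.
Proof.
apply: measurable_funM.
  exact: (measurableT_comp mu_ (measurable_coord ord0)).
exact: (measurableT_comp mw (@measurable_tailr n)).
Qed.

Lemma integrable_mul_cons : (mu n.+1).-integrable [set: 'rV[R]_n.+1] (EFin \o f).
Proof.
apply/integrableP; split; first exact: measurable_funE.
rewrite ge0_integral_cons//; last first.
  by apply/measurableT_comp => //; exact: measurable_funE.
have wf : (\int[mu n]_y `|(w y)%:E| < +oo)%E by have /integrableP[] := wi.
have uf : (\int[leb]_y `|(u y)%:E| < +oo)%E by have /integrableP[] := ui.
rewrite (_ : (fun _ => _) =
    (fun v => `|(u v)%:E| * \int[mu n]_y `|(w y)%:E|))%E; last first.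
  apply/funext => v; rewrite -ge0_integralZl//; last first.
    by apply/measurableT_comp => //; exact: measurable_funE.
  by apply: eq_integral => y _; rewrite /f /= consr0 tailr_consr normrM EFinM.
rewrite ge0_integralZr//; last 2 first.
- by apply/measurableT_comp => //; exact: measurable_funE.
- exact: integral_ge0.
rewrite lte_mul_pinfty//; first exact: integral_ge0.
by rewrite ge0_fin_numE//; exact: integral_ge0.
Qed.

Lemma Rintegral_mul_cons :
  Rintegral (mu n.+1) setT f = Rintegral leb setT u * Rintegral (mu n) setT w.
Proof.
rewrite {1}/Rintegral integral_cons; last exact: integrable_mul_cons.
rewrite (_ : (fun _ => _) =
    (fun v => (u v)%:E * \int[mu n]_y (w y)%:E))%E; last first.
  apply/funext => v; rewrite -integralZl//.
  by apply: eq_integral => y _; rewrite /f /= consr0 tailr_consr EFinM.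
have wf : (\int[mu n]_y (w y)%:E)%E \is a fin_num by exact: integrable_fin_num.
have uf : (\int[leb]_y (u y)%:E)%E \is a fin_num by exact: integrable_fin_num.
by rewrite -(fineK wf) integralZr// fineM.
Qed.

End integral_mul_cons.

Definition upd n (x : 'rV[R]_n) (j : 'I_n) (v : R) : 'rV[R]_n :=
  \row_i (if i == j then v else x ord0 i).

Lemma updE n (x : 'rV[R]_n) j v i :
  upd x j v ord0 i = if i == j then v else x ord0 i.
Proof. by rewrite mxE. Qed.

Lemma upd_id n (x : 'rV[R]_n) j : upd x j (x ord0 j) = x.
Proof. by apply/rV_ext => i; rewrite mxE; case: eqP => [->|]. Qed.

(** Fubini with the inner integral in direction j, by induction on the dimension:
    first coordinates are split off until j is the first one. The slices of f are
    integrable almost everywhere only, hence the comparison up to null sets. *)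
Lemma integral_slice_eq0 n (f : 'rV[R]_n -> R) (j : 'I_n) :
  (mu n).-integrable [set: 'rV[R]_n] (EFin \o f) ->
  (forall x, \int[leb]_v (f (upd x j v))%:E = 0)%E ->
  (\int[mu n]_x (f x)%:E = 0)%E.
Proof.
elim: n f j => [|n IH] f j fi f0; first by case: j f0.
case: (unliftP ord0 j) f0 => [j' ->|->] f0.
- rewrite integral_cons//.
  rewrite (@ae_eq_integral _ _ _ leb setT (cst 0%E))//; last 2 first.
  + exact: measurable_integral_cons.
  + have := ae_integrable_cons fi.
    apply: filterS; first exact: (ae_filter_ringOfSetsType leb).
    move=> v fvi _ /=.
    apply: (IH _ j') => // y; rewrite -[RHS](f0 (consr v y)).
    apply: eq_integral => t _; congr (f _)%:E; apply/rV_ext => i.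
    case: (unliftP ord0 i) => [i' ->|->].
      by rewrite consrS !updE consrS (inj_eq (@lift_inj _ ord0)).
    by rewrite consr0 updE consr0.
  by rewrite integral0.
- rewrite integral_cons_sym// -[RHS](integral0 (mu n) setT).
  apply: eq_integral => y _; rewrite -[RHS](f0 (consr 0 y)).
  apply: eq_integral => t _; congr (f _)%:E; apply/rV_ext => i.
  case: (unliftP ord0 i) => [i' ->|->].
    by rewrite consrS !updE consrS.
  by rewrite consr0 updE.
Qed.

End rV_integral.

(** * Complex-valued functions and their integrals *)

Section complex_basics.
Variable R : realType.
Implicit Types (z w : R[i]) (a b t : R).
Local Notation normc := ComplexField.Normc.normc.

Lemma complex_ext z w :
  complex.Re z = complex.Re w -> complex.Im z = complex.Im w -> z = w.
Proof. by case: z w => a b [c e] /= -> ->. Qed.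

Lemma creD z w : complex.Re (z + w) = complex.Re z + complex.Re w.
Proof. by case: z w => a b []. Qed.

Lemma cimD z w : complex.Im (z + w) = complex.Im z + complex.Im w.
Proof. by case: z w => a b []. Qed.

Lemma creM z w : complex.Re (z * w) =
  complex.Re z * complex.Re w - complex.Im z * complex.Im w.
Proof. by case: z w => a b []. Qed.

Lemma cimM z w : complex.Im (z * w) =
  complex.Re z * complex.Im w + complex.Im z * complex.Re w.
Proof. by case: z w => a b []. Qed.

Lemma realCM a b : (a * b)%:C = a%:C * b%:C :> R[i].
Proof. exact: rmorphM. Qed.

Lemma creZ a z : complex.Re (a%:C * z) = a * complex.Re z.
Proof. by rewrite creM /= mul0r subr0. Qed.

Lemma cimZ a z : complex.Im (a%:C * z) = a * complex.Im z.
Proof. by rewrite cimM /= mul0r addr0. Qed.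

Lemma Re_sum I (s : seq I) (F : I -> R[i]) :
  complex.Re (\sum_(i <- s) F i) = \sum_(i <- s) complex.Re (F i).
Proof. by elim/big_ind2 : _ => // x1 x2 y1 y2 <- <-; rewrite creD. Qed.

Lemma Im_sum I (s : seq I) (F : I -> R[i]) :
  complex.Im (\sum_(i <- s) F i) = \sum_(i <- s) complex.Im (F i).
Proof. by elim/big_ind2 : _ => // x1 x2 y1 y2 <- <-; rewrite cimD. Qed.

Lemma normc_ge0 z : 0 <= normc z.
Proof. by case: z => a b; exact: sqrtr_ge0. Qed.

Lemma normc_Re z : `|complex.Re z| <= normc z.
Proof.
by case: z => a b /=; rewrite -sqrtr_sqr ler_wsqrtr// lerDl sqr_ge0.
Qed.

Lemma normc_Im z : `|complex.Im z| <= normc z.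
Proof.
by case: z => a b /=; rewrite -sqrtr_sqr ler_wsqrtr// lerDr sqr_ge0.
Qed.

Lemma normc_le_ReIm z : normc z <= `|complex.Re z| + `|complex.Im z|.
Proof.
case: z => a b /=; rewrite -[leRHS]ger0_norm ?addr_ge0//.
rewrite -[leRHS]sqrtr_sqr ler_wsqrtr// sqrrD !real_normK ?num_real//.
by rewrite lerD2r lerDl mulrn_wge0// mulr_ge0.
Qed.

Lemma normc_real a : normc a%:C = `|a|.
Proof. by rewrite /= expr0n/= addr0 sqrtr_sqr. Qed.

Lemma normcZ a z : normc (a%:C * z) = `|a| * normc z.
Proof. by rewrite ComplexField.Normc.normcM normc_real. Qed.

Lemma normc_expi t : normc (expi t) = 1.
Proof. by rewrite /= cos2Dsin2 sqrtr1. Qed.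

Lemma expi0 : expi 0 = 1 :> R[i].
Proof. by rewrite /expi cos0 sin0. Qed.

Lemma expiD a b : expi (a + b) = expi a * expi b.
Proof.
by apply: complex_ext; rewrite ?creM ?cimM /= ?cosD ?sinD//; ring.
Qed.

Lemma expi_sum n (F : 'I_n -> R) : expi (\sum_j F j) = \prod_j expi (F j).
Proof. by elim/big_ind2 : _ => [|x1 x2 y1 y2 <- <-|//]; rewrite ?expi0 ?expiD. Qed.

Lemma real_complex_prod n (F : 'I_n -> R) : (\prod_j F j)%:C = \prod_j (F j)%:C.
Proof. exact: rmorph_prod. Qed.

Lemma normc_sum I (s : seq I) (F : I -> R[i]) :
  normc (\sum_(i <- s) F i) <= \sum_(i <- s) normc (F i).
Proof.
elim/big_ind2 : _ => [|x1 x2 y1 y2 h1 h2|//].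
  by rewrite ComplexField.Normc.normc0.
exact: le_trans (le_normcD _ _) (lerD h1 h2).
Qed.

Lemma prod_expR n (F : 'I_n -> R) : \prod_j expR (F j) = expR (\sum_j F j).
Proof. by rewrite expR_sum. Qed.

End complex_basics.

Section complex_integral.
Variable R : realType.
Local Notation mu n := (lebesgue_rV R n).
Local Notation leb := (@lebesgue_measure R).
Local Notation normc := ComplexField.Normc.normc.

Definition cintegrable n (f : 'rV[R]_n -> R[i]) :=
  (mu n).-integrable [set: 'rV[R]_n] (EFin \o (fun x => complex.Re (f x))) /\
  (mu n).-integrable [set: 'rV[R]_n] (EFin \o (fun x => complex.Im (f x))).

Definition cintegrable1 (h : R -> R[i]) :=
  leb.-integrable [set: measurableTypeR R] (EFin \o (fun v => complex.Re (h v))) /\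
  leb.-integrable [set: measurableTypeR R] (EFin \o (fun v => complex.Im (h v))).

Definition cintegral1 (h : R -> R[i]) : R[i] :=
  Rintegral leb setT (fun v => complex.Re (h v)) +i*
  Rintegral leb setT (fun v => complex.Im (h v)).

Lemma integrableDr d (T : measurableType d) (m : {measure set T -> \bar R})
    (f g : T -> R) :
  m.-integrable setT (EFin \o f) -> m.-integrable setT (EFin \o g) ->
  m.-integrable setT (EFin \o (fun x => f x + g x)).
Proof. by move=> fi gi; exact: (integrableD measurableT fi gi). Qed.

Lemma integrableBr d (T : measurableType d) (m : {measure set T -> \bar R})
    (f g : T -> R) :
  m.-integrable setT (EFin \o f) -> m.-integrable setT (EFin \o g) ->
  m.-integrable setT (EFin \o (fun x => f x - g x)).
Proof. by move=> fi gi; exact: (integrableB measurableT fi gi). Qed.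

(** The real and imaginary parts of a product of two complex functions of separate
    variables are sums of two real products, to which Fubini applies. *)
Lemma cintegral_prod n (h : 'I_n -> R -> R[i]) :
  (forall j, cintegrable1 (h j)) ->
  cintegrable (fun x => \prod_j h j (x ord0 j)) /\
  cintegral setT (fun x => \prod_j h j (x ord0 j)) = \prod_j cintegral1 (h j).
Proof.
elim: n h => [|n IH] h hi.
  have -> : (fun x : 'rV[R]_0 => \prod_(j < 0) h j (x ord0 j)) = cst 1.
    by apply/funext => x; rewrite big_ord0.
  split.
    by split; apply: finite_measure_integrable_cst.
  rewrite big_ord0 /cintegral /Rintegral /=.
  by apply: complex_ext => /=; rewrite integral_dirac// diracE mem_set// mul1e.
have [[Pr Pi] Pe] := IH (fun j => h (lift ord0 j)) (fun j => hi _).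
pose P : 'rV[R]_n -> R[i] := fun x => \prod_j h (lift ord0 j) (x ord0 j).
rewrite -/P in Pr Pi Pe.
have FE : (fun x : 'rV[R]_n.+1 => \prod_j h j (x ord0 j)) =
    fun x => h ord0 (x ord0 ord0) * P (tailr x).
  apply/funext => x; rewrite big_ord_recl; congr (_ * _).
  by apply: eq_bigr => j _; rewrite mxE.
have [hr hm] := hi ord0.
pose u := fun v => complex.Re (h ord0 v); pose w := fun v => complex.Im (h ord0 v).
pose p := fun x => complex.Re (P x); pose q := fun x => complex.Im (P x).
rewrite FE big_ord_recl -Pe.
have RE : (fun x : 'rV[R]_n.+1 => complex.Re (h ord0 (x ord0 ord0) * P (tailr x))) =
    fun x : 'rV[R]_n.+1 => u (x ord0 ord0) * p (tailr x) - w (x ord0 ord0) * q (tailr x).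
  by apply/funext => x; rewrite creM.
have IE : (fun x : 'rV[R]_n.+1 => complex.Im (h ord0 (x ord0 ord0) * P (tailr x))) =
    fun x : 'rV[R]_n.+1 => u (x ord0 ord0) * q (tailr x) + w (x ord0 ord0) * p (tailr x).
  by apply/funext => x; rewrite cimM.
have up := integrable_mul_cons hr Pr; have wq := integrable_mul_cons hm Pi.
have uq := integrable_mul_cons hr Pi; have wp := integrable_mul_cons hm Pr.
split.
  by rewrite /cintegrable RE IE; split; [exact: integrableBr|exact: integrableDr].
rewrite /cintegral RE IE; apply: complex_ext.
  rewrite [LHS](RintegralB _ up wq)// creM.
  by rewrite (Rintegral_mul_cons hr Pr) (Rintegral_mul_cons hm Pi).
rewrite [LHS](RintegralD _ uq wp)// cimM.
by rewrite (Rintegral_mul_cons hr Pi) (Rintegral_mul_cons hm Pr).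
Qed.

End complex_integral.

(** * Calculus and Gaussians on the line *)

Section one_dim.
Variable R : realType.
Local Notation leb := (@lebesgue_measure R).
Implicit Types (F f : R -> R) (a b v y tau : R).

(** The fundamental theorem of calculus on [-n, n], then dominated convergence. *)
Lemma integral_derive_eq0 F f :
  (forall v, is_derive v (1 : R) F (f v)) -> continuous f ->
  leb.-integrable [set: measurableTypeR R] (EFin \o f) ->
  F n%:R @[n --> \oo] --> (0 : R) -> F (- n%:R) @[n --> \oo] --> (0 : R) ->
  (\int[leb]_v (f v)%:E = 0)%E.
Proof.
move=> dF cf fi Fy FNy.
pose D (n : nat) : set R := `[- n.+1%:R, n.+1%:R]%classic.
have Ff n : (\int[leb]_(v in D n) (f v)%:E = (F n.+1%:R - F (- n.+1%:R))%:E)%E.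
  have cF : continuous F.
    by move=> v; apply/differentiable_continuous/derivable1_diffP; case: (dF v).
  rewrite (@continuous_FTC2 _ f F)//.
  - by rewrite -subr_gt0 opprK addr_gt0.
  - exact: continuous_subspaceT.
  - split => [v _||]; first by case: (dF v).
    + exact/cvg_at_right_filter/cF.
    + exact/cvg_at_left_filter/cF.
  - by move=> v _; rewrite derive1E; have [_ ->] := dF v.
have mf : measurable_fun [set: measurableTypeR R] f.
  by have /integrableP[/measurable_EFinP] := fi.
have mfn n : measurable_fun [set: measurableTypeR R]
    (fun v => ((f \_ (D n)) v)%:E).
  apply: measurable_funE; apply/(measurable_restrictT _ _).1 => //.
    exact: measurable_itv.
  exact: measurable_funTS mf.
have fnf : {ae leb, forall v, [set: R] v ->
    (fun n => ((f \_ (D n)) v)%:E) @ \oo --> (f v)%:E}.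
  apply: aeW => v _; apply: cvg_near_cst.
  have [N _ HN] := nbhs_infty_ger `|v|.
  exists N => // n Nn /=; rewrite patchE mem_set// /D /= in_itv /=.
  by rewrite -ler_norml (le_trans (HN n Nn))// ler_nat.
have domf : {ae leb, forall v n, [set: R] v ->
    (`|((f \_ (D n)) v)%:E| <= `|(f v)%:E|)%E}.
  apply: aeW => v n _; rewrite patchE lee_fin.
  by case: ifP => // _; rewrite normr0.
have [_ _] := @dominated_convergence _ _ _ leb setT measurableT
  (fun n v => ((f \_ (D n)) v)%:E) (fun v => (f v)%:E) (fun v => `|(f v)%:E|)%E
  mfn (measurable_funE mf) fnf (integrable_abse fi) domf.
have -> : (fun n => \int[leb]_v ((f \_ (D n)) v)%:E)%E =
    (fun n => (F n.+1%:R - F (- n.+1%:R))%:E).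
  apply/funext => n; rewrite -Ff [RHS]integral_mkcond.
  by apply: eq_integral => v _; rewrite restrict_EFin.
move=> cvgf.
have cvg0 : (F n.+1%:R - F (- n.+1%:R))%:E @[n --> \oo] --> 0%E.
  apply: cvg_EFin; first exact: nearW.
  rewrite [X in _ --> X](_ : _ = 0 - 0 :> R); last by rewrite subr0.
  apply: cvgB.
    by rewrite -(cvg_shiftS (fun n => F n%:R)) in Fy.
  by rewrite -(cvg_shiftS (fun n => F (- n%:R))) in FNy.
exact: (cvg_unique _ cvgf cvg0).
Qed.


(** In the derivation rules below the derivative is a separate argument of
    [is_derive], to be brought into the desired form by this lemma. *)
Lemma Deq F v (dF dF' : R) : is_derive v (1 : R) F dF -> dF = dF' ->
  is_derive v (1 : R) F dF'.
Proof. by move=> h <-. Qed.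

Lemma Dcst a v : is_derive v (1 : R) (fun=> a) 0.
Proof. exact: is_derive_cst. Qed.

Lemma Did v : is_derive v (1 : R) (fun u => u) 1.
Proof. exact: is_derive_id. Qed.

Lemma Dadd F f v (dF df : R) : is_derive v (1 : R) F dF ->
  is_derive v (1 : R) f df -> is_derive v (1 : R) (fun u => F u + f u) (dF + df).
Proof. exact: is_deriveD. Qed.

Lemma Dmul F f v (dF df : R) : is_derive v (1 : R) F dF ->
  is_derive v (1 : R) f df ->
  is_derive v (1 : R) (fun u => F u * f u) (F v * df + f v * dF).
Proof. exact: is_deriveM. Qed.

Lemma Dcmul a F v (dF : R) : is_derive v (1 : R) F dF ->
  is_derive v (1 : R) (fun u => a * F u) (a * dF).
Proof.
by move=> /(Dmul (Dcst a v)) h; apply: (Deq h); rewrite mulr0 addr0.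
Qed.

Lemma Dcomp F f v (dF df : R) : is_derive (f v) (1 : R) F dF ->
  is_derive v (1 : R) f df -> is_derive v (1 : R) (fun u => F (f u)) (dF * df).
Proof. exact: is_derive1_comp. Qed.

Lemma Dexp f v (df : R) : is_derive v (1 : R) f df ->
  is_derive v (1 : R) (fun u => expR (f u)) (expR (f v) * df).
Proof. exact: (Dcomp (is_derive_expR _)). Qed.

Lemma Dcos f v (df : R) : is_derive v (1 : R) f df ->
  is_derive v (1 : R) (fun u => cos (f u)) (- sin (f v) * df).
Proof. exact: (Dcomp (is_derive_cos _)). Qed.

Lemma Dsin f v (df : R) : is_derive v (1 : R) f df ->
  is_derive v (1 : R) (fun u => sin (f u)) (cos (f v) * df).
Proof. exact: (Dcomp (is_derive_sin _)). Qed.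

Lemma Daff a b v : is_derive v (1 : R) (fun u => a * (u - b)) a.
Proof.
have h := Dcmul a (Dadd (Did v) (Dcst (- b) v)).
by apply: (Deq h); rewrite addr0 mulr1.
Qed.

Lemma is_derive_continuous F (dF : R -> R) :
  (forall v, is_derive v (1 : R) F (dF v)) -> continuous F.
Proof.
by move=> h v; apply/differentiable_continuous/derivable1_diffP; case: (h v).
Qed.

Definition gs tau b v := expR (- (tau * (v - b) ^+ 2)).

Lemma gs_ge0 tau b v : 0 <= gs tau b v. Proof. exact: expR_ge0. Qed.

Lemma is_derive_gs tau b v :
  is_derive v (1 : R) (gs tau b) (- (2 * tau * (v - b)) * gs tau b v).
Proof.
have h1 := Daff 1 b v.
have h := Dexp (Dcmul (- tau) (Dmul h1 h1)).
have E u : gs tau b u = expR (- tau * (1 * (u - b) * (1 * (u - b)))).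
  by rewrite /gs; congr expR; ring.
rewrite (_ : gs tau b = fun u => expR (- tau * (1 * (u - b) * (1 * (u - b))))).
  by apply: (Deq h); ring.
exact/funext.
Qed.

Lemma continuous_gs tau b : continuous (gs tau b).
Proof. exact: is_derive_continuous (is_derive_gs tau b). Qed.

Lemma measurable_gs tau b : measurable_fun [set: R] (gs tau b).
Proof. exact: continuous_measurable_fun (@continuous_gs tau b). Qed.

Lemma integral_gs tau b : 0 < tau ->
  (\int[leb]_v (gs tau b v)%:E = (Num.sqrt (pi / tau))%:E)%E.
Proof.
move=> t0; pose s : R := Num.sqrt (2 * tau)^-1.
have s2 : s ^+ 2 *+ 2 = tau^-1.
  rewrite sqr_sqrtr ?invr_ge0 ?mulr_ge0 ?ltW//.
  by rewrite invfM mulrC -mulr_natr -mulrA mulVf ?mulr1.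
have s0 : s != 0 by rewrite gt_eqF// sqrtr_gt0 invr_gt0 mulr_gt0.
have E v : gs tau b v = Num.sqrt (pi / tau) * normal_pdf b s v.
  rewrite normal_pdfE// /normal_peak /normal_fun s2 invrK.
  have -> : s ^+ 2 * pi *+ 2 = pi / tau by rewrite mulrC -mulrnAr s2.
  rewrite mulrA mulfV ?mul1r; last by rewrite gt_eqF// sqrtr_gt0 divr_gt0// pi_gt0.
  by rewrite /gs mulNr mulrC.
under eq_integral do rewrite E EFinM.
rewrite ge0_integralZl//; last 2 first.
- exact: (measurable_funE (measurable_normal_pdf b s)).
- by move=> v _; rewrite lee_fin normal_pdf_ge0.
by rewrite integral_normal_pdf// mule1.
Qed.

Lemma integrable_gs tau b : 0 < tau ->
  leb.-integrable [set: measurableTypeR R] (EFin \o gs tau b).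
Proof.
move=> t0; apply/integrableP; split.
  exact: (measurable_funE (measurable_gs tau b)).
rewrite (_ : (fun _ => _) = (fun v => (gs tau b v)%:E)); last first.
  by apply/funext => v /=; rewrite ger0_norm// gs_ge0.
by rewrite integral_gs// ltry.
Qed.

Lemma integrable_le_gs F C tau b : 0 < tau -> measurable_fun [set: R] F ->
  (forall v, `|F v| <= C * gs tau b v) ->
  leb.-integrable [set: measurableTypeR R] (EFin \o F).
Proof.
move=> t0 mF FC.
apply: (@le_integrable _ _ _ leb setT measurableT _ (fun v => C%:E * (gs tau b v)%:E)%E).
- exact: measurable_funE mF.
- move=> v _ /=; rewrite lee_fin (le_trans (FC v))// ler_norm//.
- exact: integrableZl (integrable_gs b t0).
Qed.

Lemma gs_small tau b (e : R) : 0 < tau -> 0 < e ->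
  \forall n \near \oo, forall v, n%:R <= `|v| -> gs tau b v <= e.
Proof.
move=> t0 e0; near=> n => v nv.
have nb : 1 + (tau * e)^-1 <= `|v - b|.
  have : 1 + (tau * e)^-1 + `|b| <= n%:R.
    by near: n; exact: nbhs_infty_ger.
  have := lerB_dist v b; lra.
have i0 : 0 < (tau * e)^-1 by rewrite invr_gt0 mulr_gt0.
have sq : (tau * e)^-1 <= (v - b) ^+ 2.
  rewrite -real_normK ?num_real//.
  apply: (@le_trans _ _ (`|v - b| * 1)); first lra.
  by rewrite expr2 ler_pM2l; lra.
rewrite /gs expRN -[e]invrK lef_pV2 ?posrE ?invr_gt0 ?expR_gt0//.
apply: le_trans (expR_ge1Dx _); rewrite -[leLHS]add0r lerD//.
rewrite -ler_pdivrMl// -invfM.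
by rewrite mulrC mulrC.
Unshelve. all: by end_near. Qed.

Lemma integral_derive_gs_eq0 F f C C' tau b : 0 < tau ->
  (forall v, is_derive v (1 : R) F (f v)) -> continuous f ->
  (forall v, `|F v| <= C * gs tau b v) -> (forall v, `|f v| <= C' * gs tau b v) ->
  (\int[leb]_v (f v)%:E = 0)%E.
Proof.
move=> t0 dF cf FC fC.
have C0 : 0 <= C.
  have := le_trans (normr_ge0 _) (FC 0); rewrite pmulr_lge0 ?expR_gt0//.
have C1 : 0 < C + 1 by lra.
have lim (u : nat -> R) : (forall n, n%:R <= `|u n|) -> F (u n) @[n --> \oo] --> (0 : R).
  move=> nu; apply/cvgrPdist_le => e e0; near=> n.
  rewrite sub0r normrN (le_trans (FC _))//.
  have : gs tau b (u n) <= e / (C + 1).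
    near: n; have := gs_small b t0 (divr_gt0 e0 C1).
    by apply: filterS => n; apply; exact: nu.
  rewrite ler_pdivlMr//.
  by have := gs_ge0 tau b (u n); nra.
apply: (integral_derive_eq0 dF cf).
- apply: (integrable_le_gs t0 _ fC); exact: continuous_measurable_fun.
- by apply: lim => n; rewrite ger0_norm.
- by apply: lim => n; rewrite normrN ger0_norm.
Unshelve. all: by end_near. Qed.

End one_dim.

(** * The Fourier transform of a Gaussian on the line *)

Section char_fun.
Variable R : realType.
Local Notation leb := (@lebesgue_measure R).
Implicit Types (F f : R -> R) (a b v y tau : R).

(** Exponentials dominate polynomials, in the multiplicative form in which
    Gaussians absorb polynomial factors. *)
Lemma poly_le_expR m (k : R) : 0 < k ->
  exists2 C : R, 0 <= C & forall x, 0 <= x -> (1 + x) ^+ m <= C * expR (k * x).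
Proof.
elim: m k => [|m IH] k k0.
  by exists 1 => // x x0; rewrite expr0 mul1r -expR0 ler_expR mulr_ge0// ltW.
have k2 : 0 < k / 2 by rewrite divr_gt0.
have [D D0 HD] := IH _ k2.
have i0 : 0 < (k / 2)^-1 by rewrite invr_gt0.
exists ((1 + (k / 2)^-1) * D) => [|x x0]; first by rewrite mulr_ge0// addr_ge0// ltW.
rewrite exprS.
have -> : (1 + (k / 2)^-1) * D * expR (k * x) =
    ((1 + (k / 2)^-1) * expR (k / 2 * x)) * (D * expR (k / 2 * x)).
  by rewrite (_ : k * x = k / 2 * x + k / 2 * x) ?expRD; [ring|field].
apply: ler_pM; [lra|by rewrite exprn_ge0//; lra| |exact: HD].
apply: (@le_trans _ _ ((1 + (k / 2)^-1) * (1 + k / 2 * x))); last first.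
  by rewrite ler_pM2l ?expR_ge1Dx//; lra.
have -> : (1 + (k / 2)^-1) * (1 + k / 2 * x) = 1 + x + (k / 2)^-1 + k / 2 * x.
  by field; rewrite gt_eqF.
have : 0 <= k / 2 * x by rewrite mulr_ge0// ltW.
lra.
Qed.

(** A polynomial factor costs half of the exponent of a Gaussian. *)
Lemma poly_gs m tau : 0 < tau ->
  exists2 C : R, 0 <= C &
    forall b v, (1 + (v - b) ^+ 2) ^+ m * gs tau b v <= C * gs (tau / 2) b v.
Proof.
move=> t0; have t2 : 0 < tau / 2 by rewrite divr_gt0.
have [C C0 HC] := poly_le_expR m t2; exists C => // b v.
have -> : gs tau b v = expR (- (tau / 2 * (v - b) ^+ 2)) * gs (tau / 2) b v.
  by rewrite /gs -expRD; congr expR; field.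
rewrite mulrA ler_wpM2r ?gs_ge0//.
by rewrite expRN ler_pdivrMr ?expR_gt0//; apply: HC; exact: sqr_ge0.
Qed.

Lemma norm_le_1Dsqr v : `|v| <= 1 + v ^+ 2.
Proof. by rewrite -[v ^+ 2]real_normK ?num_real//; have := normr_ge0 v; nra. Qed.

Variables tau b : R.
Hypothesis t0 : 0 < tau.
Let g := gs (tau / 2) b.
Let t2 : 0 < tau / 2. Proof. by rewrite divr_gt0. Qed.
Let t4 : 0 < tau / 2 / 2. Proof. by rewrite divr_gt0. Qed.

Let g_bound (T : R -> R) : (forall v, `|T v| <= 1) ->
  forall v, `|g v * T v| <= 1 * g v.
Proof.
move=> T1 v; rewrite normrM (ger0_norm (gs_ge0 _ _ _)) mul1r.
by rewrite ler_piMr// gs_ge0.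
Qed.

Let C0 := sval (cid2 (poly_gs 1 t2)).
Let xg_bound (T : R -> R) : (forall v, `|T v| <= 1) ->
  forall v, `|(v - b) * g v * T v| <= C0 * gs (tau / 2 / 2) b v.
Proof.
move=> T1 v; rewrite /C0; case: cid2 => /= C Cge HC.
apply: le_trans (HC b v); rewrite expr1 2!normrM (ger0_norm (gs_ge0 _ _ _)).
rewrite -[leRHS]mulr1; apply: ler_pM => //.
  by rewrite mulr_ge0// gs_ge0.
by rewrite ler_wpM2r ?gs_ge0// norm_le_1Dsqr.
Qed.

Let cg : continuous g. Proof. exact: continuous_gs. Qed.

Let caff y : continuous (fun v => y * (v - b)).
Proof. exact: is_derive_continuous (Daff y b). Qed.

Let ccos y : continuous (fun v => cos (y * (v - b))).
Proof. exact: (is_derive_continuous (fun v => Dcos (Daff y b v))). Qed.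

Let csin y : continuous (fun v => sin (y * (v - b))).
Proof. exact: (is_derive_continuous (fun v => Dsin (Daff y b v))). Qed.

Let cmul F f : continuous F -> continuous f -> continuous (fun v => F v * f v).
Proof. by move=> cF cf v; apply: cvgM; [exact: cF|exact: cf]. Qed.

Let cx : continuous (fun v => v - b).
Proof. by under eq_fun do rewrite -[_ - b]mul1r; exact: caff. Qed.

Let int_g T : continuous T -> (forall v, `|T v| <= 1) ->
  leb.-integrable [set: measurableTypeR R] (EFin \o (fun v => g v * T v)).
Proof.
move=> cT T1; apply: (integrable_le_gs t2 _ (g_bound T1)).
by apply: continuous_measurable_fun; exact: (cmul cg cT).
Qed.

Let int_xg T : continuous T -> (forall v, `|T v| <= 1) ->
  leb.-integrable [set: measurableTypeR R] (EFin \o (fun v => (v - b) * g v * T v)).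
Proof.
move=> cT T1; apply: (integrable_le_gs t4 _ (xg_bound T1)).
by apply: continuous_measurable_fun; exact: (cmul (cmul cx cg) cT).
Qed.

Definition gcos y := Rintegral leb setT (fun v => g v * cos (y * (v - b))).
Definition gsin y := Rintegral leb setT (fun v => g v * sin (y * (v - b))).
Definition xgcos y := Rintegral leb setT (fun v => (v - b) * g v * cos (y * (v - b))).
Definition xgsin y := Rintegral leb setT (fun v => (v - b) * g v * sin (y * (v - b))).

Let g_half v : g v <= gs (tau / 2 / 2) b v.
Proof. by rewrite /g /gs ler_expR lerN2 ler_wpM2r ?sqr_ge0//; have := t0; lra. Qed.

Let ibp (S T : R -> R) y (y' : R) :
  (forall v, is_derive v (1 : R) S (y' * T v)) -> continuous S -> continuous T ->
  (forall v, `|S v| <= 1) -> (forall v, `|T v| <= 1) ->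
  tau * Rintegral leb setT (fun v => (v - b) * g v * S v) =
  y' * Rintegral leb setT (fun v => g v * T v).
Proof.
move=> dS cS cT S1 T1.
pose f v := y' * (g v * T v) - tau * ((v - b) * g v * S v).
have df v : is_derive v (1 : R) (fun v => g v * S v) (f v).
  by apply: (Deq (Dmul (is_derive_gs (tau / 2) b v) (dS v))); rewrite /f /g; field.
have cf : continuous f.
  move=> v; apply: cvgB.
    by apply: cvgM; [exact: cvg_cst|exact: (cmul cg cT)].
  by apply: cvgM; [exact: cvg_cst|exact: (cmul (cmul cx cg) cS)].
have fb v : `|f v| <= (`|y'| + tau * C0) * gs (tau / 2 / 2) b v.
  rewrite (le_trans (ler_normB _ _))// (normrM y') (normrM tau).
  rewrite (ger0_norm (ltW t0)) [leRHS]mulrDl lerD//.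
    rewrite ler_wpM2l// (le_trans (g_bound T1 v))// mul1r.
    exact: g_half.
  by rewrite -[leRHS]mulrA ler_wpM2l ?(ltW t0)//; exact: xg_bound.
have Sb v : `|g v * S v| <= 1 * gs (tau / 2 / 2) b v.
  by rewrite (le_trans (g_bound S1 v))// !mul1r.
have f0 : Rintegral leb setT f = 0.
  by rewrite /Rintegral (integral_derive_gs_eq0 t4 df cf Sb fb).
have i1 := int_g cT T1; have i2 := int_xg cS S1.
have fE : Rintegral leb setT f =
    Rintegral leb setT (fun v => y' * (g v * T v)) -
    Rintegral leb setT (fun v => tau * ((v - b) * g v * S v)).
  apply: (RintegralB measurableT).
    exact: (integrableZl measurableT y' i1).
  exact: (integrableZl measurableT tau i2).
move: fE; rewrite f0 (RintegralZl _ measurableT i1) (RintegralZl _ measurableT i2).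
by move/esym/eqP; rewrite subr_eq0 => /eqP.
Qed.

Let sin1 y v : `|sin (y * (v - b))| <= 1. Proof. exact: sin_max. Qed.
Let cos1 y v : `|cos (y * (v - b))| <= 1. Proof. exact: cos_max. Qed.

Lemma xgsinE y : xgsin y = y / tau * gcos y.
Proof.
have h := ibp y (fun v => Deq (Dsin (Daff y b v)) (mulrC _ _)) (@csin y) (@ccos y)
  (sin1 y) (cos1 y).
by rewrite /xgsin /gcos mulrAC -h mulrC mulKf// gt_eqF.
Qed.

Lemma xgcosE y : xgcos y = - (y / tau) * gsin y.
Proof.
have dc v : is_derive v (1 : R) (fun v => cos (y * (v - b))) (- y * sin (y * (v - b))).
  by apply: (Deq (Dcos (Daff y b v))); ring.
have h := ibp y dc (@ccos y) (@csin y) (cos1 y) (sin1 y).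
by rewrite /xgcos /gsin -mulNr mulrAC -h mulrC mulKf// gt_eqF.
Qed.


Let int_absxg : leb.-integrable [set: measurableTypeR R]
  (EFin \o (fun v => `|(v - b) * g v|)).
Proof.
have n1 (v : R) : `|1 : R| <= 1 by rewrite normr1.
have h := int_xg (@cst_continuous _ _ (1 : R)) n1.
rewrite (_ : EFin \o _ = (fun v => `|((v - b) * g v * 1)%:E|)%E).
  exact: (integrable_abse h).
by apply/funext => v /=; rewrite mulr1.
Qed.

Let diff_int (T T' : R -> R) y :
  (forall y v, is_derive y (1 : R) (fun y => T (y * (v - b))) ((v - b) * T' (y * (v - b)))) ->
  (forall y, continuous (fun v => T (y * (v - b)))) ->
  (forall u, `|T u| <= 1) -> (forall u, `|T' u| <= 1) ->
  is_derive y (1 : R) (fun y => Rintegral leb setT (fun v => g v * T (y * (v - b))))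
    (Rintegral leb setT (fun v => (v - b) * g v * T' (y * (v - b)))).
Proof.
move=> dT cT T1 T1'.
pose f y v := g v * T (y * (v - b)).
have df z v : is_derive z (1 : R) (f^~ v) ((v - b) * g v * T' (z * (v - b))).
  by apply: (Deq (Dcmul (g v) (dT z v))); ring.
have fE z v : partial1of2 f z v = (v - b) * g v * T' (z * (v - b)).
  by rewrite partial1of2E; have [_ ->] := df z v.
have Iy : `]y - 1, y + 1[%classic y by rewrite /= in_itv /=; lra.
have intf z : `]y - 1, y + 1[%classic z -> leb.-integrable setT (EFin \o f z).
  by move=> _; exact: int_g.
have derf z v : `]y - 1, y + 1[%classic z -> [set: R] v -> derivable (f^~ v) z 1.
  by move=> _ _; case: (df z v).
have bd z v : `]y - 1, y + 1[%classic z -> [set: R] v ->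
    `|partial1of2 f z v| <= `|(v - b) * g v|.
  by move=> _ _; rewrite fE normrM ler_piMr.
have := @derivable_under_integral _ _ _ leb f setT measurableT _ _ _ Iy intf derf
  (fun v => `|(v - b) * g v|) (fun v => normr_ge0 _) int_absxg bd.
have := @differentiation_under_integral _ _ _ leb f setT measurableT _ _ _ Iy intf derf
  (fun v => `|(v - b) * g v|) (fun v => normr_ge0 _) int_absxg bd.
rewrite derive1E => h1 h2; apply: DeriveDef => //; rewrite h1.
by apply: eq_Rintegral => v _; rewrite fE.
Qed.


Let dgcos y : is_derive y (1 : R) gcos (- (y / tau) * gcos y).
Proof.
rewrite mulNr -xgsinE.
have dT z v : is_derive z (1 : R) (fun y => cos (y * (v - b)))
    ((v - b) * - sin (z * (v - b))).
  have h := Dcos (Daff (v - b) 0 z).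
  rewrite (_ : (fun _ => _) = fun z => cos ((v - b) * (z - 0))).
    by apply: (Deq h); rewrite subr0 mulrC [_ * (v - b)]mulrC.
  by apply/funext => u; rewrite subr0 mulrC.
have := @diff_int cos (fun u => - sin u) y dT ccos (@cos_max R) _.
move=> h; apply: (Deq (h _)) => [u|]; first by rewrite normrN; exact: sin_max.
rewrite /xgsin -mulN1r -RintegralZl//; last exact: int_xg.
by apply: eq_Rintegral => v _; rewrite mulN1r mulrN.
Qed.

Let dgsin y : is_derive y (1 : R) gsin (- (y / tau) * gsin y).
Proof.
rewrite -xgcosE.
have dT z v : is_derive z (1 : R) (fun y => sin (y * (v - b)))
    ((v - b) * cos (z * (v - b))).
  have h := Dsin (Daff (v - b) 0 z).
  rewrite (_ : (fun _ => _) = fun z => sin ((v - b) * (z - 0))).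
    by apply: (Deq h); rewrite subr0 mulrC [_ * (v - b)]mulrC.
  by apply/funext => u; rewrite subr0 mulrC.
exact: (@diff_int sin cos y dT csin (@sin_max R) (@cos_max R)).
Qed.

(** The cosine and sine transforms h of a Gaussian satisfy h' = - (y / tau) h:
    differentiation under the integral produces the factor v - b, and integration by
    parts turns it into y / tau. The quotient of h by the expected Gaussian is then
    constant. *)
Let gauss_ode (h : R -> R) : (forall y, is_derive y (1 : R) h (- (y / tau) * h y)) ->
  forall y, h y = h 0 * expR (- (y ^+ 2 / (2 * tau))).
Proof.
move=> dh y.
have tN : tau != 0 by rewrite gt_eqF.
have dE z : is_derive z (1 : R) (fun z => expR ((2 * tau)^-1 * (z * z)))
   (expR ((2 * tau)^-1 * (z * z)) * (z / tau)).
  by apply: (Deq (Dexp (Dcmul (2 * tau)^-1 (Dmul (Did z) (Did z))))); field.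
have dH z : is_derive z (1 : R) (fun z => h z * expR ((2 * tau)^-1 * (z * z))) 0.
  by apply: (Deq (Dmul (dh z) (dE z))); ring.
have := is_derive_0_is_cst y 0 dH.
rewrite mulr0 mulr0 expR0 mulr1 => <-.
rewrite -mulrA -expRD (_ : _ + _ = 0) ?expR0 ?mulr1//.
by rewrite expr2; field.
Qed.

Lemma gcosE y : gcos y = Num.sqrt (2 * pi / tau) * expR (- (y ^+ 2 / (2 * tau))).
Proof.
rewrite (gauss_ode dgcos); congr (_ * _).
rewrite /gcos (_ : (fun _ => _) = g).
  rewrite /Rintegral integral_gs//=; congr Num.sqrt.
  by field; rewrite gt_eqF.
by apply/funext => v; rewrite mul0r cos0 mulr1.
Qed.

Lemma gsinE y : gsin y = 0.
Proof.
rewrite (gauss_ode dgsin) (_ : gsin 0 = 0) ?mul0r//.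
rewrite /gsin (_ : (fun _ => _) = cst 0) ?Rintegral_cst// ?mul0r//.
by apply/funext => v; rewrite mul0r sin0 mulr0.
Qed.

Let char_shift (w : R -> R) y (A B : R) :
  leb.-integrable [set: measurableTypeR R] (EFin \o (fun v => w v * cos (y * (v - b)))) ->
  leb.-integrable [set: measurableTypeR R] (EFin \o (fun v => w v * sin (y * (v - b)))) ->
  Rintegral leb setT (fun v => w v * cos (y * (v - b))) = A ->
  Rintegral leb setT (fun v => w v * sin (y * (v - b))) = B ->
  cintegrable1 (fun v => (w v)%:C * expi (y * v)) /\
  cintegral1 (fun v => (w v)%:C * expi (y * v)) = (A +i* B) * expi (y * b).
Proof.
move=> ic is_ <- <-; set c := fun v => _ in ic *; set s := fun v => _ in is_ *.
have E v : y * v = y * (v - b) + y * b by ring.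
have RE : (fun v => complex.Re ((w v)%:C * expi (y * v))) =
    (fun v => cos (y * b) * c v - sin (y * b) * s v).
  by apply/funext => v; rewrite creZ /= E cosD /c /s; ring.
have IE : (fun v => complex.Im ((w v)%:C * expi (y * v))) =
    (fun v => cos (y * b) * s v + sin (y * b) * c v).
  by apply/funext => v; rewrite cimZ /= E sinD /c /s; ring.
have cc := integrableZl measurableT (cos (y * b)) ic.
have cs := integrableZl measurableT (cos (y * b)) is_.
have sc := integrableZl measurableT (sin (y * b)) ic.
have ss := integrableZl measurableT (sin (y * b)) is_.
split.
  by rewrite /cintegrable1 RE IE; split; [exact: integrableBr|exact: integrableDr].
rewrite /cintegral1 RE IE; apply: complex_ext => /=.
  rewrite (_ : Rintegral _ _ _ = Rintegral leb setT (fun v => cos (y * b) * c v) -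
     Rintegral leb setT (fun v => sin (y * b) * s v)); last exact: RintegralB.
  by rewrite (RintegralZl _ measurableT ic) (RintegralZl _ measurableT is_); ring.
rewrite (_ : Rintegral _ _ _ = Rintegral leb setT (fun v => cos (y * b) * s v) +
     Rintegral leb setT (fun v => sin (y * b) * c v)); last exact: RintegralD.
by rewrite (RintegralZl _ measurableT ic) (RintegralZl _ measurableT is_); ring.
Qed.

Lemma gauss_char y :
  cintegrable1 (fun v => (gs (tau / 2) b v)%:C * expi (y * v)) /\
  cintegral1 (fun v => (gs (tau / 2) b v)%:C * expi (y * v)) =
    (Num.sqrt (2 * pi / tau) * expR (- (y ^+ 2 / (2 * tau))))%:C * expi (y * b).
Proof.
rewrite -gcosE.
have := char_shift (int_g (@ccos y) (cos1 y)) (int_g (@csin y) (sin1 y)) erefl (gsinE y).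
by [].
Qed.

Lemma gauss_char_moment y :
  cintegrable1 (fun v => ((v - b) * gs (tau / 2) b v)%:C * expi (y * v)) /\
  cintegral1 (fun v => ((v - b) * gs (tau / 2) b v)%:C * expi (y * v)) =
    (0 +i* (y / tau)) * ((Num.sqrt (2 * pi / tau) *
      expR (- (y ^+ 2 / (2 * tau))))%:C * expi (y * b)).
Proof.
rewrite -gcosE.
have xc : xgcos y = 0 by rewrite xgcosE gsinE mulr0.
have [h1 ->] := char_shift (int_xg (@ccos y) (cos1 y)) (int_xg (@csin y) (sin1 y))
  xc (xgsinE y).
split=> //; rewrite mulrA; congr (_ * _).
by apply: complex_ext => /=; ring.
Qed.

End char_fun.

(** * Integrals of singular and decaying weights on the line *)

Section one_dim_bounds.
Variable R : realType.
Local Notation leb := (@lebesgue_measure R).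
Implicit Types (F f : R -> R) (a b v y tau : R).

(** An antiderivative on the half line that stays bounded controls the integral
    of a nonnegative even function. *)
Lemma ge0_even_integral_le F f M :
  (forall v, 0 <= f v) -> continuous f -> (forall v, f (- v) = f v) ->
  (forall v, 0 <= v -> is_derive v (1 : R) F (f v)) ->
  (forall v, 0 <= v -> F v <= M) ->
  (\int[leb]_v (f v)%:E <= (2 * (M - F 0))%:E)%E.
Proof.
move=> f0 cf fN dF FM.
rewrite (ge0_symfun_integralT f0 cf); last by move=> v /=; rewrite fN.
rewrite EFinM lee_pmul2l//.
pose D (n : nat) : set (measurableTypeR R) := `[0, n%:R]%classic.
have DE : [set x : R | 0 <= x] = \bigcup_n D n.
  apply/seteqP; split => v /=.
    move=> v0; have [N _ HN] := nbhs_infty_ger v; exists N => //.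
    by rewrite /D /= in_itv /= v0/=; apply: HN => /=.
  by move=> [n _]; rewrite /D /= in_itv /= => /andP[].
have mf : measurable_fun [set: R] f by exact: continuous_measurable_fun.
have ndD : nondecreasing_seq D.
  move=> m n mn; apply/subsetPset => v; rewrite /D /= !in_itv /= => /andP[-> h].
  by rewrite (le_trans h)// ler_nat.
have mD n : measurable (D n) by exact: measurable_itv.
have := @ge0_nondecreasing_set_cvg_integral _ _ _ D (fun v => (f v)%:E) leb ndD mD
  (fun n => measurable_funTS (measurable_funE mf)) (fun n v _ => f0 v).
rewrite DE => cvgI.
apply: (cvge_le _ cvgI); apply: nearW => n.
case: n => [|n].
  rewrite /D set_itv1 integral_set1 lee_fin subr_ge0; exact: FM.
have cF v : 0 <= v -> {for v, continuous F}.
  move=> v0; apply/differentiable_continuous/derivable1_diffP.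
  by case: (dF v v0).
rewrite (@continuous_FTC2 _ f F)//.
- by rewrite lee_fin lerD2r; exact: FM.
- exact: continuous_subspaceT.
- split => [v|| ].
  + by rewrite in_itv /= => /andP[/ltW v0 _]; case: (dF v v0).
  + exact/cvg_at_right_filter/cF.
  + exact/cvg_at_left_filter/cF.
- move=> v; rewrite in_itv /= => /andP[/ltW v0 _].
  by rewrite derive1E; have [_ ->] := dF v v0.
Qed.

Lemma continuous_norm_powR (c d q : R) : 0 < c -> 0 <= d ->
  continuous (fun v => (c + d * `|v|) `^ q).
Proof.
move=> c0 d0 v.
have h0 : 0 < c + d * `|v| by rewrite ltr_pwDl// mulr_ge0.
have cq : {for c + d * `|v|, continuous (fun u : R => u `^ q)}.
  apply/differentiable_continuous/derivable1_diffP.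
  by have [] := is_derive1_powR q h0.
apply: (@continuous_comp _ _ _ (fun v => c + d * `|v|) (fun u => u `^ q)) => //.
  apply: cvgD; first exact: cvg_cst.
by apply: cvgM; [exact: cvg_cst|exact: norm_continuous].
Qed.

Lemma DpowR (c d q v : R) : 0 < c + d * v ->
  is_derive v (1 : R) (fun u => (c + d * u) `^ q) (q * (c + d * v) `^ (q - 1) * d).
Proof.
move=> h0; have h := Dadd (Dcst c v) (Dcmul d (Did v)).
apply: (Deq (@Dcomp _ (fun u => u `^ q) (fun u => c + d * u) v _ _ (is_derive1_powR q h0) h)).
by rewrite mulr1 add0r.
Qed.

Lemma powR_anti (q y z : R) : 0 <= q -> 0 < y -> y <= z -> z `^ (- q) <= y `^ (- q).
Proof.
move=> q0 y0 yz; have z0 : 0 < z by exact: lt_le_trans yz.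
rewrite !powRN lef_pV2 ?posrE ?powR_gt0//.
by apply: ge0_ler_powR => //; rewrite nnegrE ltW.
Qed.

Lemma powR_ge1 (q y : R) : 0 <= q -> 1 <= y -> 1 <= y `^ q.
Proof. by move=> q0 y1; rewrite -(powRr0 y) ler_powR. Qed.

Lemma powR_le1 (q y : R) : 0 <= q -> 1 <= y -> y `^ (- q) <= 1.
Proof. by move=> q0 y1; rewrite powRN invf_le1 ?powR_ge1// powR_gt0// (lt_le_trans ltr01). Qed.

Lemma integral_powR_decay (p r : R) : 1 < p -> 0 < r ->
  (\int[leb]_v ((1 + r^-1 * `|v|) `^ (- p))%:E <= (2 / (p - 1) * r)%:E)%E.
Proof.
move=> p1 r0.
have ri0 : 0 < r^-1 by rewrite invr_gt0.
have p10 : 0 < p - 1 by lra.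
have b0 v : 0 <= v -> 0 < 1 + r^-1 * v by move=> v0; rewrite ltr_pwDl// mulr_ge0// ltW.
pose F v := - (r / (p - 1)) * (1 + r^-1 * v) `^ (1 - p).
pose f v := (1 + r^-1 * `|v|) `^ (- p).
apply: le_trans (@ge0_even_integral_le F f 0 _ _ _ _ _) _.
- by move=> v; exact: powR_ge0.
- by apply: continuous_norm_powR => //; exact: ltW.
- by move=> v; rewrite /f normrN.
- move=> v v0; have h := b0 v v0.
  apply: (Deq (Dcmul (- (r / (p - 1))) (DpowR (1 - p) h))).
  rewrite /f (ger0_norm v0) (_ : 1 - p - 1 = - p); last by ring.
  by field; rewrite !gt_eqF.
- move=> v v0; rewrite /F mulNr oppr_le0 mulr_ge0 ?powR_ge0//.
  by rewrite divr_ge0// ltW.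
- by rewrite lee_fin /F mulr0 addr0 powR1 mulr1 sub0r opprK; nra.
Qed.

(** An antiderivative on the half line is a multiple of the power 1 - th of
    (r + r v) / (1 + r + r v), which is at most 1 for every r. *)
Lemma integral_singular (th r : R) : 0 <= th < 1 -> 0 < r ->
  (\int[leb]_v ((r + r * `|v|) `^ (- th) * (1 + r + r * `|v|) `^ (th - 2))%:E
    <= (2 / ((1 - th) * r))%:E)%E.
Proof.
move=> /andP[th0 th1] r0.
have t10 : 0 < 1 - th by lra.
have b0 v : 0 <= v -> 0 < r + r * v by move=> v0; rewrite ltr_pwDl// mulr_ge0// ltW.
have c0 v : 0 <= v -> 0 < 1 + r + r * v.
  by move=> v0; rewrite -addrA ltr_pwDl// ltW// b0.
pose F v := ((1 - th) * r)^-1 * ((r + r * v) `^ (1 - th) * (1 + r + r * v) `^ (th - 1)).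
pose f v := (r + r * `|v|) `^ (- th) * (1 + r + r * `|v|) `^ (th - 2).
apply: le_trans (@ge0_even_integral_le F f ((1 - th) * r)^-1 _ _ _ _ _) _.
- by move=> v; rewrite mulr_ge0 ?powR_ge0.
- move=> v; apply: cvgM.
    by apply: continuous_norm_powR => //; exact: ltW.
  by apply: continuous_norm_powR; [rewrite addr_gt0|exact: ltW].
- by move=> v; rewrite /f normrN.
- move=> v v0; have h := b0 v v0; have h' := c0 v v0.
  apply: (Deq (Dcmul _ (Dmul (DpowR (1 - th) h) (DpowR (th - 1) h')))).
  rewrite /f (ger0_norm v0) (_ : 1 - th - 1 = - th); last by ring.
  rewrite (_ : th - 1 - 1 = th - 2); last by ring.
  have -> : (r + r * v) `^ (1 - th) = (r + r * v) * (r + r * v) `^ (- th).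
    by rewrite powRD ?powRr1 ?(ltW h)// (gt_eqF h) implybT.
  have -> : (1 + r + r * v) `^ (th - 1) = (1 + r + r * v) * (1 + r + r * v) `^ (th - 2).
    rewrite -{2}[1 + r + r * v]powRr1 ?(ltW h')// -powRD ?(gt_eqF h') ?implybT//.
    by congr (_ `^ _); ring.
  by field; rewrite !gt_eqF.
- move=> v v0; rewrite /F ler_piMr//; first by rewrite invr_ge0 mulr_ge0// ltW.
  rewrite (_ : th - 1 = - (1 - th)); last by rewrite opprB.
  rewrite powRN ler_pdivrMr ?powR_gt0 ?c0// mul1r.
  by apply: ge0_ler_powR; rewrite ?nnegrE ?ltW ?b0 ?c0//; lra.
- rewrite lee_fin ler_wpM2l// lerBlDr lerDl.
  by rewrite /F mulr_ge0 ?mulr_ge0 ?powR_ge0 ?invr_ge0 ?mulr_ge0 ?ltW.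
Qed.

(** With u = r v this is a Gaussian around r a plus a singularity of order th at u = 0,
    cut off at distance r: its integral is of order 1 / r uniformly in r and a. *)
Definition weight (th kap r a v : R) :=
  (1 + (r + r * `|v|) `^ (- th)) * gs (kap * r ^+ 2) a v.

Lemma weight_ge0 th kap r a v : 0 <= weight th kap r a v.
Proof. by rewrite mulr_ge0 ?gs_ge0// addr_ge0 ?powR_ge0. Qed.

Lemma measurable_weight th kap r a : 0 < r ->
  measurable_fun [set: R] (weight th kap r a).
Proof.
move=> r0; apply: measurable_funM; last exact: measurable_gs.
apply: measurable_funD; first exact: measurable_cst.
by apply: continuous_measurable_fun; apply: continuous_norm_powR => //; exact: ltW.
Qed.

(** Where r + r |v| >= 1 the weight is at most twice the Gaussian. Elsewhere the
    Gaussian is at most 1 and the weight is comparable to the integrand of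
    [integral_singular], whatever the centre a is. *)
Lemma integral_weight th kap : 0 <= th < 1 -> 0 < kap ->
  exists2 C : R, 0 <= C & forall r a, 0 < r ->
    (\int[leb]_v (weight th kap r a v)%:E <= (C / r)%:E)%E.
Proof.
move=> th01 k0; have /andP[th0 th1] := th01.
exists (2 * Num.sqrt (pi / kap) + 8 / (1 - th)) => [|r a r0].
  by rewrite addr_ge0 ?mulr_ge0 ?sqrtr_ge0// invr_ge0; lra.
pose f v := (r + r * `|v|) `^ (- th) * (1 + r + r * `|v|) `^ (th - 2).
have f0 v : 0 <= f v by rewrite mulr_ge0 ?powR_ge0.
have mf : measurable_fun [set: R] f.
  apply: measurable_funM; apply: continuous_measurable_fun;
    apply: continuous_norm_powR; rewrite ?addr_gt0 ?(ltW r0)//.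
have kr0 : 0 < kap * r ^+ 2 by rewrite mulr_gt0// exprn_gt0.
have wf v : weight th kap r a v <= 2 * gs (kap * r ^+ 2) a v + 4 * f v.
  have g1 : gs (kap * r ^+ 2) a v <= 1.
    by rewrite /gs -expR0 ler_expR oppr_le0 mulr_ge0 ?sqr_ge0// ltW.
  have g0 := gs_ge0 (kap * r ^+ 2) a v.
  have y0 : 0 < r + r * `|v| by rewrite ltr_pwDl// mulr_ge0// ltW.
  (* away from the origin the Gaussian is integrable, near it the singularity is *)
  have [y1|y1] := leP 1 (r + r * `|v|).
    have h := powR_le1 th0 y1; have := f0 v; rewrite /weight.
    have := powR_ge0 (r + r * `|v|) (- th); nra.
  have h : 4^-1 <= (1 + r + r * `|v|) `^ (th - 2).
    rewrite -addrA (_ : th - 2 = - (2 - th)); last by rewrite opprB.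
    rewrite powRN lef_pV2 ?posrE ?powR_gt0//; last lra.
    apply: (@le_trans _ _ (2 `^ (2 - th))).
      by apply: ge0_ler_powR; rewrite ?nnegrE; lra.
    apply: (@le_trans _ _ (2 `^ 2%:R)); first by apply: ler_powR; lra.
    by rewrite powR_mulrn//; lra.
  rewrite /weight /f; have := powR_ge0 (r + r * `|v|) (- th); nra.
apply: (@le_trans _ _ (\int[leb]_v (2%:E * (gs (kap * r ^+ 2) a v)%:E + 4%:E * (f v)%:E))%E).
  apply: ge0_integral_mono => v _; first by rewrite lee_fin weight_ge0.
  by rewrite -!EFinM -EFinD lee_fin.
rewrite ge0_integralD//; last 4 first.
- by move=> v _; rewrite -EFinM lee_fin mulr_ge0// gs_ge0.
- by apply: measurable_funeM; exact: measurable_funE (measurable_gs _ _).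
- by move=> v _; rewrite -EFinM lee_fin mulr_ge0.
- by apply: measurable_funeM; exact: measurable_funE.
rewrite ge0_integralZl//; last 2 first.
- exact: measurable_funE (measurable_gs _ _).
- by move=> v _; rewrite lee_fin gs_ge0.
rewrite ge0_integralZl//; last 2 first.
- exact: measurable_funE.
- by move=> v _; rewrite lee_fin.
rewrite integral_gs//.
apply: (@le_trans _ _ (2%:E * (Num.sqrt (pi / (kap * r ^+ 2)))%:E +
   4%:E * (2 / ((1 - th) * r))%:E)%E).
  by rewrite leeD2l// lee_pmul2l//; exact: integral_singular.
rewrite -!EFinM -EFinD lee_fin.
have -> : Num.sqrt (pi / (kap * r ^+ 2)) = Num.sqrt (pi / kap) / r.
  rewrite invfM mulrA sqrtrM ?divr_ge0 ?pi_ge0 ?(ltW k0)//.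
  by rewrite sqrtrV ?sqr_ge0// sqrtr_sqr gtr0_norm.
rewrite le_eqVlt; apply/orP; left; apply/eqP; field.
by rewrite !gt_eqF//; lra.
Qed.

End one_dim_bounds.

(** * Integrals dominated by products *)

Section product_bounds.
Variables (R : realType) (n : nat).
Local Notation mu := (lebesgue_rV R n).
Local Notation leb := (@lebesgue_measure R).
Local Notation normc := ComplexField.Normc.normc.
Implicit Types (x xi : 'rV[R]_n) (F : 'rV[R]_n -> R).

Lemma measurable_dot x : measurable_fun [set: 'rV[R]_n] (fun xi => dot x xi).
Proof.
apply: measurable_sum => j; apply: measurable_funM; first exact: measurable_cst.
exact: measurable_coord.
Qed.

Lemma measurable_sqnorm : measurable_fun [set: 'rV[R]_n] (fun xi => dot xi xi).
Proof.
by apply: measurable_sum => j; apply: measurable_funM; exact: measurable_coord.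
Qed.

Lemma measurable_cos_fun F : measurable_fun [set: 'rV[R]_n] F ->
  measurable_fun [set: 'rV[R]_n] (fun x => cos (F x)).
Proof.
by move=> mF; apply: measurableT_comp mF; apply: continuous_measurable_fun;
  exact: continuous_cos.
Qed.

Lemma measurable_sin_fun F : measurable_fun [set: 'rV[R]_n] F ->
  measurable_fun [set: 'rV[R]_n] (fun x => sin (F x)).
Proof.
by move=> mF; apply: measurableT_comp mF; apply: continuous_measurable_fun;
  exact: continuous_sin.
Qed.

Lemma dot_ge0 x : 0 <= dot x x.
Proof. by apply: sumr_ge0 => j _; rewrite -expr2 sqr_ge0. Qed.

Section dominated.
Variables (h : 'I_n -> R -> R) (c : 'I_n -> R) (C : R) (F : 'rV[R]_n -> R).
Hypotheses (mh : forall j, measurable_fun [set: R] (h j)) (h0 : forall j v, 0 <= h j v)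
  (hc : forall j, (\int[leb]_v (h j v)%:E <= (c j)%:E)%E)
  (C0 : 0 <= C) (mF : measurable_fun [set: 'rV[R]_n] F)
  (Fh : forall xi, `|F xi| <= C * \prod_j h j (xi ord0 j)).

Lemma integral_abs_prod_le : (\int[mu]_xi `|(F xi)%:E| <= (C * \prod_j c j)%:E)%E.
Proof.
apply: (@le_trans _ _ (\int[mu]_xi (C%:E * (\prod_j h j (xi ord0 j))%:E))%E).
  by apply: ge0_integral_mono => xi _ //; rewrite -EFinM /= lee_fin.
rewrite ge0_integralZl//; last 2 first.
- exact: measurable_funE (measurable_prod_coord mh).
- by move=> xi _; rewrite lee_fin; exact: prodr_ge0.
by rewrite EFinM lee_wpmul2l ?lee_fin//; exact: ge0_integral_prod_le.
Qed.

Lemma integrable_prod_le : mu.-integrable [set: 'rV[R]_n] (EFin \o F).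
Proof.
apply/integrableP; split; first exact: measurable_funE mF.
by apply: le_lt_trans integral_abs_prod_le _; rewrite ltry.
Qed.

Lemma Rintegral_prod_le : `|Rintegral mu setT F| <= C * \prod_j c j.
Proof.
rewrite -lee_fin EFin_normr_Rintegral//; last exact: integrable_prod_le.
apply: le_trans integral_abs_prod_le.
by apply: le_abse_integral => //; exact: measurable_funE mF.
Qed.

End dominated.

Section dominated_char.
Variables (h : 'I_n -> R -> R) (c : 'I_n -> R) (C : R) (F : 'rV[R]_n -> R).
Hypotheses (mh : forall j, measurable_fun [set: R] (h j)) (h0 : forall j v, 0 <= h j v)
  (hc : forall j, (\int[leb]_v (h j v)%:E <= (c j)%:E)%E)
  (C0 : 0 <= C) (mF : measurable_fun [set: 'rV[R]_n] F)
  (Fh : forall xi, `|F xi| <= C * \prod_j h j (xi ord0 j)).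
Variable x : 'rV[R]_n.

Let RE : (fun xi => complex.Re ((F xi)%:C * expi (dot x xi))) =
  fun xi => F xi * cos (dot x xi).
Proof. by apply/funext => xi; rewrite creZ. Qed.

Let IE : (fun xi => complex.Im ((F xi)%:C * expi (dot x xi))) =
  fun xi => F xi * sin (dot x xi).
Proof. by apply/funext => xi; rewrite cimZ. Qed.

Let mRE : measurable_fun [set: 'rV[R]_n] (fun xi => F xi * cos (dot x xi)).
Proof. by apply: measurable_funM => //; apply: measurable_cos_fun; exact: measurable_dot. Qed.

Let mIE : measurable_fun [set: 'rV[R]_n] (fun xi => F xi * sin (dot x xi)).
Proof. by apply: measurable_funM => //; apply: measurable_sin_fun; exact: measurable_dot. Qed.

Let REh xi : `|F xi * cos (dot x xi)| <= C * \prod_j h j (xi ord0 j).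
Proof. by apply: le_trans (Fh xi); rewrite normrM ler_piMr// cos_max. Qed.

Let IEh xi : `|F xi * sin (dot x xi)| <= C * \prod_j h j (xi ord0 j).
Proof. by apply: le_trans (Fh xi); rewrite normrM ler_piMr// sin_max. Qed.

Lemma cintegrable_prod_le : cintegrable (fun xi => (F xi)%:C * expi (dot x xi)).
Proof.
rewrite /cintegrable RE IE; split.
  exact: (integrable_prod_le mh h0 hc C0 mRE REh).
exact: (integrable_prod_le mh h0 hc C0 mIE IEh).
Qed.

Lemma normc_cintegral_prod_le :
  normc (cintegral setT (fun xi => (F xi)%:C * expi (dot x xi))) <=
  2 * C * \prod_j c j.
Proof.
apply: le_trans (normc_le_ReIm _) _; rewrite /cintegral RE IE /=.
rewrite -mulrA mulrDl !mul1r lerD//.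
  exact: (Rintegral_prod_le mh h0 hc C0 mRE REh).
exact: (Rintegral_prod_le mh h0 hc C0 mIE IEh).
Qed.

End dominated_char.

Lemma cintegralZ (a : R) (f : 'rV[R]_n -> R[i]) : cintegrable f ->
  cintegrable (fun x => a%:C * f x) /\
  cintegral setT (fun x => a%:C * f x) = a%:C * cintegral setT f.
Proof.
move=> [fr fi].
have RE : (fun x => complex.Re (a%:C * f x)) = fun x => a * complex.Re (f x).
  by apply/funext => x; rewrite creZ.
have IE : (fun x => complex.Im (a%:C * f x)) = fun x => a * complex.Im (f x).
  by apply/funext => x; rewrite cimZ.
split; first by rewrite /cintegrable RE IE; split;
  [exact: (integrableZl measurableT a fr)|exact: (integrableZl measurableT a fi)].
rewrite /cintegral RE IE; apply: complex_ext.
  by rewrite creZ; exact: (RintegralZl _ measurableT fr).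
by rewrite cimZ; exact: (RintegralZl _ measurableT fi).
Qed.

Lemma cintegralD (f g : 'rV[R]_n -> R[i]) : cintegrable f -> cintegrable g ->
  cintegrable (fun x => f x + g x) /\
  cintegral setT (fun x => f x + g x) = cintegral setT f + cintegral setT g.
Proof.
move=> [fr fi] [gr gi].
have RE : (fun x => complex.Re (f x + g x)) = fun x => complex.Re (f x) + complex.Re (g x).
  by apply/funext => x; rewrite creD.
have IE : (fun x => complex.Im (f x + g x)) = fun x => complex.Im (f x) + complex.Im (g x).
  by apply/funext => x; rewrite cimD.
split; first by rewrite /cintegrable RE IE; split; exact: integrableDr.
rewrite /cintegral RE IE; apply: complex_ext.
  by rewrite creD; exact: (RintegralD measurableT fr gr).
by rewrite cimD; exact: (RintegralD measurableT fi gi).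
Qed.

Lemma cintegral_sum N (z : 'I_N -> R) (f : 'I_N -> 'rV[R]_n -> R[i]) :
  (forall k, cintegrable (f k)) ->
  cintegrable (fun x => \sum_k (z k)%:C * f k x) /\
  cintegral setT (fun x => \sum_k (z k)%:C * f k x) =
    \sum_k (z k)%:C * cintegral setT (f k).
Proof.
move=> fi; elim: N z f fi => [|N IH] z f fi.
  rewrite (_ : (fun x => _) = cst 0); last by apply/funext => x; rewrite big_ord0.
  split; first by split; exact: integrable0.
  rewrite big_ord0 /cintegral; apply: complex_ext => /=;
    by rewrite /Rintegral integral0.
have [h1 h2] := IH (fun k => z (lift ord0 k)) (fun k => f (lift ord0 k)) (fun k => fi _).
have [k1 k2] := cintegralZ (z ord0) (fi ord0).
have [l1 l2] := cintegralD k1 h1.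
rewrite (_ : (fun x => _) = (fun x => (z ord0)%:C * f ord0 x +
  \sum_k (z (lift ord0 k))%:C * f (lift ord0 k) x)); last first.
  by apply/funext => x; rewrite big_ord_recl.
by split => //; rewrite l2 k2 h2 big_ord_recl.
Qed.

End product_bounds.

(** * Wave packets and their Bessel potentials *)

Section wave_packets.
Variables (R : realType) (n : nat).
Local Notation d := n.+1.
Local Notation mu := (lebesgue_rV R d).
Local Notation leb := (@lebesgue_measure R).
Local Notation normc := ComplexField.Normc.normc.
Implicit Types (x xi : 'rV[R]_d) (a t tau sig : R).

Definition freq a (j : 'I_d) : R := if j == ord0 then a else 0.

Definition wave a t x : R[i] :=
  (expR (- (t / 2 * dot x x)))%:C * expi (a * x ord0 ord0).

(** A Gaussian centred at (a, 0, ..., 0), as a product over the coordinates since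
    this is the form in which its integrals factor. *)
Definition gauss tau a xi : R := \prod_j gs (tau / 2) (freq a j) (xi ord0 j).

Definition symb sig xi : R := (1 + dot xi xi) `^ (sig / 2).

Lemma freq0 j : freq 0 j = 0.
Proof. by rewrite /freq if_same. Qed.

Lemma sum_freq a x : \sum_j freq a j * x ord0 j = a * x ord0 ord0.
Proof.
rewrite (bigD1 ord0)//= /freq eqxx big1 ?addr0// => j /negPf ->.
by rewrite mul0r.
Qed.

Lemma waveE a t x : wave a t x =
  \prod_j ((gs (t / 2) 0 (x ord0 j))%:C * expi (freq a j * x ord0 j)).
Proof.
rewrite big_split /= -real_complex_prod -expi_sum sum_freq; congr (_%:C * _).
rewrite /gs prod_expR; congr expR; rewrite sumrN /dot mulr_sumr; congr (- _).
by apply: eq_bigr => j _; rewrite subr0 expr2.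
Qed.

Lemma gauss_wave tau xi : (gauss tau 0 xi)%:C = wave 0 tau xi.
Proof.
rewrite waveE /gauss real_complex_prod; apply: eq_bigr => j _.
by rewrite freq0 mul0r expi0 mulr1.
Qed.

(** Fourier transform of a Gaussian, in a form that serves for the direct and
    for the inverse transform. *)
Lemma gauss_transform tau a x : 0 < tau ->
  cintegrable (fun xi => (gauss tau a xi)%:C * expi (dot x xi)) /\
  cintegral setT (fun xi => (gauss tau a xi)%:C * expi (dot x xi)) =
    (Num.sqrt (2 * pi / tau) ^+ d)%:C * wave a tau^-1 x.
Proof.
move=> t0.
have E : (fun xi => (gauss tau a xi)%:C * expi (dot x xi)) =
    fun xi => \prod_j ((gs (tau / 2) (freq a j) (xi ord0 j))%:C *
                       expi (x ord0 j * xi ord0 j)).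
  by apply/funext => xi; rewrite big_split /= -real_complex_prod -expi_sum.
rewrite E.
have [h1 h2] := cintegral_prod (fun j =>
  proj1 (@gauss_char R tau (freq a j) t0 (x ord0 j))).
split => //; rewrite h2 waveE.
rewrite (eq_bigr (fun j => (Num.sqrt (2 * pi / tau))%:C *
   ((gs (tau^-1 / 2) 0 (x ord0 j))%:C * expi (freq a j * x ord0 j)))); last first.
  move=> j _; rewrite (proj2 (@gauss_char R tau (freq a j) t0 (x ord0 j))).
  rewrite realCM -[LHS]mulrA; congr (_ * (_ * expi _)); last exact: mulrC.
  by congr (_%:C); rewrite /gs subr0; congr expR; congr (- _); field; rewrite gt_eqF.
by rewrite big_split /= prodr_const card_ord rmorphXn.
Qed.

(** The transform of the linear term in the expansion of the symbol. *)
Lemma gauss_transform_moment tau a x : 0 < tau ->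
  cintegrable (fun xi => ((xi ord0 ord0 - a) * gauss tau a xi)%:C * expi (dot x xi)) /\
  cintegral setT (fun xi => ((xi ord0 ord0 - a) * gauss tau a xi)%:C * expi (dot x xi)) =
    (0 +i* (x ord0 ord0 / tau)) *
      ((Num.sqrt (2 * pi / tau) ^+ d)%:C * wave a tau^-1 x).
Proof.
move=> t0.
pose h (j : 'I_d) : R -> R[i] := if j == ord0
  then fun v => ((v - a) * gs (tau / 2) a v)%:C * expi (x ord0 j * v)
  else fun v => (gs (tau / 2) 0 v)%:C * expi (x ord0 j * v).
have E : (fun xi => ((xi ord0 ord0 - a) * gauss tau a xi)%:C * expi (dot x xi)) =
    fun xi => \prod_j h j (xi ord0 j).
  apply/funext => xi; rewrite /gauss /dot expi_sum realCM real_complex_prod.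
  rewrite -mulrA -big_split /= [in LHS](bigD1 ord0)//= [in RHS](bigD1 ord0)//=.
  rewrite /h ?eqxx realCM !mulrA; congr (_ * _).
  by apply: eq_bigr => j /negPf j0; rewrite /freq j0.
have hi j : cintegrable1 (h j).
  rewrite /h; case: ifP => _.
    exact: (proj1 (@gauss_char_moment R tau a t0 (x ord0 j))).
  exact: (proj1 (@gauss_char R tau 0 t0 (x ord0 j))).
rewrite E; have [h1 h2] := cintegral_prod hi.
split => //; rewrite h2 -(proj2 (gauss_transform a x t0)).
rewrite (_ : (fun xi => (gauss tau a xi)%:C * expi (dot x xi)) =
    fun xi => \prod_j ((gs (tau / 2) (freq a j) (xi ord0 j))%:C *
                       expi (x ord0 j * xi ord0 j))); last first.
  by apply/funext => xi; rewrite big_split /= -real_complex_prod -expi_sum.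
rewrite (proj2 (cintegral_prod (fun j =>
  proj1 (@gauss_char R tau (freq a j) t0 (x ord0 j))))).
rewrite (bigD1 ord0)//= [in RHS](bigD1 ord0)//= mulrA; congr (_ * _).
  rewrite /h ?eqxx (proj2 (@gauss_char_moment R tau a t0 _)).
  by rewrite /freq ?eqxx (proj2 (@gauss_char R tau a t0 _)).
by apply: eq_bigr => j /negPf j0; rewrite /h /freq j0.
Qed.

Lemma fourier_wave a t xi : 0 < t ->
  cintegrable (fun x => wave a t x * expi (- dot x xi)) /\
  fourier (wave a t) xi = (Num.sqrt (2 * pi / t) ^+ d * gauss t^-1 a xi)%:C.
Proof.
move=> t0; pose y : 'rV[R]_d := \row_j (freq a j - xi ord0 j).
have E : (fun x => wave a t x * expi (- dot x xi)) =
    fun x => (gauss t 0 x)%:C * expi (dot y x).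
  apply/funext => x; rewrite gauss_wave /wave mul0r expi0 mulr1 -mulrA -expiD.
  congr (_ * expi _); rewrite -sum_freq /dot -sumrN -big_split /=.
  by apply: eq_bigr => j _; rewrite mxE; ring.
have [h1 h2] := gauss_transform 0 y t0.
rewrite /fourier E; split => //; rewrite h2 -gauss_wave -realCM; congr (_ * _)%:C.
rewrite /gauss; apply: eq_bigr => j _; rewrite /gs mxE freq0 subr0.
by congr (expR (- (_ * _))); ring.
Qed.

Lemma symb_ge0 sig xi : 0 <= symb sig xi. Proof. exact: powR_ge0. Qed.

Lemma measurable_symb sig : measurable_fun [set: 'rV[R]_d] (symb sig).
Proof.
apply: (measurableT_comp (measurable_powR (sig / 2))).
apply: measurable_funD; first exact: measurable_cst.
exact: (@measurable_sqnorm R d).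
Qed.

Lemma measurable_gauss tau a : measurable_fun [set: 'rV[R]_d] (gauss tau a).
Proof.
exact: (measurable_prod_coord (fun j => measurable_gs (tau / 2) (freq a j))).
Qed.

(** An upper bound that factors over the coordinates. *)
Lemma sqnorm_le_prod xi : 1 + dot xi xi <= \prod_j (1 + xi ord0 j ^+ 2).
Proof.
rewrite /dot; elim: (index_enum _) => [|j s IH]; first by rewrite !big_nil addr0.
rewrite !big_cons -expr2.
have h : 0 <= \sum_(i <- s) xi ord0 i * xi ord0 i.
  by apply: sumr_ge0 => i _; rewrite -expr2 sqr_ge0.
by have := sqr_ge0 (xi ord0 j); nra.
Qed.

Lemma sqnorm_shift a xi : 1 + dot xi xi <= 2 * (1 + a ^+ 2) *
  \prod_j (1 + (xi ord0 j - freq a j) ^+ 2).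
Proof.
pose eta : 'rV[R]_d := \row_j (xi ord0 j - freq a j).
have hx : dot xi xi <= 2 * dot eta eta + 2 * a ^+ 2.
  rewrite (_ : a ^+ 2 = \sum_j freq a j * freq a j); last first.
    rewrite (bigD1 ord0)//= {1 2}/freq eqxx big1 ?addr0 ?expr2// => j /negPf j0.
    by rewrite /freq j0 mul0r.
  rewrite /dot !mulr_sumr -big_split /=; apply: ler_sum => j _.
  by rewrite !mxE; have := sqr_ge0 (xi ord0 j - 2 * freq a j); lra.
have hp := sqnorm_le_prod eta.
have <- : \prod_j (1 + eta ord0 j ^+ 2) = \prod_j (1 + (xi ord0 j - freq a j) ^+ 2).
  by apply: eq_bigr => j _; rewrite mxE.
have h0 := dot_ge0 eta; have := sqr_ge0 a; nra.
Qed.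

Section bessel_wave.
Variables (sig a tau : R) (t0 : 0 < tau).

Lemma symb_gauss_le : exists2 C : R, 0 <= C & forall xi,
  `|symb sig xi * gauss tau a xi| <=
  C * \prod_j gs (tau / 2 / 2) (freq a j) (xi ord0 j).
Proof.
have t2 : 0 < tau / 2 by rewrite divr_gt0.
have [m sm] : exists m : nat, sig / 2 <= m%:R.
  exists (Num.bound `|sig / 2|); rewrite (le_trans (ler_norm _))//.
  by rewrite ltW// archi_boundP.
have [C C0 HC] := poly_gs m t2.
pose K := (2 * (1 + a ^+ 2)) ^+ m.
have K0 : 0 <= K by rewrite exprn_ge0// mulr_ge0// addr_ge0// sqr_ge0.
exists (K * C ^+ d) => [|xi]; first by rewrite mulr_ge0// exprn_ge0.
rewrite ger0_norm; last first.
  by rewrite mulr_ge0 ?symb_ge0//; apply: prodr_ge0 => j _; exact: gs_ge0.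
have s1 : symb sig xi <= K * \prod_j (1 + (xi ord0 j - freq a j) ^+ 2) ^+ m.
  rewrite prodrXl -exprMn.
  apply: (@le_trans _ _ ((1 + dot xi xi) ^+ m)).
    rewrite -powR_mulrn; last by rewrite addr_ge0// dot_ge0.
    by apply: ler_powR => //; rewrite lerDl dot_ge0.
  by rewrite lerXn2r ?nnegrE ?sqnorm_shift// ?(le_trans _ (sqnorm_shift a xi)) ?addr_ge0 ?dot_ge0.
apply: (@le_trans _ _ (K * \prod_j ((1 + (xi ord0 j - freq a j) ^+ 2) ^+ m *
    gs (tau / 2) (freq a j) (xi ord0 j)))).
  rewrite big_split /= mulrA ler_wpM2r//.
  by apply: prodr_ge0 => j _; exact: gs_ge0.
rewrite -mulrA ler_wpM2l//.
have -> : C ^+ d = \prod_(j < d) C by rewrite prodr_const card_ord.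
rewrite -big_split /=.
apply: ler_prod => j _; rewrite HC andbT mulr_ge0 ?gs_ge0//.
by rewrite exprn_ge0// addr_ge0// sqr_ge0.
Qed.

Lemma cintegrable_symb_gauss x :
  cintegrable (fun xi => (symb sig xi * gauss tau a xi)%:C * expi (dot x xi)).
Proof.
have t4 : 0 < tau / 2 / 2 by rewrite !divr_gt0.
have [C C0 HC] := symb_gauss_le.
apply: (@cintegrable_prod_le _ _ (fun j => gs (tau / 2 / 2) (freq a j))
  (fun=> Num.sqrt (pi / (tau / 2 / 2))) C) => //.
- by move=> j; exact: measurable_gs.
- by move=> j v; exact: gs_ge0.
- by move=> j; rewrite integral_gs.
- by apply: measurable_funM; [exact: measurable_symb|exact: measurable_gauss].
Qed.

End bessel_wave.

(** J^sig of a wave packet of frequency a and width tau^(1/2), up to the factor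
    [wave_cst]. *)
Definition symb_transform sig tau a x : R[i] :=
  cintegral setT (fun xi => (symb sig xi * gauss tau a xi)%:C * expi (dot x xi)).

(** The constant of the inverse Fourier transform times the one that
    [fourier_wave] produces. *)
Definition wave_cst t : R := (2 * pi) ^- d * Num.sqrt (2 * pi / t) ^+ d.

(** The Fourier transform of each packet is a Gaussian, against which the symbol
    is integrable, so that the sum and the integrals may be exchanged. *)
Lemma bessel_sum_wave sig N (z a t : 'I_N -> R) x : (forall k, 0 < t k) ->
  bessel sig (fun x => \sum_k (z k)%:C * wave (a k) (t k) x) x =
  \sum_k (z k)%:C * ((wave_cst (t k))%:C * symb_transform sig (t k)^-1 (a k) x).
Proof.
move=> t0; pose S k : R := Num.sqrt (2 * pi / t k) ^+ d.
have F xi : fourier (fun x => \sum_k (z k)%:C * wave (a k) (t k) x) xi =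
    \sum_k (z k)%:C * (S k * gauss (t k)^-1 (a k) xi)%:C.
  have h k := fourier_wave (a k) xi (t0 k).
  rewrite /fourier (_ : (fun x => _) = fun x => \sum_k (z k)%:C *
      (wave (a k) (t k) x * expi (- dot x xi))); last first.
    apply/funext => y; rewrite mulr_suml; apply: eq_bigr => k _.
    by rewrite mulrA.
  rewrite (proj2 (cintegral_sum z (fun k => proj1 (h k)))).
  by apply: eq_bigr => k _; rewrite -(proj2 (h k)).
rewrite /bessel /fourier_multiplier /inv_fourier.
have ti k : 0 < (t k)^-1 by rewrite invr_gt0.
rewrite (_ : (fun xi => _) = fun xi => \sum_k (z k * S k)%:C *
   ((symb sig xi * gauss (t k)^-1 (a k) xi)%:C * expi (dot x xi))); last first.
  apply/funext => xi; rewrite F mulr_sumr mulr_suml; apply: eq_bigr => k _.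
  by rewrite -/(symb sig xi) !realCM; ring.
rewrite (proj2 (cintegral_sum (fun k => z k * S k)
  (fun k => cintegrable_symb_gauss sig (a k) (ti k) x))).
rewrite mulr_sumr; apply: eq_bigr => k _.
by rewrite /wave_cst -/(S k) /symb_transform !realCM; ring.
Qed.

End wave_packets.

(** * Derivatives of the symbol along a line *)

Section symbol_calculus.
Variable R : realType.

(** Polynomials in the three quantities
      p = v / (r B),  z = 1 / (r^2 B),  w = r (v - c),  with B = A + v^2,
    an algebra that r^-1 d/dv maps to itself. *)
Inductive sexp : Type :=
| Sconst of R | Sp | Sz | Sw | Sadd of sexp & sexp | Smul of sexp & sexp.

Fixpoint seval (e : sexp) (p z w : R) : R :=
  match e with
  | Sconst c => c | Sp => p | Sz => z | Sw => w
  | Sadd e1 e2 => seval e1 p z w + seval e2 p z w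
  | Smul e1 e2 => seval e1 p z w * seval e2 p z w
  end.

Fixpoint sder (e : sexp) : sexp :=
  match e with
  | Sconst _ => Sconst 0
  | Sp => Sadd Sz (Smul (Sconst (- 2)) (Smul Sp Sp))
  | Sz => Smul (Sconst (- 2)) (Smul Sp Sz)
  | Sw => Sconst 1
  | Sadd e1 e2 => Sadd (sder e1) (sder e2)
  | Smul e1 e2 => Sadd (Smul (sder e1) e2) (Smul e1 (sder e2))
  end.

(** Homogeneity: |p| <= z^(1/2), so that p counts for 1 and z for 2. *)
Fixpoint sdeg (e : sexp) : nat :=
  match e with
  | Sconst _ => 0 | Sp => 1 | Sz => 2 | Sw => 1
  | Sadd e1 e2 => maxn (sdeg e1) (sdeg e2)
  | Smul e1 e2 => sdeg e1 + sdeg e2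
  end%N.

Lemma sdeg_der e : (sdeg (sder e) <= (sdeg e).+1)%N.
Proof.
elim: e => //= [e1 h1 e2 h2|e1 h1 e2 h2].
  by lia.
by lia.
Qed.

Lemma seval_bound e k : (sdeg e <= k)%N -> exists2 C : R, 0 <= C &
  forall p y w : R, 0 <= y -> `|p| <= y ->
    `|seval e p (y ^+ 2) w| <= C * ((1 + y) ^+ k * (1 + `|w|) ^+ k).
Proof.
have mono (k1 k2 : nat) (y : R) : (k1 <= k2)%N -> 0 <= y -> (1 + y) ^+ k1 <= (1 + y) ^+ k2.
  by move=> kk y0; rewrite ler_weXn2l// lerDl.
have one (k1 : nat) (y : R) : 0 <= y -> 1 <= (1 + y) ^+ k1.
  by move=> y0; rewrite exprn_ege1// lerDl.
elim: e k => [c|| | |e1 IH1 e2 IH2|e1 IH1 e2 IH2] k /= hk.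
- exists `|c| => // p y w y0 _; rewrite ler_peMr//.
  by rewrite mulr_ege1// one.
- exists 1 => // p y w y0 py; rewrite mul1r -[leLHS]mulr1.
  apply: ler_pM => //; last by rewrite one.
  by apply: le_trans py (le_trans _ (mono _ _ _ hk y0)); rewrite expr1; lra.
- exists 1 => // p y w y0 py; rewrite mul1r -[leLHS]mulr1.
  apply: ler_pM => //; last by rewrite one.
  rewrite ger0_norm ?sqr_ge0//; apply: le_trans (mono _ _ _ hk y0).
  by rewrite lerXn2r ?nnegrE//; lra.
- exists 1 => // p y w y0 py; rewrite mul1r -[leLHS]mul1r.
  apply: ler_pM => //; first by rewrite one.
  by apply: le_trans (mono _ _ _ hk (normr_ge0 w)); rewrite expr1; lra.
- move: hk; rewrite geq_max => /andP[hk1 hk2].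
  have [C1 C10 H1] := IH1 _ hk1; have [C2 C20 H2] := IH2 _ hk2.
  exists (C1 + C2) => [|p y w y0 py]; first exact: addr_ge0.
  rewrite mulrDl; apply: le_trans (ler_normD _ _) (lerD _ _); [exact: H1|exact: H2].
- have [C1 C10 H1] := IH1 _ (leqnn _); have [C2 C20 H2] := IH2 _ (leqnn _).
  exists (C1 * C2) => [|p y w y0 py]; first exact: mulr_ge0.
  rewrite normrM; apply: le_trans (ler_pM _ _ (H1 _ _ w y0 py) (H2 _ _ w y0 py)) _ => //.
  rewrite mulrACA ler_wpM2l ?mulr_ge0// mulrACA -!exprD.
  by apply: ler_pM; rewrite ?exprn_ge0 ?addr_ge0//; apply: mono.
Qed.

(** The polynomial factor of the k-th derivative of B^(sig/2) exp(-w^2/2). *)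
Fixpoint sderiv (sig : R) (k : nat) : sexp :=
  if k is k'.+1 then
    let e := sderiv sig k' in
    Sadd (Smul (Sadd (Smul (Sconst sig) Sp) (Smul (Sconst (- 1)) Sw)) e) (sder e)
  else Sconst 1.

Lemma sdeg_sderiv sig k : (sdeg (sderiv sig k) <= k)%N.
Proof.
elim: k => //= k IH; rewrite geq_max; apply/andP; split; first lia.
exact: leq_trans (sdeg_der _) _.
Qed.

Section slice.
Variables (r A c : R).
Hypotheses (r0 : 0 < r) (A1 : 1 <= A).

Definition slice_p v := v / (r * (A + v ^+ 2)).
Definition slice_z v := (r ^+ 2 * (A + v ^+ 2))^-1.
Definition slice_w v := r * (v - c).

Let B0 v : 0 < A + v ^+ 2.
Proof. by rewrite ltr_wpDr ?sqr_ge0// (lt_le_trans ltr01). Qed.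

Let dB v : is_derive v (1 : R) (fun v => A + v ^+ 2) (2 * v).
Proof.
under eq_fun do rewrite expr2.
by apply: (Deq (Dadd (Dcst A v) (Dmul (Did v) (Did v)))); ring.
Qed.

Let dBi v : is_derive v (1 : R) (fun v => (A + v ^+ 2)^-1) (- (2 * v) / (A + v ^+ 2) ^+ 2).
Proof.
have h := is_deriveV (f := fun v => A + v ^+ 2) (lt0r_neq0 (B0 v)) (dB v).
by apply: (Deq h); rewrite /GRing.scale /=; field; rewrite gt_eqF.
Qed.

Let dslice_p v : is_derive v (1 : R) slice_p (r * (slice_z v + - 2 * (slice_p v * slice_p v))).
Proof.
rewrite (_ : slice_p = fun v => r^-1 * (v * (A + v ^+ 2)^-1)); last first.
  by apply/funext => u; rewrite /slice_p invfM; ring.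
apply: (Deq (Dcmul r^-1 (Dmul (Did v) (dBi v)))).
by rewrite /slice_z; field; rewrite !gt_eqF.
Qed.

Let dslice_z v : is_derive v (1 : R) slice_z (r * (- 2 * (slice_p v * slice_z v))).
Proof.
rewrite (_ : slice_z = fun v => r^-1 ^+ 2 * (A + v ^+ 2)^-1); last first.
  by apply/funext => u; rewrite /slice_z invfM exprVn.
apply: (Deq (Dcmul (r^-1 ^+ 2) (dBi v))).
by rewrite /slice_p; field; rewrite !gt_eqF.
Qed.

Lemma is_derive_seval e v :
  is_derive v (1 : R) (fun v => seval e (slice_p v) (slice_z v) (slice_w v))
    (r * seval (sder e) (slice_p v) (slice_z v) (slice_w v)).
Proof.
elim: e => [x|| | |e1 IH1 e2 IH2|e1 IH1 e2 IH2] /=.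
- by apply: (Deq (Dcst x v)); rewrite mulr0.
- exact: dslice_p.
- exact: dslice_z.
- by apply: (Deq (Daff r c v)); rewrite mulr1.
- by apply: (Deq (Dadd IH1 IH2)); rewrite mulrDr.
- by apply: (Deq (Dmul IH1 IH2)); ring.
Qed.

Definition slice_deriv sig k v := r ^+ k *
  ((A + v ^+ 2) `^ (sig / 2) * gs (r ^+ 2 / 2) c v *
   seval (sderiv sig k) (slice_p v) (slice_z v) (slice_w v)).

Lemma is_derive_slice_deriv sig k v :
  is_derive v (1 : R) (slice_deriv sig k) (slice_deriv sig k.+1 v).
Proof.
have dP := @Dcomp _ (fun u => u `^ (sig / 2)) (fun v => A + v ^+ 2) v _ _ 
  (is_derive1_powR (sig / 2) (B0 v)) (dB v).
have h := Dcmul (r ^+ k) (Dmul (Dmul dP (is_derive_gs (r ^+ 2 / 2) c v))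
  (is_derive_seval (sderiv sig k) v)).
apply: (Deq h); rewrite /slice_deriv /= (exprS r k).
have -> : (A + v ^+ 2) `^ (sig / 2) = (A + v ^+ 2) * (A + v ^+ 2) `^ (sig / 2 - 1).
  rewrite -{2}[A + v ^+ 2]powRr1 ?(ltW (B0 v))// -powRD ?(gt_eqF (B0 v)) ?implybT//.
  by congr (_ `^ _); ring.
by rewrite /slice_p /slice_w; field; rewrite !gt_eqF.
Qed.

End slice.
End symbol_calculus.

(** * The symbol near the origin *)

Section symbol_bound.
Variables (R : realType) (n : nat).
Local Notation d := n.+1.
Implicit Types (x xi : 'rV[R]_d) (r a sig : R).

Lemma powR_halfM (u q : R) : 0 <= u -> (u ^+ 2) `^ (q / 2) = u `^ q.
Proof.
move=> u0; rewrite -(powR_mulrn 2 u0) -powRrM; congr (_ `^ _).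
by field.
Qed.

Lemma prod1D_ge1 (F : 'I_d -> R) : (forall j, 0 <= F j) -> 1 <= \prod_j (1 + F j).
Proof.
move=> F0; rewrite -[leLHS](_ : \prod_(j < d) 1 = 1); last by rewrite big1.
by apply: ler_prod => j _; rewrite ler01 lerDl F0.
Qed.

Lemma coord_le_prod1D (F : 'I_d -> R) j : (forall j, 0 <= F j) ->
  1 + F j <= \prod_j (1 + F j).
Proof.
move=> F0; rewrite (bigD1 j)//= ler_peMr ?addr_ge0//.
rewrite -[leLHS](_ : \prod_(i < d | i != j) 1 = 1); last by rewrite big1.
by apply: ler_prod => i _; rewrite ler01 lerDl F0.
Qed.

(** Splits a singularity of order d - sig evenly among the d coordinates, so that
    each of them carries an order below 1; the minimum makes this order nonnegative
    for large sig. *)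
Definition sing_exp sig : R := 1 - Num.min sig (d%:R / 2) / d%:R.

Lemma sing_exp_itv sig : 0 < sig -> 0 <= sing_exp sig < 1.
Proof.
move=> s0; rewrite /sing_exp; have d0 : 0 < d%:R :> R by rewrite ltr0n.
apply/andP; split.
  rewrite subr_ge0 ler_pdivrMr// mul1r; apply: (@le_trans _ _ (d%:R / 2)).
    by rewrite ge_min lexx orbT.
  by lra.
rewrite ltrBlDr ltrDl divr_gt0// lt_min s0/= divr_gt0//.
Qed.

Lemma sqnorm_scaled_le r a xi : 0 < r <= 1 -> 1 <= r * a ->
  r ^+ 2 * (1 + dot xi xi) <=
  4 * (r * a) ^+ 2 * \prod_j (1 + (r * (xi ord0 j - freq a j)) ^+ 2).
Proof.
move=> /andP[r0 r1] ra.
pose eta : 'rV[R]_d := \row_j (r * (xi ord0 j - freq a j)).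
have hx : r ^+ 2 * dot xi xi <= 2 * dot eta eta + 2 * (r * a) ^+ 2.
  rewrite (_ : (r * a) ^+ 2 = r ^+ 2 * \sum_(j < d) freq a j * freq a j); last first.
    rewrite exprMn; congr (_ * _).
    rewrite (bigD1 ord0)//= {1 2}/freq eqxx big1 ?addr0 ?expr2// => j /negPf j0.
    by rewrite /freq j0 mul0r.
  rewrite /dot !mulr_sumr -big_split /=; apply: ler_sum => j _.
  rewrite !mxE; have := sqr_ge0 (r * (xi ord0 j - 2 * freq a j)); lra.
have := sqnorm_le_prod eta.
rewrite (_ : \prod_j (1 + eta ord0 j ^+ 2) =
  \prod_j (1 + (r * (xi ord0 j - freq a j)) ^+ 2)); last first.
  by apply: eq_bigr => j _; rewrite mxE.
set W := \prod_j _ => hW.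
have W1 : 1 <= W by apply: prod1D_ge1 => j; exact: sqr_ge0.
have h0 := dot_ge0 eta.
have ra2 : 1 <= (r * a) ^+ 2 by rewrite exprn_ege1.
have r2 : r ^+ 2 <= 1 by rewrite exprn_ile1// ltW.
nra.
Qed.

(** The factor (1 + Y^(-1/2))^K, with Y = r^2 (1 + |xi|^2), is what K
    derivatives of the symbol cost; up to K = d it stays integrable at the origin,
    uniformly in r, once multiplied by Y^(sig/2) with sig > 0. *)
Lemma symbol_factor_le sig K : 0 < sig -> (K <= d)%N ->
  exists (C : R) (m : nat), 0 <= C /\ forall r a xi, 0 < r <= 1 -> 1 <= r * a ->
    (r ^+ 2 * (1 + dot xi xi)) `^ (sig / 2) *
      (1 + Num.sqrt (r ^+ 2 * (1 + dot xi xi))^-1) ^+ K <=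
    C * (r * a) `^ sig * \prod_j (1 + (r * (xi ord0 j - freq a j)) ^+ 2) ^+ m *
      \prod_j (1 + (r + r * `|xi ord0 j|) `^ (- sing_exp sig)).
Proof.
move=> s0 Kd; have [m sm] : exists m : nat, sig / 2 <= m%:R.
  exists (Num.bound `|sig / 2|); rewrite (le_trans (ler_norm _))//.
  by rewrite ltW// archi_boundP.
have /andP[th0 th1] := sing_exp_itv s0; set th := sing_exp sig in th0 th1 *.
exists (2 ^+ K * (4 `^ (sig / 2) + 2 ^+ d)), m; split.
  by rewrite mulr_ge0 ?exprn_ge0// addr_ge0 ?powR_ge0 ?exprn_ge0.
move=> r a xi r01 ra; have /andP[r0 r1] := r01.
have := sqnorm_scaled_le xi r01 ra.
have -> : \prod_j (1 + (r * (xi ord0 j - freq a j)) ^+ 2) ^+ m =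
    (\prod_j (1 + (r * (xi ord0 j - freq a j)) ^+ 2)) ^+ m by rewrite prodrXl.
set W := \prod_j (1 + (r * _) ^+ 2); set Y := r ^+ 2 * _ => YW.
set S := \prod_j (1 + _ `^ _).
have W1 : 1 <= W by apply: prod1D_ge1 => j; exact: sqr_ge0.
have S1 : 1 <= S by apply: prod1D_ge1 => j; exact: powR_ge0.
have B1 : 1 <= 1 + dot xi xi by rewrite lerDl dot_ge0.
have Y0 : 0 < Y by rewrite /Y mulr_gt0 ?exprn_gt0// (lt_le_trans ltr01).
have ras : 1 <= (r * a) `^ sig by apply: powR_ge1 => //; exact: ltW.
have Wm1 : 1 <= W ^+ m by rewrite exprn_ege1.
have K20 : 0 <= 2 ^+ K :> R by rewrite exprn_ge0.
have d20 : 0 <= 2 ^+ d :> R by rewrite exprn_ge0.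
have s40 : 0 <= 4 `^ (sig / 2) :> R by exact: powR_ge0.
(* for Y >= 1 the second factor is bounded and the first one grows polynomially; for
   Y < 1 the second factor is at most of order Y^(-d/2), which the coordinates share *)
have [Y1|Y1] := leP 1 Y.
  have y1 : (1 + Num.sqrt Y^-1) ^+ K <= 2 ^+ K.
    rewrite lerXn2r ?nnegrE ?addr_ge0//.
    have : Num.sqrt Y^-1 <= 1 by rewrite -sqrtr1 ler_wsqrtr// invf_le1.
    lra.
  have Ys : Y `^ (sig / 2) <= 4 `^ (sig / 2) * (r * a) `^ sig * W ^+ m.
    apply: (@le_trans _ _ ((4 * (r * a) ^+ 2 * W) `^ (sig / 2))).
      apply: ge0_ler_powR => //; rewrite ?nnegrE ?(ltW Y0)//; first lra.
      by apply: le_trans YW; exact: ltW.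
    have ra0 : 0 <= r * a by apply: le_trans ra.
    have W0 : 0 <= W by apply: le_trans W1.
    rewrite (@powRM _ (4 * (r * a) ^+ 2) W)//; last by rewrite mulr_ge0// sqr_ge0.
    rewrite (@powRM _ 4 ((r * a) ^+ 2))//; last exact: sqr_ge0.
    rewrite powR_halfM//.
    have c0 : 0 <= 4 `^ (sig / 2) * (r * a) `^ sig by rewrite mulr_ge0 ?powR_ge0.
    by rewrite ler_wpM2l// -powR_mulrn// ler_powR.
  apply: (@le_trans _ _ (4 `^ (sig / 2) * (r * a) `^ sig * W ^+ m * 2 ^+ K)).
    by apply: ler_pM => //; rewrite ?powR_ge0// exprn_ge0// addr_ge0.
  set u := (r * a) `^ sig in ras *; set v := W ^+ m in Wm1 *.
  have u0 : 0 <= u by rewrite (le_trans ler01).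
  have v0 : 0 <= v by rewrite (le_trans ler01).
  have w0 : 0 <= u * v * 2 ^+ K by apply: mulr_ge0 => //; exact: mulr_ge0.
  have h1 : 4 `^ (sig / 2) * (u * v * 2 ^+ K) <= (4 `^ (sig / 2) + 2 ^+ d) * (u * v * 2 ^+ K).
    by rewrite ler_wpM2r// lerDl.
  have h2 : (4 `^ (sig / 2) + 2 ^+ d) * (u * v * 2 ^+ K) <=
      (4 `^ (sig / 2) + 2 ^+ d) * (u * v * 2 ^+ K) * S.
    by rewrite ler_peMr//; apply: mulr_ge0 => //; exact: addr_ge0.
  lra.
have y0 : Num.sqrt Y^-1 = Y `^ (- 2^-1).
  by rewrite powRN powR12_sqrt ?ltW// sqrtrV// ltW.
have y1 : 1 <= Num.sqrt Y^-1.
  by rewrite -sqrtr1 ler_wsqrtr// invf_ge1// ltW.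
have yK : (1 + Num.sqrt Y^-1) ^+ K <= 2 ^+ K * Num.sqrt Y^-1 ^+ d.
  apply: (@le_trans _ _ ((2 * Num.sqrt Y^-1) ^+ K)).
    by rewrite lerXn2r ?nnegrE ?addr_ge0 ?mulr_ge0//; lra.
  by rewrite exprMn ler_wpM2l// ler_weXn2l.
have sj j : Y `^ (- (th / 2)) <= 2 * (r + r * `|xi ord0 j|) `^ (- th).
  have u0 : 0 < r + r * `|xi ord0 j| by rewrite ltr_pwDl// mulr_ge0// ltW.
  set u := r + _ in u0 *.
  have uY : u ^+ 2 / 2 <= Y.
    have hj : xi ord0 j ^+ 2 <= dot xi xi.
      rewrite /dot (bigD1 j)//= -expr2 lerDl; apply: sumr_ge0 => i _.
      by rewrite -expr2 sqr_ge0.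
    have -> : u ^+ 2 = r ^+ 2 * (1 + `|xi ord0 j|) ^+ 2 by rewrite /u; ring.
    rewrite /Y -mulrA ler_wpM2l ?sqr_ge0//.
    have := sqr_ge0 (1 - `|xi ord0 j|); rewrite !sqrrD sqrrN.
    rewrite real_normK ?num_real//; lra.
  have u20 : 0 < u ^+ 2 / 2 by rewrite divr_gt0// exprn_gt0.
  have t20 : 0 <= th / 2 by rewrite divr_ge0.
  apply: le_trans (powR_anti t20 u20 uY) _.
  have h2 : 2^-1 `^ (- (th / 2)) <= 2 :> R.
    apply: (@le_trans _ _ (2^-1 `^ (-1))); last by rewrite powR_inv1// invrK.
    by apply: ger_powR; lra.
  rewrite (@powRM _ (u ^+ 2)) ?sqr_ge0 ?invr_ge0//.
  rewrite (_ : - (th / 2) = - th / 2); last by rewrite mulNr.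
  rewrite powR_halfM ?(ltW u0)// mulrC ler_wpM2r ?powR_ge0//.
  by rewrite mulNr.
have YS : Y `^ (sig / 2) * Num.sqrt Y^-1 ^+ d <= 2 ^+ d * S.
  apply: (@le_trans _ _ (\prod_(j < d) Y `^ (- (th / 2)))).
    rewrite prodr_const card_ord -!powR_mulrn ?powR_ge0 ?sqrtr_ge0// y0 -!powRrM.
    rewrite -powRD ?(gt_eqF Y0) ?implybT//.
    apply: ger_powR; first by rewrite Y0 ltW.
    have d0 : 0 < d%:R :> R by rewrite ltr0n.
    rewrite /th /sing_exp.
    have -> : - ((1 - Num.min sig (d%:R / 2) / d%:R) / 2) * d%:R =
        (Num.min sig (d%:R / 2) - d%:R) / 2 by field; rewrite gt_eqF.
    have : Num.min sig (d%:R / 2) <= sig by rewrite ge_min lexx.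
    lra.
  have -> : 2 ^+ d = \prod_(j < d) 2 :> R by rewrite prodr_const card_ord.
  rewrite /S -big_split /=; apply: ler_prod => j _; rewrite powR_ge0 /=.
  by apply: le_trans (sj j) _; rewrite ler_wpM2l// lerDr.
apply: (@le_trans _ _ (2 ^+ K * (2 ^+ d * S))).
  apply: le_trans (_ : Y `^ (sig / 2) * (2 ^+ K * Num.sqrt Y^-1 ^+ d) <= _).
    by rewrite ler_wpM2l ?powR_ge0.
  by rewrite mulrCA ler_wpM2l.
set u := (r * a) `^ sig in ras *; set v := W ^+ m in Wm1 *.
have uv1 : 1 <= u * v by rewrite mulr_ege1.
have S0 : 0 <= S by apply: le_trans S1.
have h1 : 2 ^+ K * (2 ^+ d * S) <= 2 ^+ K * ((4 `^ (sig / 2) + 2 ^+ d) * S).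
  by rewrite ler_wpM2l// ler_wpM2r// lerDr.
have h2 : 2 ^+ K * ((4 `^ (sig / 2) + 2 ^+ d) * S) <=
    2 ^+ K * ((4 `^ (sig / 2) + 2 ^+ d) * S) * (u * v).
  by rewrite ler_peMr// mulr_ge0// mulr_ge0// addr_ge0.
lra.
Qed.

End symbol_bound.

(** * Derivatives of the symbol of a wave packet *)

Section decay.
Variables (R : realType) (n : nat).
Local Notation d := n.+1.
Local Notation mu := (lebesgue_rV R d).
Local Notation leb := (@lebesgue_measure R).
Local Notation normc := ComplexField.Normc.normc.
Implicit Types (x xi : 'rV[R]_d) (r a sig : R) (j : 'I_d).

(** The K-th derivative in direction j of the symbol times the Gaussian: each
    derivative costs a factor r, and a polynomial in the scaled quantities of the
    calculus above. *)
Definition symb_deriv sig r a j K xi : R := r ^+ K *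
  (symb sig xi * gauss (r ^+ 2) a xi *
   seval (sderiv sig K) (xi ord0 j / (r * (1 + dot xi xi)))
     (r ^+ 2 * (1 + dot xi xi))^-1 (r * (xi ord0 j - freq a j))).

Lemma measurable_seval e (p z w : 'rV[R]_d -> R) :
  measurable_fun [set: 'rV[R]_d] p -> measurable_fun [set: 'rV[R]_d] z ->
  measurable_fun [set: 'rV[R]_d] w ->
  measurable_fun [set: 'rV[R]_d] (fun xi => seval e (p xi) (z xi) (w xi)).
Proof.
move=> mp mz mw; elim: e => //= [e1 IH1 e2 IH2|e1 IH1 e2 IH2].
- exact: measurable_funD.
- exact: measurable_funM.
Qed.

Lemma measurable_invr (F : 'rV[R]_d -> R) : (forall xi, 0 < F xi) ->
  measurable_fun [set: 'rV[R]_d] F ->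
  measurable_fun [set: 'rV[R]_d] (fun xi => (F xi)^-1).
Proof.
move=> F0 mF; rewrite (_ : (fun xi => _) = fun xi => (F xi) `^ (-1)).
  exact: (measurableT_comp (measurable_powR (-1)) mF).
by apply/funext => xi; rewrite powR_inv1// ltW.
Qed.

Lemma measurable_symb_deriv sig r a j K : 0 < r ->
  measurable_fun [set: 'rV[R]_d] (symb_deriv sig r a j K).
Proof.
move=> r0.
have mB : measurable_fun [set: 'rV[R]_d] (fun xi => 1 + dot xi xi).
  apply: measurable_funD; first exact: measurable_cst.
  exact: (@measurable_sqnorm R d).
have B0 xi : 0 < 1 + dot xi xi by rewrite ltr_pwDl// dot_ge0.
apply: measurable_funM; first exact: measurable_cst.
apply: measurable_funM.
  by apply: measurable_funM; [exact: measurable_symb|exact: measurable_gauss].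
apply: measurable_seval.
- apply: measurable_funM; first exact: measurable_coord.
  apply: measurable_invr; first by move=> xi; rewrite mulr_gt0.
  by apply: measurable_funM => //; exact: measurable_cst.
- apply: measurable_invr; first by move=> xi; rewrite mulr_gt0// exprn_gt0.
  by apply: measurable_funM => //; exact: measurable_cst.
- apply: measurable_funM; first exact: measurable_cst.
  apply: measurable_funD; first exact: measurable_coord.
  exact: measurable_cst.
Qed.

(** Half of the Gaussian absorbs the factors that grow polynomially; the other half
    enters the weights. *)
Lemma symb_deriv_bound sig K : 0 < sig -> (K <= d)%N ->
  exists2 C : R, 0 <= C & forall r a j xi, 0 < r <= 1 -> 1 <= r * a ->
    `|symb_deriv sig r a j K xi| <= C * (r ^+ K * a `^ sig) *
      \prod_i weight (sing_exp n sig) 4^-1 r (freq a i) (xi ord0 i).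
Proof.
move=> s0 Kd.
have [C0 C00 HC0] := seval_bound (sdeg_sderiv sig K).
have [C1 [m [C10 HC1]]] := @symbol_factor_le R n _ _ s0 Kd.
have k4 : 0 < 4^-1 :> R by rewrite invr_gt0.
have [C2 C20 HC2] := poly_le_expR (m + K) k4.
exists (C0 * C1 * 2 ^+ K * C2 ^+ d) => [|r a j xi r01 ra].
  by rewrite !mulr_ge0// exprn_ge0.
have /andP[r0 r1] := r01.
have a0 : 0 < a by rewrite -(pmulr_rgt0 _ r0) (lt_le_trans ltr01).
have B1 : 1 <= 1 + dot xi xi by rewrite lerDl dot_ge0.
have B0 : 0 < 1 + dot xi xi by apply: lt_le_trans B1.
pose Y := r ^+ 2 * (1 + dot xi xi).
have Y0 : 0 < Y by rewrite mulr_gt0// exprn_gt0.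
pose y := Num.sqrt Y^-1.
have y2 : y ^+ 2 = Y^-1 by rewrite sqr_sqrtr// invr_ge0 ltW.
pose w i := r * (xi ord0 i - freq a i).
pose p := xi ord0 j / (r * (1 + dot xi xi)).
have py : `|p| <= y.
  rewrite -sqrtr_sqr ler_wsqrtr// /p exprMn exprVn.
  rewrite ler_pdivrMr ?exprn_gt0 ?mulr_gt0//.
  have -> : Y^-1 * (r * (1 + dot xi xi)) ^+ 2 = 1 + dot xi xi.
    by rewrite /Y; field; rewrite !gt_eqF.
  rewrite /dot (bigD1 j)//= -expr2 addrCA lerDl addr_ge0//.
  by apply: sumr_ge0 => i _; rewrite -expr2 sqr_ge0.
have hs := HC0 p y (w j) (sqrtr_ge0 _) py.
have hf := HC1 r a xi r01 ra.
have sY : Y `^ (sig / 2) = r `^ sig * symb sig xi.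
  by rewrite /Y powRM ?sqr_ge0 ?(ltW B0)// powR_halfM// ltW.
have hw : (1 + `|w j|) ^+ K <= 2 ^+ K * \prod_i (1 + w i ^+ 2) ^+ K.
  rewrite prodrXl -exprMn lerXn2r ?nnegrE ?addr_ge0 ?mulr_ge0 ?prodr_ge0//.
    by move=> i _; rewrite addr_ge0// sqr_ge0.
  have := @coord_le_prod1D R n (fun i => w i ^+ 2) j (fun i => sqr_ge0 _).
  have := norm_le_1Dsqr (w j); have := sqr_ge0 (w j).
  rewrite /= => h1 h2 h3; nra.
have g0 : 0 <= gauss (r ^+ 2) a xi by apply: prodr_ge0 => i _; exact: gs_ge0.
have sy0 := symb_ge0 sig xi.
have y0 : 0 <= y by exact: sqrtr_ge0.
have step1 : symb sig xi * `|seval (sderiv sig K) p (y ^+ 2) (w j)| <=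
   C0 * (C1 * a `^ sig * \prod_i (1 + w i ^+ 2) ^+ m *
     \prod_i (1 + (r + r * `|xi ord0 i|) `^ (- sing_exp n sig))) *
     (2 ^+ K * \prod_i (1 + w i ^+ 2) ^+ K).
  have rs : 0 < r `^ sig by rewrite powR_gt0.
  apply: (@le_trans _ _ (C0 * (symb sig xi * (1 + y) ^+ K) * (1 + `|w j|) ^+ K)).
    rewrite (_ : C0 * _ * _ = symb sig xi * (C0 * ((1 + y) ^+ K * (1 + `|w j|) ^+ K))).
      by rewrite ler_wpM2l.
    by ring.
  apply: ler_pM; [| |idtac|exact: hw].
  - by rewrite mulr_ge0// mulr_ge0// exprn_ge0// addr_ge0.
  - by rewrite exprn_ge0// addr_ge0.
  rewrite ler_wpM2l// -(ler_pM2l rs) mulrA -sY.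
  apply: le_trans hf _.
  by rewrite powRM ?(ltW r0) ?(ltW a0)// -/y; rewrite le_eqVlt; apply/orP; left;
    apply/eqP; ring.
rewrite /symb_deriv -/p -/Y -y2 -/(w j) normrM (ger0_norm (exprn_ge0 _ (ltW r0))).
rewrite mulrAC normrM (ger0_norm g0) normrM (ger0_norm sy0).
rewrite [leRHS](_ : _ = r ^+ K * (C0 * C1 * 2 ^+ K * a `^ sig * (C2 ^+ d *
   \prod_i weight (sing_exp n sig) 4^-1 r (freq a i) (xi ord0 i)))); last by ring.
rewrite ler_wpM2l ?exprn_ge0 ?(ltW r0)//.
apply: le_trans (ler_wpM2r g0 step1) _.
rewrite [leLHS](_ : _ = C0 * C1 * 2 ^+ K * a `^ sig *
  (\prod_i (1 + w i ^+ 2) ^+ m * \prod_i (1 + w i ^+ 2) ^+ K *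
   \prod_i (1 + (r + r * `|xi ord0 i|) `^ (- sing_exp n sig)) * gauss (r ^+ 2) a xi));
  last by ring.
rewrite ler_wpM2l ?mulr_ge0 ?powR_ge0 ?exprn_ge0//.
have -> : C2 ^+ d = \prod_(i < d) C2 by rewrite prodr_const card_ord.
rewrite /gauss -!big_split /=; apply: ler_prod => i _; apply/andP; split.
  have w0 : 0 <= 1 + w i ^+ 2 by rewrite addr_ge0// sqr_ge0.
  have s10 : 0 <= 1 + (r + r * `|xi ord0 i|) `^ (- sing_exp n sig).
    by rewrite addr_ge0 ?powR_ge0.
  by rewrite !mulr_ge0 ?gs_ge0// exprn_ge0.
rewrite -exprD /weight.
have -> : gs (4^-1 * r ^+ 2) (freq a i) (xi ord0 i) = expR (- (4^-1 * w i ^+ 2)).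
  by rewrite /gs /w; congr expR; ring.
have -> : gs (r ^+ 2 / 2) (freq a i) (xi ord0 i) =
    expR (- (4^-1 * w i ^+ 2)) * expR (- (4^-1 * w i ^+ 2)).
  by rewrite /gs /w -expRD; congr expR; field.
set E := expR _; set s := 1 + _ `^ _.
have Es : (1 + w i ^+ 2) ^+ (m + K) * E <= C2.
  by rewrite /E expRN ler_pdivrMr ?expR_gt0// HC2// sqr_ge0.
rewrite [leLHS](_ : _ = (1 + w i ^+ 2) ^+ (m + K) * E * (s * E)); last by ring.
by rewrite ler_wpM2r// mulr_ge0 ?expR_ge0// addr_ge0 ?powR_ge0.
Qed.


End decay.

(** * Integration by parts in the frequency variable *)

Section decay2.
Variables (R : realType) (n : nat).
Local Notation d := n.+1.
Local Notation mu := (lebesgue_rV R d).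
Local Notation leb := (@lebesgue_measure R).
Local Notation normc := ComplexField.Normc.normc.
Implicit Types (x xi : 'rV[R]_d) (r a sig : R) (j : 'I_d).

Lemma dot_upd xi j v :
  dot (upd xi j v) (upd xi j v) = dot (upd xi j 0) (upd xi j 0) + v ^+ 2.
Proof.
rewrite /dot (bigD1 j)//= [in RHS](bigD1 j)//= !updE eqxx mulr0 add0r addrC expr2.
by congr (_ + _); apply: eq_bigr => i /negPf ij; rewrite !updE ij.
Qed.

Lemma dotx_upd x xi j v :
  dot x (upd xi j v) = dot x (upd xi j 0) + x ord0 j * v.
Proof.
rewrite /dot (bigD1 j)//= [in RHS](bigD1 j)//= !updE eqxx mulr0 add0r addrC.
by congr (_ + _); apply: eq_bigr => i /negPf ij; rewrite !updE ij.
Qed.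

Lemma symb_deriv_upd sig r a j K xi v : symb_deriv sig r a j K (upd xi j v) =
  (\prod_(i | i != j) gs (r ^+ 2 / 2) (freq a i) (xi ord0 i)) *
  slice_deriv r (1 + dot (upd xi j 0) (upd xi j 0)) (freq a j) sig K v.
Proof.
rewrite /symb_deriv /slice_deriv /slice_p /slice_z /slice_w /symb dot_upd updE eqxx addrA.
rewrite /gauss (bigD1 j)//= updE eqxx.
rewrite (eq_bigr (fun i => gs (r ^+ 2 / 2) (freq a i) (xi ord0 i))); last first.
  by move=> i /negPf ij; rewrite updE ij.
ring.
Qed.

Lemma weight_le_gs th kap r a v : 0 <= th -> 0 < r ->
  weight th kap r a v <= (1 + r `^ (- th)) * gs (kap * r ^+ 2) a v.
Proof.
move=> th0 r0; rewrite /weight ler_wpM2r ?gs_ge0// lerD2l powR_anti//.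
by rewrite lerDl mulr_ge0// ltW.
Qed.

Section fixed_packet.
Variables (sig r a : R) (j : 'I_d).
Hypotheses (s0 : 0 < sig) (r01 : 0 < r <= 1) (ra : 1 <= r * a).

Let r0 : 0 < r. Proof. by have /andP[] := r01. Qed.
Let kr : 0 < 4^-1 * r ^+ 2. Proof. by rewrite mulr_gt0// exprn_gt0. Qed.

(** This discards the boundary terms of the integration by parts, so that C may depend
    on the line. *)
Lemma symb_deriv_slice_bound K xi : (K <= d)%N -> exists C, forall v,
  `|symb_deriv sig r a j K (upd xi j v)| <= C * gs (4^-1 * r ^+ 2) (freq a j) v.
Proof.
move=> Kd; have [C C0 HC] := symb_deriv_bound s0 Kd.
have /andP[th0 _] := sing_exp_itv n s0.
pose W := \prod_(i | i != j) weight (sing_exp n sig) 4^-1 r (freq a i) (xi ord0 i).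
have W0 : 0 <= W by apply: prodr_ge0 => i _; exact: weight_ge0.
exists (C * (r ^+ K * a `^ sig) * W * (1 + r `^ (- sing_exp n sig))) => v.
apply: le_trans (HC r a j _ r01 ra) _.
rewrite (bigD1 j)//= updE eqxx.
rewrite (eq_bigr (fun i => weight (sing_exp n sig) 4^-1 r (freq a i) (xi ord0 i))); last first.
  by move=> i /negPf ij; rewrite updE ij.
rewrite -/W [leRHS](_ : _ = C * (r ^+ K * a `^ sig) *
  ((1 + r `^ (- sing_exp n sig)) * gs (4^-1 * r ^+ 2) (freq a j) v * W)); last by ring.
have c0 : 0 <= C * (r ^+ K * a `^ sig).
  by rewrite mulr_ge0// mulr_ge0 ?powR_ge0// exprn_ge0// ltW.
rewrite ler_wpM2l// ler_wpM2r//.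
exact: weight_le_gs.
Qed.

Lemma integrable_symb_deriv K' x (S : R -> R) : (K' <= d)%N -> continuous S ->
  (forall u, `|S u| <= 1) ->
  mu.-integrable [set: 'rV[R]_d]
    (EFin \o (fun xi => symb_deriv sig r a j K' xi * S (dot x xi))).
Proof.
move=> K'd cS S1; have [C C0 HC] := symb_deriv_bound s0 K'd.
have th01 := sing_exp_itv n s0.
have k4 : 0 < 4^-1 :> R by rewrite invr_gt0.
have [Cw Cw0 HCw] := integral_weight th01 k4.
apply: (@integrable_prod_le _ _ (fun i => weight (sing_exp n sig) 4^-1 r (freq a i))
  (fun=> Cw / r) (C * (r ^+ K' * a `^ sig))).
- by move=> i; exact: measurable_weight.
- by move=> i v; exact: weight_ge0.
- by move=> i; exact: HCw.
- by rewrite mulr_ge0// mulr_ge0 ?powR_ge0// exprn_ge0// ltW.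
- apply: measurable_funM; first exact: measurable_symb_deriv.
  apply: measurableT_comp (measurable_dot x).
  exact: continuous_measurable_fun.
- move=> xi; apply: le_trans (HC r a j xi r01 ra).
  by rewrite normrM ler_piMr.
Qed.

Section derivative.
Variables (K : nat) (Kd : (K.+1 <= d)%N) (x : 'rV[R]_d) (T T' : R -> R).
Hypotheses (dT : forall u, is_derive u (1 : R) T (T' u))
  (cT' : continuous T') (T1 : forall u, `|T u| <= 1) (T'1 : forall u, `|T' u| <= 1).

Let cT : continuous T. Proof. exact: is_derive_continuous dT. Qed.

(** On each line in direction j the sum of the two integrands is the derivative of
    a function with Gaussian decay. *)
Lemma symb_deriv_ibp :
  Rintegral mu setT (fun xi => symb_deriv sig r a j K.+1 xi * T (dot x xi)) =
  - x ord0 j * Rintegral mu setT (fun xi => symb_deriv sig r a j K xi * T' (dot x xi)).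
Proof.
have K'd : (K <= d)%N by exact: ltnW.
have i1 := integrable_symb_deriv x Kd cT T1; have i2 := integrable_symb_deriv x K'd cT' T'1.
pose f xi := symb_deriv sig r a j K.+1 xi * T (dot x xi) +
  x ord0 j * (symb_deriv sig r a j K xi * T' (dot x xi)).
have i3 : mu.-integrable [set: 'rV[R]_d] (EFin \o
    (fun xi => x ord0 j * (symb_deriv sig r a j K xi * T' (dot x xi)))).
  exact: (integrableZl measurableT (x ord0 j) i2).
have fi : mu.-integrable [set: 'rV[R]_d] (EFin \o f) by exact: integrableDr.
suff /(congr1 fine) : (\int[mu]_xi (f xi)%:E = 0)%E.
  rewrite -[LHS]/(Rintegral mu setT f) /= /f => fE.
  move: (RintegralD measurableT i1 i3); rewrite fE.
  rewrite (RintegralZl _ measurableT i2) => /esym/eqP.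
  by rewrite addr_eq0 mulNr => /eqP.
apply: (integral_slice_eq0 (j := j) fi) => xi.
have [C1 H1] := symb_deriv_slice_bound xi K'd.
have [C2 H2] := symb_deriv_slice_bound xi Kd.
set A := 1 + dot (upd xi j 0) (upd xi j 0).
have A1 : 1 <= A by rewrite lerDl dot_ge0.
set g0 := \prod_(i | i != j) gs (r ^+ 2 / 2) (freq a i) (xi ord0 i).
pose ph u := dot x (upd xi j 0) + x ord0 j * u.
have dph v : is_derive v (1 : R) ph (x ord0 j).
  by apply: (Deq (Dadd (Dcst _ v) (Dcmul (x ord0 j) (Did v)))); rewrite add0r mulr1.
have ds k v : is_derive v (1 : R) (slice_deriv r A (freq a j) sig k)
    (slice_deriv r A (freq a j) sig k.+1 v) by exact: is_derive_slice_deriv.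
pose F v := g0 * slice_deriv r A (freq a j) sig K v * T (ph v).
pose f' v := g0 * slice_deriv r A (freq a j) sig K.+1 v * T (ph v) +
  x ord0 j * (g0 * slice_deriv r A (freq a j) sig K v * T' (ph v)).
have fE v : f (upd xi j v) = f' v.
  by rewrite /f !symb_deriv_upd -/A -/g0 dotx_upd.
have dF v : is_derive v (1 : R) F (f' v).
  have h := Dmul (Dcmul g0 (ds K v)) (@Dcomp _ T ph v _ _ (dT (ph v)) (dph v)).
  by apply: (Deq h); rewrite /f'; ring.
have cs k : continuous (slice_deriv r A (freq a j) sig k).
  exact: is_derive_continuous (ds k).
have cph : continuous ph by exact: is_derive_continuous dph.
have cf' : continuous f'.
  move=> v; apply: cvgD; last apply: cvgM; first last.
  - apply: cvgM; last exact: (continuous_comp (cph v) (@cT' _)).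
    by apply: cvgM; [exact: cvg_cst|exact: cs].
  - exact: cvg_cst.
  - apply: cvgM; last exact: (continuous_comp (cph v) (@cT _)).
    by apply: cvgM; [exact: cvg_cst|exact: cs].
under eq_integral do rewrite fE.
apply: (@integral_derive_gs_eq0 R F f' C1 (C2 + `|x ord0 j| * C1) _ (freq a j) kr dF cf').
  move=> v; apply: le_trans (H1 v); rewrite /F symb_deriv_upd -/A -/g0.
  by rewrite normrM ler_piMr.
move=> v; rewrite mulrDl; apply: le_trans (ler_normD _ _) (lerD _ _).
  apply: le_trans (H2 v); rewrite symb_deriv_upd -/A -/g0.
  by rewrite normrM ler_piMr.
rewrite normrM -[leRHS]mulrA ler_wpM2l//; apply: le_trans (H1 v); rewrite symb_deriv_upd -/A -/g0.
by rewrite normrM ler_piMr.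
Qed.

End derivative.

Let transform K x :=
  cintegral setT (fun xi => (symb_deriv sig r a j K xi)%:C * expi (dot x xi)).

(** A derivative of the symbol multiplies the transform by x_j and a factor of
    modulus 1. The pair of real integrals is exchanged, because the derivative of the
    cosine is minus the sine. *)
Lemma transform_derivative K x : (K.+1 <= d)%N ->
  normc (transform K.+1 x) = `|x ord0 j| * normc (transform K x).
Proof.
move=> Kd.
have RE k : (fun xi => complex.Re ((symb_deriv sig r a j k xi)%:C * expi (dot x xi))) =
    fun xi => symb_deriv sig r a j k xi * cos (dot x xi).
  by apply/funext => xi; rewrite creZ.
have IE k : (fun xi => complex.Im ((symb_deriv sig r a j k xi)%:C * expi (dot x xi))) =
    fun xi => symb_deriv sig r a j k xi * sin (dot x xi).
  by apply/funext => xi; rewrite cimZ.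
have s1 (u : R) : `|- sin u| <= 1 by rewrite normrN sin_max.
have cns : continuous (fun u : R => - sin u).
  by move=> u; apply: cvgN; exact: continuous_sin.
have h1 := symb_deriv_ibp Kd x (@is_derive_cos R) cns (@cos_max R) s1.
have h2 := symb_deriv_ibp Kd x (@is_derive_sin R) (@continuous_cos R) (@sin_max R) (@cos_max R).
have nE : Rintegral mu setT (fun xi => symb_deriv sig r a j K xi * - sin (dot x xi)) =
    - Rintegral mu setT (fun xi => symb_deriv sig r a j K xi * sin (dot x xi)).
  have i2 := integrable_symb_deriv x (ltnW Kd) (@continuous_sin R) (@sin_max R).
  rewrite -mulN1r -(RintegralZl _ measurableT i2).
  by apply: eq_Rintegral => xi _; rewrite mulN1r mulrN.
rewrite nE mulrNN in h1.
rewrite /transform /cintegral !RE !IE h1 h2.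
set c := Rintegral _ _ _; set s := Rintegral _ _ _.
rewrite -normc_real -ComplexField.Normc.normcM /=.
by congr Num.sqrt; ring.
Qed.

End fixed_packet.
End decay2.

(** * Decay of the Bessel potential of a wave packet *)

Section decay3.
Variables (R : realType) (n : nat).
Local Notation d := n.+1.
Local Notation mu := (lebesgue_rV R d).
Local Notation normc := ComplexField.Normc.normc.
Implicit Types (x xi : 'rV[R]_d) (r a sig : R) (j : 'I_d).

Lemma transform_bound sig K : 0 < sig -> (K <= d)%N -> exists2 C : R, 0 <= C &
  forall r a j x, 0 < r <= 1 -> 1 <= r * a ->
    normc (cintegral setT (fun xi => (symb_deriv sig r a j K xi)%:C * expi (dot x xi)))
      <= C * a `^ sig * (r ^+ K / r ^+ d).
Proof.
move=> s0 Kd; have [C C0 HC] := symb_deriv_bound s0 Kd.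
have th01 := sing_exp_itv n s0.
have k4 : 0 < 4^-1 :> R by rewrite invr_gt0.
have [Cw Cw0 HCw] := integral_weight th01 k4.
exists (2 * C * Cw ^+ d) => [|r a j x r01 ra]; first by rewrite !mulr_ge0// exprn_ge0.
have /andP[r0 r1] := r01.
have h := @normc_cintegral_prod_le R d (fun i => weight (sing_exp n sig) 4^-1 r (freq a i))
  (fun=> Cw / r) (C * (r ^+ K * a `^ sig)) (symb_deriv sig r a j K) _ _ _ _ _ _ x.
apply: le_trans (h _ _ _ _ _ _) _.
- by move=> i; exact: measurable_weight.
- by move=> i v; exact: weight_ge0.
- by move=> i; exact: HCw.
- by rewrite mulr_ge0// mulr_ge0 ?powR_ge0// exprn_ge0// ltW.
- exact: measurable_symb_deriv.
- by move=> xi; exact: HC.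
rewrite prodr_const card_ord exprMn exprVn le_eqVlt; apply/orP; left; apply/eqP.
ring.
Qed.

Definition bwave sig a t x : R[i] := (wave_cst n t)%:C * symb_transform sig t^-1 a x.

(** J^sig of a wave packet of width r and frequency a >= 1/r is a bump of width r and
    height a^sig. The bounds with 0 and with d integrations by parts are combined; more
    than d derivatives of the symbol would not be integrable at the origin uniformly
    in r when sig is small. *)
Lemma bwave_decay sig : 0 < sig -> exists2 C : R, 0 <= C &
  forall r a x j, 0 < r <= 1 -> 1 <= r * a ->
    normc (bwave sig a (r ^+ 2)^-1 x) * (1 + r^-1 * `|x ord0 j|) ^+ d <= C * a `^ sig.
Proof.
move=> s0.
have [C1 C10 H1] := transform_bound s0 (leq0n d).
have [C2 C20 H2] := transform_bound s0 (leqnn d).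
pose k : R := (2 * pi) ^- d * Num.sqrt (2 * pi) ^+ d.
have k0 : 0 <= k by rewrite mulr_ge0 ?invr_ge0 ?exprn_ge0 ?mulr_ge0 ?pi_ge0.
exists (k * 2 ^+ d * (C1 + C2)) => [|r a x j r01 ra].
  by rewrite mulr_ge0 ?addr_ge0// mulr_ge0// exprn_ge0.
have /andP[r0 r1] := r01.
have rN : r != 0 by rewrite gt_eqF.
pose N K := normc (cintegral setT (fun xi => (symb_deriv sig r a j K xi)%:C * expi (dot x xi))).
have NK K : (K <= d)%N -> N K = `|x ord0 j| ^+ K * N 0%N.
  elim: K => [|K IH] Kd; first by rewrite expr0 mul1r.
  by rewrite /N transform_derivative// -/(N K) IH 1?ltnW// exprS mulrA.
have N0 : normc (symb_transform sig (r ^+ 2)^-1^-1 a x) = N 0%N.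
  rewrite invrK /N /symb_transform; congr (normc (cintegral _ _)).
  by apply/funext => xi; rewrite /symb_deriv /= expr0 mul1r mulr1.
have h1 : N 0%N <= C1 * a `^ sig / r ^+ d.
  by have := H1 r a j x r01 ra; rewrite expr0 mul1r.
have h2 : `|x ord0 j| ^+ d * N 0%N <= C2 * a `^ sig.
  have := H2 r a j x r01 ra; rewrite -/(N d) NK// mulfV ?mulr1//.
  by rewrite expf_neq0.
have wc : wave_cst n (r ^+ 2)^-1 = k * r ^+ d.
  rewrite /wave_cst invrK sqrtrM ?mulr_ge0 ?pi_ge0// sqrtr_sqr gtr0_norm//.
  by rewrite [(_ * r) ^+ _]exprMn mulrA.
rewrite /bwave normcZ wc N0 ger0_norm; last by rewrite mulr_ge0// exprn_ge0// ltW.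
set y := `|x ord0 j| in h2 *.
have y0 : 0 <= r^-1 * y by rewrite mulr_ge0 ?normr_ge0 ?invr_ge0 ?(ltW r0).
have yd : (1 + r^-1 * y) ^+ d <= 2 ^+ d * (1 + (r^-1 * y) ^+ d).
  set z := r^-1 * y in y0 *.
  have z1 : 0 <= 1 + z by lra.
  have e1 : 0 <= z ^+ d by rewrite exprn_ge0.
  have t0 : 0 <= 2 ^+ d :> R by rewrite exprn_ge0.
  have [y1|y1] := leP 1 z.
    apply: (@le_trans _ _ ((2 * z) ^+ d)).
      have z2 : 0 <= 2 * z by lra.
      by rewrite lerXn2r ?nnegrE//; lra.
    by rewrite exprMn ler_wpM2l// lerDr.
  apply: (@le_trans _ _ (2 ^+ d)).
    by rewrite lerXn2r ?nnegrE//; lra.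
  by rewrite ler_peMr// lerDl.
have N00 : 0 <= N 0%N by exact: normc_ge0.
have rd0 : 0 < r ^+ d by rewrite exprn_gt0.
have krN : 0 <= k * r ^+ d * N 0%N by rewrite mulr_ge0// mulr_ge0// ltW.
apply: le_trans (ler_wpM2l krN yd) _.
have -> : k * r ^+ d * N 0%N * (2 ^+ d * (1 + (r^-1 * y) ^+ d)) =
    k * 2 ^+ d * (r ^+ d * N 0%N + y ^+ d * N 0%N).
  rewrite exprMn exprVn; field; rewrite expf_neq0//.
rewrite -[leRHS]mulrA ler_wpM2l//; first by rewrite mulr_ge0// exprn_ge0.
rewrite [leRHS]mulrDl lerD//.
by rewrite mulrC -ler_pdivlMr.
Qed.

End decay3.

(** * Taylor expansion of a power *)

Section taylor.
Variable R : realType.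
Implicit Types (f df : R -> R) (b z t c : R).

(** The mean value theorem between 0 and z, for z of either sign. *)
Lemma MVT_from0 f df z : - 2^-1 <= z ->
  (forall t, - 2^-1 <= t -> is_derive t (1 : R) f (df t)) ->
  exists c, [/\ - 2^-1 <= c, `|c| <= `|z| & f z - f 0 = df c * z].
Proof.
move=> z2 d_f.
have cf t : - 2^-1 <= t -> {for t, continuous f}.
  by move=> t2; apply/differentiable_continuous/derivable1_diffP; case: (d_f t t2).
have mvt u v : u <= v -> - 2^-1 <= u -> exists2 c : R, c \in `[u, v] & f v - f u = df c * (v - u).
  move=> uv u2; apply: MVT_segment => //.
    by move=> t; rewrite in_itv /= => /andP[h _]; apply: d_f; lra.
  apply: continuous_in_subspaceT => t; rewrite inE /= in_itv /= => /andP[h _].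
  by apply: cf; lra.
have [z0|z0] := leP 0 z.
  have [c] := mvt 0 z z0 ltac:(lra).
  rewrite in_itv /= => /andP[c0 cz] ->; exists c; split; [lra| |by rewrite subr0].
  by rewrite !ger0_norm.
have [c] := mvt z 0 (ltW z0) z2.
rewrite in_itv /= => /andP[c0 cz] h; exists c; split; first lra.
  by rewrite !ler0_norm ?lerN2// ltW.
by rewrite -opprB h sub0r mulrN opprK.
Qed.

Lemma dpow1D b t : - 2^-1 <= t ->
  is_derive t (1 : R) (fun t => (1 + t) `^ b) (b * (1 + t) `^ (b - 1)).
Proof.
move=> t2; have h0 : 0 < 1 + 1 * t by lra.
rewrite (_ : (fun t => _) = fun t => (1 + 1 * t) `^ b).
  by apply: (Deq (DpowR b h0)); rewrite mul1r mulr1.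
by apply/funext => u; rewrite mul1r.
Qed.

(** For z >= -1/2 the mean value theorem applies twice. For z < -1/2 the left side is
    bounded and z^2 is bounded from below. *)
Lemma taylor_powR b : 0 < b -> exists (C : R) (m : nat), 0 <= C /\
  forall z, -1 < z -> `|(1 + z) `^ b - 1 - b * z| <= C * z ^+ 2 * (1 + `|z|) ^+ m.
Proof.
move=> b0; have [m bm] : exists m : nat, b <= m%:R.
  by exists (Num.bound `|b|); rewrite (le_trans (ler_norm _))// ltW// archi_boundP.
exists (4 * (b * `|b - 1|) + 4 * (2 + b)), m; split.
  by rewrite addr_ge0 ?mulr_ge0 ?normr_ge0//; lra.
move=> z z1.
have p1 : 1 <= (1 + `|z|) ^+ m by rewrite exprn_ege1// lerDl.
have sz := sqr_ge0 z.
have [z2|z2] := leP (- 2^-1) z; last first.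
  have pz : 0 <= (1 + z) `^ b <= 1.
    rewrite powR_ge0 /=; apply: (@le_trans _ _ (1 `^ b)); last by rewrite powR1.
    by apply: ge0_ler_powR; rewrite ?nnegrE; lra.
  have h1 : `|(1 + z) `^ b - 1 - b * z| <= 2 + b.
    by rewrite ler_norml; apply/andP; split; nra.
  have z4 : 1 <= 4 * z ^+ 2 by nra.
  apply: (le_trans h1).
  have b10 : 0 <= b * `|b - 1| by apply: mulr_ge0 => //; exact: ltW.
  have q0 : 0 <= 4 * (b * `|b - 1|) * z ^+ 2 by apply: mulr_ge0 => //; exact: mulr_ge0.
  have h2 : 2 + b <= (4 * (b * `|b - 1|) + 4 * (2 + b)) * z ^+ 2 by nra.
  by apply: (le_trans h2); rewrite ler_peMr//; nra.
have d1 t : - 2^-1 <= t -> is_derive t (1 : R) (fun t => (1 + t) `^ b + - b * t)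
    (b * (1 + t) `^ (b - 1) - b).
  move=> t2; apply: (Deq (Dadd (dpow1D b t2) (Dcmul (- b) (Did t)))).
  by rewrite mulr1.
have [c [c2 cz hc]] := MVT_from0 z2 d1.
have [c' [c2' cz' hc']] := MVT_from0 c2 (fun t => @dpow1D (b - 1) t).
move: hc hc'; rewrite !addr0 !powR1 mulr0 addr0 => hc hc'.
have -> : (1 + z) `^ b - 1 - b * z = b * ((b - 1) * (1 + c') `^ (b - 1 - 1)) * c * z.
  rewrite -[in RHS]mulrA; rewrite (_ : _ - _ - _ = (1 + z) `^ b + - b * z - 1); last by ring.
  rewrite hc.
  have -> : b * (1 + c) `^ (b - 1) - b = b * ((1 + c) `^ (b - 1) - 1) by ring.
  rewrite hc'; ring.
have pc : `|(1 + c') `^ (b - 1 - 1)| <= 4 * (1 + `|z|) ^+ m.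
  have c'z : 1 + c' <= 1 + `|z|.
    by rewrite lerD2l (le_trans (ler_norm _))// (le_trans cz').
  rewrite ger0_norm ?powR_ge0//.
  have [b2|b2] := leP 0 (b - 1 - 1).
    apply: (@le_trans _ _ ((1 + `|z|) `^ (b - 1 - 1))).
      by apply: ge0_ler_powR; rewrite ?nnegrE//; lra.
    apply: (@le_trans _ _ ((1 + `|z|) ^+ m)).
      by rewrite -powR_mulrn ?addr_ge0//; apply: ler_powR; [rewrite lerDl|lra].
    by rewrite ler_peMl ?ler1n// (le_trans ler01).
  apply: (@le_trans _ _ 4); last by rewrite ler_peMr.
  have h2 : 0 < 2^-1 :> R by rewrite invr_gt0.
  have c12 : 2^-1 <= 1 + c' by lra.
  have b20 : 0 <= - (b - 1 - 1) by lra.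
  rewrite -[b - 1 - 1]opprK; apply: (le_trans (powR_anti b20 h2 c12)).
  rewrite opprK; apply: (@le_trans _ _ (2^-1 `^ (- 2%:R))).
    by apply: ger_powR; lra.
  by rewrite powR_invn// exprVn invrK; lra.
rewrite !normrM (ger0_norm (ltW b0)).
have cc : `|c| * `|z| <= z ^+ 2.
  by rewrite -real_normK ?num_real// expr2 ler_wpM2r.
set Q := (1 + `|z|) ^+ m in p1 pc *.
have b10 : 0 <= b * `|b - 1| by rewrite mulr_ge0// ltW.
apply: (@le_trans _ _ (b * `|b - 1| * (4 * Q) * z ^+ 2)).
  rewrite [leLHS](_ : _ = b * `|b - 1| * `|(1 + c') `^ (b - 1 - 1)| * (`|c| * `|z|)); last by ring.
  by apply: ler_pM; [exact: mulr_ge0|exact: mulr_ge0|exact: ler_wpM2l|].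
have Q0 : 0 <= Q by lra.
have : 0 <= 4 * (2 + b) * z ^+ 2 * Q.
  by apply: mulr_ge0 => //; apply: mulr_ge0 => //; lra.
lra.
Qed.

End taylor.

(** * Bessel potentials at high frequency *)

Section asymptotics.
Variables (R : realType) (n : nat).
Local Notation d := n.+1.
Local Notation mu := (lebesgue_rV R d).
Local Notation normc := ComplexField.Normc.normc.
Implicit Types (x xi : 'rV[R]_d) (s lam b u : R).

(** First-order expansion of the symbol at the frequency (lam, 0, ..., 0): with
    1 + |xi|^2 = lam^2 (1 + z), the number lam z is bounded by a polynomial in the
    distance of xi to that frequency, so that the quadratic remainder in z gains the
    factor lam^-2. *)
Lemma symb_remainder s : 0 < s -> exists (C : R) (m : nat), 0 <= C /\
  forall lam xi, 1 <= lam ->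
    `|symb s xi - lam `^ s - s * lam `^ (s - 1) * (xi ord0 ord0 - lam)| <=
    C * lam `^ (s - 2) * \prod_j (1 + (xi ord0 j - freq lam j) ^+ 2) ^+ m.
Proof.
move=> s0; have s20 : 0 < s / 2 by rewrite divr_gt0.
have [C [m [C0 HC]]] := taylor_powR s20.
exists (4 * C * 3 ^+ m + s / 2), m.+2; split.
  by rewrite addr_ge0 ?(ltW s20)// !mulr_ge0// exprn_ge0.
move=> lam xi lam1; have lam0 : 0 < lam by apply: lt_le_trans lam1.
rewrite prodrXl.
pose zeta : 'rV[R]_d := \row_j (xi ord0 j - freq lam j).
set z0 := xi ord0 ord0 - lam.
have dE : 1 + dot xi xi = lam ^+ 2 + 2 * lam * z0 + (1 + dot zeta zeta).
  have -> : dot xi xi = \sum_(j < d) (freq lam j * freq lam j) +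
      2 * (\sum_(j < d) freq lam j * (xi ord0 j - freq lam j)) + dot zeta zeta.
    rewrite mulr_sumr /dot -!big_split /=; apply: eq_bigr => j _.
    by rewrite !mxE; ring.
  rewrite (bigD1 ord0)//= [X in _ + 2 * X](bigD1 ord0)//= /freq eqxx.
  rewrite !big1 ?addr0; first by rewrite /z0; ring.
    by move=> j /negPf ->; rewrite mul0r.
  by move=> j /negPf ->; rewrite mul0r.
have hW := sqnorm_le_prod zeta; move: hW.
rewrite (_ : \prod_j (1 + zeta ord0 j ^+ 2) =
  \prod_j (1 + (xi ord0 j - freq lam j) ^+ 2)); last first.
  by apply: eq_bigr => j _; rewrite mxE.
set W := \prod_j _ => hW.
have z0W : 1 + z0 ^+ 2 <= W.
  have := @coord_le_prod1D R n (fun j => (xi ord0 j - freq lam j) ^+ 2) ord0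
    (fun j => sqr_ge0 _).
  by rewrite /= {1}/freq eqxx.
have D0 := dot_ge0 zeta.
set D := dot zeta zeta in dE hW D0 *.
have W1 : 1 <= W by lra.
pose z := (2 * lam * z0 + (1 + D)) / lam ^+ 2.
have l2 : lam ^+ 2 != 0 by rewrite expf_neq0// gt_eqF.
have l20 : 0 < lam ^+ 2 by rewrite exprn_gt0.
have zE : lam ^+ 2 * (1 + z) = 1 + dot xi xi by rewrite dE /z; field; rewrite gt_eqF.
have z1 : -1 < z.
  have : 0 < lam ^+ 2 * (1 + z) by rewrite zE ltr_pwDl// dot_ge0.
  by rewrite pmulr_rgt0//; lra.
have lz : lam * `|z| <= 2 * W.
  rewrite /z normrM normfV (ger0_norm (ltW l20)) mulrA ler_pdivrMr//.
  have h1 : `|2 * lam * z0 + (1 + D)| <= lam * W + W.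
    apply: le_trans (ler_normD _ _) (lerD _ _); last first.
      by rewrite ger0_norm// addr_ge0.
    rewrite mulrAC normrM (ger0_norm (ltW lam0)) mulrC ler_wpM2l ?(ltW lam0)//.
    apply: le_trans z0W; rewrite normrM ger0_norm//.
    have : `|z0| ^+ 2 = z0 ^+ 2 by rewrite real_normK ?num_real.
    have := sqr_ge0 (1 - `|z0|); rewrite sqrrB; lra.
  apply: (@le_trans _ _ (lam * (lam * W + W))); first by rewrite ler_wpM2l// ltW.
  have : lam * W <= lam ^+ 2 * W.
    by rewrite ler_wpM2r ?(le_trans ler01)// expr2 ler_peMr// ltW.
  have : W <= lam * W by rewrite ler_peMl// (le_trans ler01).
  lra.
have zW : 1 + `|z| <= 3 * W.
  have : `|z| <= lam * `|z| by rewrite ler_peMl.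
  lra.
set P := lam `^ (s - 2).
have P0 : 0 < P by rewrite powR_gt0.
have Ps : lam `^ s = P * lam ^+ 2.
  by rewrite -powR_mulrn ?(ltW lam0)// -powRD ?(gt_eqF lam0) ?implybT// subrK.
have Ps1 : lam `^ (s - 1) = P * lam.
  rewrite -[X in _ * X]powRr1 ?(ltW lam0)// -powRD ?(gt_eqF lam0) ?implybT//.
  by congr (_ `^ _); ring.
have SE : symb s xi = P * lam ^+ 2 * (1 + z) `^ (s / 2).
  rewrite /symb -zE powRM ?sqr_ge0 ?(ltW lam0)//; last lra.
  by rewrite powR_halfM ?(ltW lam0)// Ps.
have -> : symb s xi - lam `^ s - s * lam `^ (s - 1) * z0 =
    P * (lam ^+ 2 * ((1 + z) `^ (s / 2) - 1 - s / 2 * z) + s / 2 * (1 + D)).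
  rewrite SE Ps Ps1.
  have lz2 : lam ^+ 2 * z = 2 * lam * z0 + (1 + D) by rewrite /z; field; rewrite gt_eqF.
  have -> : s / 2 * (1 + D) = s / 2 * (lam ^+ 2 * z) - s * lam * z0.
    by rewrite lz2; field.
  by field.
rewrite normrM (gtr0_norm P0) [leRHS](_ : _ = P * ((4 * C * 3 ^+ m + s / 2) * W ^+ m.+2));
  last by ring.
rewrite ler_wpM2l ?(ltW P0)//; apply: le_trans (ler_normD _ _) _.
rewrite mulrDl lerD//.
  rewrite normrM (ger0_norm (ltW l20)).
  apply: (@le_trans _ _ (lam ^+ 2 * (C * z ^+ 2 * (1 + `|z|) ^+ m))).
    by rewrite ler_wpM2l ?(ltW l20)// HC.
  rewrite (_ : lam ^+ 2 * _ = C * ((lam * `|z|) ^+ 2 * (1 + `|z|) ^+ m)); last first.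
    by rewrite -[z ^+ 2]real_normK ?num_real//; ring.
  rewrite (_ : 4 * C * _ * _ = C * ((2 * W) ^+ 2 * (3 * W) ^+ m)); last first.
    by rewrite !(exprMn, exprS); ring.
  rewrite ler_wpM2l//; apply: ler_pM; rewrite ?exprn_ge0 ?addr_ge0//.
  - by apply: mulr_ge0 => //; exact: ltW.
  - by rewrite lerXn2r ?nnegrE ?mulr_ge0 ?(ltW lam0)//; lra.
  - by rewrite lerXn2r ?nnegrE ?addr_ge0//; lra.
rewrite ger0_norm; last by rewrite mulr_ge0 ?(ltW s20)// addr_ge0.
rewrite ler_wpM2l ?(ltW s20)//; apply: (le_trans hW).
by rewrite -[leLHS]expr1 ler_weXn2l.
Qed.

Section packet.
Variables (s b u : R).
Hypotheses (s0 : 0 < s) (u0 : 0 < u).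

Let iu0 : 0 < u^-1. Proof. by rewrite invr_gt0. Qed.

Let rem lam xi := symb s xi - lam `^ s - s * lam `^ (s - 1) * (xi ord0 ord0 - lam).

Let measurable_rem_gauss lam a :
  measurable_fun [set: 'rV[R]_d] (fun xi => rem lam xi * gauss u^-1 a xi).
Proof.
apply: measurable_funM; last exact: measurable_gauss.
apply: measurable_funB; first apply: measurable_funB.
- exact: measurable_symb.
- exact: measurable_cst.
- apply: measurable_funM; first exact: measurable_cst.
  by apply: measurable_funB; [exact: measurable_coord|exact: measurable_cst].
Qed.

Let rem_transform : exists2 C : R, 0 <= C & forall lam x, 1 <= lam ->
  cintegrable (fun xi => (rem lam xi * gauss u^-1 (lam + b) xi)%:C * expi (dot x xi)) /\
  normc (cintegral setT (fun xi =>
    (rem lam xi * gauss u^-1 (lam + b) xi)%:C * expi (dot x xi))) <= C * lam `^ (s - 2).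
Proof.
have [C [m [C0 HC]]] := symb_remainder s0.
have t2 : 0 < u^-1 / 2 by rewrite divr_gt0.
have [C2 C20 HC2] := poly_gs m t2.
pose D := (2 * (1 + b ^+ 2)) ^+ m.
have B0 : 0 <= 2 * (1 + b ^+ 2) by rewrite mulr_ge0// addr_ge0// sqr_ge0.
have D0 : 0 <= D by rewrite exprn_ge0.
pose I := Num.sqrt (pi / (u^-1 / 2 / 2)).
exists (2 * (C * (D * C2) ^+ d) * I ^+ d) => [|lam x lam1].
  by rewrite !mulr_ge0// ?exprn_ge0 ?sqrtr_ge0// mulr_ge0.
have bd xi : `|rem lam xi * gauss u^-1 (lam + b) xi| <=
   (C * (D * C2) ^+ d * lam `^ (s - 2)) *
   \prod_j gs (u^-1 / 2 / 2) (freq (lam + b) j) (xi ord0 j).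
  have g0 : 0 <= gauss u^-1 (lam + b) xi by apply: prodr_ge0 => j _; exact: gs_ge0.
  rewrite normrM (ger0_norm g0).
  apply: le_trans (ler_wpM2r g0 (HC lam xi lam1)) _.
  set P := lam `^ (s - 2).
  rewrite [leLHS](_ : _ = C * P * (\prod_j (1 + (xi ord0 j - freq lam j) ^+ 2) ^+ m *
    gauss u^-1 (lam + b) xi)); last by ring.
  rewrite [leRHS](_ : _ = C * P * ((D * C2) ^+ d *
    \prod_j gs (u^-1 / 2 / 2) (freq (lam + b) j) (xi ord0 j))); last by ring.
  have CP : 0 <= C * P by rewrite mulr_ge0 ?powR_ge0.
  rewrite ler_wpM2l//.
  have -> : (D * C2) ^+ d = \prod_(j < d) (D * C2) by rewrite prodr_const card_ord.
  rewrite /gauss -!big_split /=; apply: ler_prod => j _; apply/andP; split.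
    by rewrite mulr_ge0 ?gs_ge0// exprn_ge0// addr_ge0// sqr_ge0.
  have h1 : (1 + (xi ord0 j - freq lam j) ^+ 2) ^+ m <=
      D * (1 + (xi ord0 j - freq (lam + b) j) ^+ 2) ^+ m.
    rewrite -exprMn lerXn2r ?nnegrE ?mulr_ge0 ?addr_ge0 ?sqr_ge0//.
    have fb : (freq (lam + b) j - freq lam j) ^+ 2 <= b ^+ 2.
      rewrite /freq; case: ifP => _; first by rewrite addrAC subrr add0r.
      by rewrite subrr expr0n sqr_ge0.
    set p := xi ord0 j; set q := freq (lam + b) j in fb *; set r := freq lam j in fb *.
    have := sqr_ge0 (p - q - (q - r)); have := sqr_ge0 (p - q).
    have := sqr_ge0 b; nra.
  apply: le_trans (ler_wpM2r (gs_ge0 _ _ _) h1) _.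
  by rewrite -[leLHS]mulrA -[leRHS]mulrA ler_wpM2l// HC2.
have t4 : 0 < u^-1 / 2 / 2 by rewrite !divr_gt0.
have K0 : 0 <= C * (D * C2) ^+ d * lam `^ (s - 2).
  by rewrite !mulr_ge0 ?powR_ge0// exprn_ge0// mulr_ge0.
have mh j : measurable_fun [set: R] (gs (u^-1 / 2 / 2) (freq (n := n) (lam + b) j)).
  exact: measurable_gs.
have h0 j v : 0 <= gs (u^-1 / 2 / 2) (freq (n := n) (lam + b) j) v by exact: gs_ge0.
have hc j : (\int[@lebesgue_measure R]_v (gs (u^-1 / 2 / 2)
    (freq (n := n) (lam + b) j) v)%:E <= I%:E)%E by rewrite integral_gs.
split.
  exact: (cintegrable_prod_le mh h0 hc K0 (measurable_rem_gauss lam (lam + b)) bd).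
apply: le_trans (normc_cintegral_prod_le mh h0 hc K0
  (measurable_rem_gauss lam (lam + b)) bd x) _.
by rewrite prodr_const card_ord le_eqVlt; apply/orP; left; apply/eqP; ring.
Qed.

(** J^s acts on a packet of high frequency lam as lam^s plus a first-order
    differential operator, up to lam^(s-2): the remainder of the symbol is integrated
    against the Gaussian of the packet, and the two leading terms are the transform and
    the first moment of that Gaussian. *)
Lemma bwave_asymp : exists2 C : R, 0 <= C & forall lam x, 1 <= lam ->
  normc (bwave s (lam + b) u x -
    ((lam `^ s)%:C + (s * lam `^ (s - 1))%:C * (b +i* (u * x ord0 ord0))) *
      wave (lam + b) u x) <= C * lam `^ (s - 2).
Proof.
have [C C0 HC] := rem_transform.
have k0 : 0 <= wave_cst n u.
  by rewrite /wave_cst mulr_ge0 ?invr_ge0 ?exprn_ge0 ?sqrtr_ge0// mulr_ge0 ?pi_ge0.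
exists (wave_cst n u * C) => [|lam x lam1]; first exact: mulr_ge0.
have [ri rb] := HC lam x lam1.
set a := lam + b in ri rb *.
have [gi ge] := gauss_transform a x iu0.
have [mi me] := gauss_transform_moment a x iu0.
pose c0 := lam `^ s + s * lam `^ (s - 1) * b; pose c1 := s * lam `^ (s - 1).
have [g1 g2] := cintegralZ c0 gi; have [m1 m2] := cintegralZ c1 mi.
have [gm1 gm2] := cintegralD g1 m1; have [t1 t2] := cintegralD gm1 ri.
pose J := cintegral setT (fun xi =>
    (rem lam xi * gauss u^-1 a xi)%:C * expi (dot x xi)).
rewrite !invrK in ge me.
pose S : R[i] := (Num.sqrt (2 * pi * u) ^+ d)%:C.
pose I : R[i] := 0 +i* (x ord0 ord0 * u).
have E : symb_transform s u^-1 a x =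
    c0%:C * (S * wave a u x) + c1%:C * (I * (S * wave a u x)) + J.
  rewrite -/S -/I in ge me.
  rewrite -me -ge -m2 -g2 -gm2 -t2 /symb_transform; congr cintegral.
  apply/funext => xi; rewrite !mulrA -!realCM -!mulrDl -!rmorphD /=.
  by congr (_%:C * _); rewrite /rem /c0 /c1 /a; ring.
have kk : wave_cst n u * Num.sqrt (2 * pi * u) ^+ d = 1.
  rewrite /wave_cst -[LHS]mulrA -exprMn -sqrtrM; last first.
    by rewrite divr_ge0 ?mulr_ge0 ?pi_ge0// ltW.
  rewrite (_ : 2 * pi / u * (2 * pi * u) = (2 * pi) ^+ 2); last first.
    by field; rewrite gt_eqF.
  rewrite sqrtr_sqr ger0_norm ?mulr_ge0 ?pi_ge0// mulVf// expf_neq0//.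
  by rewrite mulf_neq0// gt_eqF// pi_gt0.
have -> : bwave s a u x -
    ((lam `^ s)%:C + (s * lam `^ (s - 1))%:C * (b +i* (u * x ord0 ord0))) * wave a u x =
    (wave_cst n u)%:C * J.
  have -> : (lam `^ s)%:C + (s * lam `^ (s - 1))%:C * (b +i* (u * x ord0 ord0)) =
      c0%:C + c1%:C * I.
    by apply: complex_ext => /=; rewrite /c0 /c1; ring.
  rewrite /bwave E !mulrDr.
  have -> : (wave_cst n u)%:C * (c0%:C * (S * wave a u x)) = c0%:C * wave a u x.
    by rewrite mulrCA; congr (_ * _); rewrite mulrA -realCM kk mul1r.
  have -> : (wave_cst n u)%:C * (c1%:C * (I * (S * wave a u x))) =
      c1%:C * I * wave a u x.
    rewrite mulrCA -mulrA; congr (_ * _); rewrite mulrCA; congr (_ * _).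
    by rewrite mulrA -realCM kk mul1r.
  by rewrite mulrDl [LHS]addrC addKr.
by rewrite normcZ ger0_norm// -mulrA ler_wpM2l.
Qed.

End packet.
End asymptotics.

(** * Finite sums of wave packets are Schwartz functions *)

Section schwartz_waves.
Variables (R : realType) (n : nat).
Local Notation d := n.+1.
Local Notation normc := ComplexField.Normc.normc.
Implicit Types (x : 'rV[R]_d) (j : 'I_d) (F : 'rV[R]_d -> R).

Lemma is_derive_coord F x j df :
  is_derive (x ord0 j) (1 : R) (fun v => F (upd x j v)) df ->
  is_derive x (delta_mx ord0 j) F df.
Proof.
have E : (fun h : R => h^-1 *: (F (h *: delta_mx ord0 j + x) - F x)) =
    (fun h : R => h^-1 *: (F (upd x j (h *: 1 + x ord0 j)) - F (upd x j (x ord0 j)))).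
  apply/funext => h; rewrite upd_id; congr (_ *: (F _ - _)).
  apply: rV_ext => i; rewrite updE !mxE eqxx /=.
  by case: eqP => [->|_]; rewrite ?mulr1 ?mulr0 ?add0r// /GRing.scale /= mulr1.
move=> [h1 h2]; split.
  by rewrite /derivable E; exact: h1.
by rewrite -h2 /derive E.
Qed.

(** Real and imaginary parts of derivatives of wave packets are Gaussians times
    such expressions, in which the coordinates and the carrier wave appear. *)
Inductive wexp : Type :=
| Wconst of R | Wcoord of 'I_d | Wcos | Wsin | Wadd of wexp & wexp | Wmul of wexp & wexp.

Fixpoint weval (a : R) (e : wexp) x : R :=
  match e with
  | Wconst c => c
  | Wcoord i => x ord0 i
  | Wcos => cos (a * x ord0 ord0)
  | Wsin => sin (a * x ord0 ord0)
  | Wadd e1 e2 => weval a e1 x + weval a e2 x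
  | Wmul e1 e2 => weval a e1 x * weval a e2 x
  end.

Fixpoint wder (a : R) j (e : wexp) : wexp :=
  match e with
  | Wconst c => Wconst 0
  | Wcoord i => Wconst (i == j)%:R
  | Wcos => Wmul (Wconst (- freq a j)) Wsin
  | Wsin => Wmul (Wconst (freq a j)) Wcos
  | Wadd e1 e2 => Wadd (wder a j e1) (wder a j e2)
  | Wmul e1 e2 => Wadd (Wmul (wder a j e1) e2) (Wmul e1 (wder a j e2))
  end.

Definition envelope (t : R) x := expR (- (t / 2 * dot x x)).

Definition wderE (t a : R) j e := Wadd (Wmul (Wmul (Wconst (- t)) (Wcoord j)) e) (wder a j e).

Lemma is_derive_weval a e x j : is_derive (x ord0 j) (1 : R)
  (fun v => weval a e (upd x j v)) (weval a (wder a j e) x).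
Proof.
have dx i v : is_derive v (1 : R) (fun v => upd x j v ord0 i) (i == j)%:R.
  under eq_fun do rewrite updE.
  by case: eqP => _; [exact: Did|exact: Dcst].
have df v : is_derive v (1 : R) (fun v => a * upd x j v ord0 ord0) (freq a j).
  apply: (Deq (Dcmul a (dx ord0 v))); rewrite /freq eq_sym.
  by case: eqP => _; rewrite ?mulr1 ?mulr0.
elim: e => [c|i|||e1 IH1 e2 IH2|e1 IH1 e2 IH2] /=.
- exact: Dcst.
- exact: dx.
- by apply: (Deq (Dcos (df _))); rewrite upd_id; ring.
- by apply: (Deq (Dsin (df _))); rewrite upd_id; ring.
- exact: Dadd.
- by apply: (Deq (Dmul IH1 IH2)); rewrite upd_id; ring.
Qed.

Lemma is_derive_envelope_weval t a e x j : is_derive x (delta_mx ord0 j)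
  (fun x => envelope t x * weval a e x) (envelope t x * weval a (wderE t a j e) x).
Proof.
apply: is_derive_coord.
have dE : is_derive (x ord0 j) (1 : R) (fun v => envelope t (upd x j v))
    (envelope t x * (- t * x ord0 j)).
  rewrite /envelope; under eq_fun do rewrite dot_upd expr2.
  have h := Dexp (Dcmul (- (t / 2)) (Dadd (Dcst (dot (upd x j 0) (upd x j 0)) (x ord0 j))
    (Dmul (Did (x ord0 j)) (Did (x ord0 j))))).
  rewrite (_ : (fun _ => _) = (fun v => expR (- (t / 2) *
    (dot (upd x j 0) (upd x j 0) + v * v)))); last by apply/funext => v; rewrite mulNr.
  apply: (Deq h); rewrite -expr2 -dot_upd upd_id mulNr; congr (_ * _).
  by field.
apply: (Deq (Dmul dE (is_derive_weval a e x j))).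
by rewrite /= upd_id; ring.
Qed.

Lemma continuous_coord i : continuous (fun x : 'rV[R]_d => x ord0 i).
Proof. exact: coord_continuous. Qed.

Lemma continuous_sumf N (F : 'I_N -> 'rV[R]_d -> R) :
  (forall k, continuous (F k)) -> continuous (fun x => \sum_k F k x).
Proof.
elim: N F => [|N IH] F cF.
  rewrite (_ : (fun x => _) = cst 0); first exact: cst_continuous.
  by apply/funext => x; rewrite big_ord0.
rewrite (_ : (fun x => _) = fun x => F ord0 x + \sum_k F (lift ord0 k) x).
  move=> x; have h1 := cF ord0 x; have h2 := IH _ (fun k => cF (lift ord0 k)) x.
  exact: (cvgD h1 h2).
by apply/funext => x; rewrite big_ord_recl.
Qed.

Lemma continuous_weval a e : continuous (weval a e).
Proof.
have ca : continuous (fun x : 'rV[R]_d => a * x ord0 ord0).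
  move=> x; have h := @continuous_coord ord0 x.
  exact: (cvgM (@cvg_cst _ a _ _ _) h).
elim: e => [c|i|||e1 IH1 e2 IH2|e1 IH1 e2 IH2] x /=.
- exact: (@cst_continuous _ _ c x).
- exact: (@continuous_coord i x).
- exact: (continuous_comp (ca x) (@continuous_cos R _)).
- exact: (continuous_comp (ca x) (@continuous_sin R _)).
- exact: (cvgD (IH1 x) (IH2 x)).
- exact: (cvgM (IH1 x) (IH2 x)).
Qed.

Lemma continuous_sqnorm : continuous (fun x : 'rV[R]_d => dot x x).
Proof.
apply: (@continuous_sumf d (fun i x => x ord0 i * x ord0 i)) => i x.
exact: (cvgM (@continuous_coord i x) (@continuous_coord i x)).
Qed.

Lemma continuous_envelope t : continuous (envelope t).
Proof.
move=> x; have c1 : {for x, continuous (fun x : 'rV[R]_d => - (t / 2 * dot x x))}.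
  exact: (cvgN (cvgM (@cvg_cst _ (t / 2) _ _ _) (@continuous_sqnorm x))).
exact: (continuous_comp c1 (@continuous_expR R _)).
Qed.

Section sums.
Variables (N : nat) (a t : 'I_N -> R).

Definition wsum (e : 'I_N -> wexp) x : R :=
  \sum_k envelope (t k) x * weval (a k) (e k) x.

Definition cwsum (e1 e2 : 'I_N -> wexp) x : R[i] := wsum e1 x +i* wsum e2 x.

Lemma is_derive_wsum e x j : is_derive x (delta_mx ord0 j) (wsum e)
  (wsum (fun k => wderE (t k) (a k) j (e k)) x).
Proof.
rewrite (_ : wsum e = \sum_k (fun x => envelope (t k) x * weval (a k) (e k) x)).
  by apply: is_derive_sum => k; exact: is_derive_envelope_weval.
by apply/funext => y; rewrite fct_sumE.
Qed.

Lemma partial_cwsum e1 e2 j : partial j (cwsum e1 e2) =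
  cwsum (fun k => wderE (t k) (a k) j (e1 k)) (fun k => wderE (t k) (a k) j (e2 k)).
Proof.
apply/funext => x; rewrite /partial /cwsum /=.
have [_ h1] := is_derive_wsum e1 x j; have [_ h2] := is_derive_wsum e2 x j.
by congr (_ +i* _).
Qed.

(** Sums of Gaussians times expressions are stable under differentiation, so that
    smoothness and decay need to be checked for the sums themselves only. *)
Lemma partials_cwsum e1 e2 b : exists e1' e2', partials b (cwsum e1 e2) = cwsum e1' e2'.
Proof.
elim: b => [|j b [f1 [f2 IH]]]; first by exists e1, e2.
by rewrite /= -/(partials b _) IH partial_cwsum; do 2 eexists.
Qed.

Lemma continuous_wsum e : continuous (wsum e).
Proof.
apply: (@continuous_sumf N (fun k x => envelope (t k) x * weval (a k) (e k) x)) => k x.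
exact: (cvgM (@continuous_envelope (t k) x) (@continuous_weval (a k) (e k) x)).
Qed.

Lemma coord_le_sqnorm x i : `|x ord0 i| <= 1 + dot x x.
Proof.
apply: le_trans (norm_le_1Dsqr _) _; rewrite lerD2l /dot (bigD1 i)//= -expr2 lerDl.
by apply: sumr_ge0 => k _; rewrite -expr2 sqr_ge0.
Qed.

Lemma weval_bound (c : R) e : exists (C : R) (m : nat), 0 <= C /\
  forall x, `|weval c e x| <= C * (1 + dot x x) ^+ m.
Proof.
have one x : 1 <= 1 + dot x x by rewrite lerDl dot_ge0.
elim: e => [c'|i|||e1 [C1 [m1 [C10 H1]]] e2 [C2 [m2 [C20 H2]]]
    |e1 [C1 [m1 [C10 H1]]] e2 [C2 [m2 [C20 H2]]]] /=.
- by exists `|c'|, 0%N; split => // x; rewrite mulr1.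
- by exists 1, 1%N; split => // x; rewrite mul1r expr1 coord_le_sqnorm.
- by exists 1, 0%N; split => // x; rewrite mulr1 cos_max.
- by exists 1, 0%N; split => // x; rewrite mulr1 sin_max.
- exists (C1 + C2), (maxn m1 m2); split; first exact: addr_ge0.
  move=> x; rewrite mulrDl; apply: le_trans (ler_normD _ _) (lerD _ _).
    apply: le_trans (H1 x) _; rewrite ler_wpM2l// ler_weXn2l// leq_maxl//.
  by apply: le_trans (H2 x) _; rewrite ler_wpM2l// ler_weXn2l// leq_maxr.
- exists (C1 * C2), (m1 + m2)%N; split; first exact: mulr_ge0.
  move=> x; rewrite normrM exprD mulrACA; exact: ler_pM.
Qed.

Hypothesis t0 : forall k, 0 < t k.

Lemma wsum_bound e m : exists2 C : R, 0 <= C &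
  forall x, (1 + dot x x) ^+ m * `|wsum e x| <= C.
Proof.
have H k : exists2 C : R, 0 <= C & forall x,
    (1 + dot x x) ^+ m * `|envelope (t k) x * weval (a k) (e k) x| <= C.
  have [C1 [m1 [C10 H1]]] := weval_bound (a k) (e k).
  have t2 : 0 < t k / 2 by rewrite divr_gt0.
  have [C2 C20 H2] := poly_le_expR (m + m1) t2.
  exists (C1 * C2) => [|x]; first exact: mulr_ge0.
  have e0 : 0 < envelope (t k) x by exact: expR_gt0.
  rewrite normrM (gtr0_norm e0).
  have p0 : 0 <= (1 + dot x x) ^+ m by rewrite exprn_ge0// addr_ge0// dot_ge0.
  apply: (@le_trans _ _ ((1 + dot x x) ^+ m * (envelope (t k) x * (C1 * (1 + dot x x) ^+ m1)))).
    by rewrite ler_wpM2l// ler_wpM2l// ltW.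
  rewrite (_ : _ * _ = C1 * ((1 + dot x x) ^+ (m + m1) * envelope (t k) x)); last first.
    by rewrite exprD; ring.
  rewrite ler_wpM2l// /envelope expRN ler_pdivrMr ?expR_gt0//.
  by apply: H2; exact: dot_ge0.
pose C k := sval (cid2 (H k)).
have HC k x : (1 + dot x x) ^+ m * `|envelope (t k) x * weval (a k) (e k) x| <= C k.
  by rewrite /C; case: cid2 => /= C' _ ; exact.
have C0 k : 0 <= C k by rewrite /C; case: cid2.
exists (\sum_k C k) => [|x]; first by apply: sumr_ge0 => k _.
have p0 : 0 <= (1 + dot x x) ^+ m by rewrite exprn_ge0// addr_ge0// dot_ge0.
apply: (@le_trans _ _ ((1 + dot x x) ^+ m *
   \sum_k `|envelope (t k) x * weval (a k) (e k) x|)).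
  by rewrite ler_wpM2l//; exact: ler_norm_sum.
by rewrite mulr_sumr; apply: ler_sum => k _; exact: HC.
Qed.

Lemma schwartz_cwsum e1 e2 : schwartz (cwsum e1 e2).
Proof.
split.
  move=> b; have [f1 [f2 ->]] := partials_cwsum e1 e2 b; split.
    by split; exact: continuous_wsum.
  by move=> j x; split; [case: (is_derive_wsum f1 x j)|case: (is_derive_wsum f2 x j)].
move=> p b; have [f1 [f2 ->]] := partials_cwsum e1 e2 b.
pose m := (\sum_j p j)%N.
have [C1 C10 H1] := wsum_bound f1 m; have [C2 C20 H2] := wsum_bound f2 m.
exists (C1 + C2) => x.
have pm : \prod_(j < d) `|x ord0 j| ^+ p j <= (1 + dot x x) ^+ m.
  rewrite /m -prodrXr; apply: ler_prod => j _; rewrite exprn_ge0//=.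
  by rewrite lerXn2r ?nnegrE ?addr_ge0 ?dot_ge0// coord_le_sqnorm.
have p0 : 0 <= \prod_(j < d) `|x ord0 j| ^+ p j by apply: prodr_ge0 => j _; rewrite exprn_ge0.
apply: (@le_trans _ _ ((1 + dot x x) ^+ m * (`|wsum f1 x| + `|wsum f2 x|))).
  by apply: ler_pM => //; [exact: normc_ge0|exact: normc_le_ReIm].
by rewrite mulrDr lerD.
Qed.

End sums.

Section wave_sums.
Variables (N : nat) (z a t : 'I_N -> R).
Hypothesis t0 : forall k, 0 < t k.

Definition wave_sum x : R[i] := \sum_k (z k)%:C * wave (a k) (t k) x.

Lemma wave_sum_cwsum : wave_sum =
  cwsum a t (fun k => Wmul (Wconst (z k)) Wcos) (fun k => Wmul (Wconst (z k)) Wsin).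
Proof.
apply/funext => x; apply: complex_ext => /=.
  by rewrite Re_sum; apply: eq_bigr => k _; rewrite creZ /wave creZ /envelope /=; ring.
by rewrite Im_sum; apply: eq_bigr => k _; rewrite cimZ /wave cimZ /envelope /=; ring.
Qed.

Lemma schwartz_wave_sum : schwartz wave_sum.
Proof. by rewrite wave_sum_cwsum; exact: schwartz_cwsum. Qed.

Lemma partial_wave_sum j x : partial j wave_sum x = \sum_k (z k)%:C *
  (((- t k * x ord0 j) +i* freq (a k) j) * wave (a k) (t k) x).
Proof.
rewrite wave_sum_cwsum partial_cwsum; apply: complex_ext => /=.
  rewrite Re_sum; apply: eq_bigr => k _.
  by rewrite creZ creM /wave creZ cimZ /envelope /=; ring.
rewrite Im_sum; apply: eq_bigr => k _.
by rewrite cimZ cimM /wave creZ cimZ /envelope /=; ring.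
Qed.

End wave_sums.
End schwartz_waves.

(** * L^p norms of lacunary sums *)

Section lp_sums.
Variable R : realType.
Local Notation leb := (@lebesgue_measure R).
Local Notation normc := ComplexField.Normc.normc.
Implicit Types (q M p : R).

(** The terms grow geometrically while P holds and decay geometrically afterwards,
    so that the largest one dominates. *)
Lemma unimodal_sum_le (w : nat -> R) (P : nat -> bool) q M N :
  0 <= q < 1 -> 0 <= M -> (forall k, 0 <= w k) -> (forall k, P k.+1 -> P k) ->
  (forall k, P k.+1 -> w k <= q * w k.+1) ->
  (forall k, ~~ P k -> w k.+1 <= q * w k) ->
  (forall k, (k < N)%N -> w k <= M) ->
  \sum_(k < N) w k <= 2 * M / (1 - q).
Proof.
move=> /andP[q0 q1] M0 w0 PS up down.
have q10 : 0 < 1 - q by lra.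
case: N => [|N] wM; first by rewrite big_ord0 divr_ge0 ?mulr_ge0// ltW.
(* the potential below records on which side of the maximum index k lies *)
have H k : (k <= N)%N ->
    (1 - q) * \sum_(i < k.+1) w i <= if P k then w k else 2 * M - q * w k.
  elim: k => [|k IH] kN.
    rewrite big_ord_recl big_ord0 addr0 /=; have := wM 0%N isT; have := w0 0%N.
    by case: ifP => _; nra.
  rewrite big_ord_recr /= mulrDr; have := IH (ltnW kN); have := wM k (ltnW kN : (k < N.+1)%N).
  have := wM k.+1 kN; have := w0 k.+1; have := w0 k.
  have [Pk1|_] := boolP (P k.+1).
    by rewrite (PS _ Pk1); have := up _ Pk1; nra.
  have [Pk|Pk] := boolP (P k); first by move=> *; nra.
  by have := down k Pk; nra.
rewrite ler_pdivlMr// mulrC; apply: le_trans (H N (leqnn N)) _.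
have := wM N (ltnSn N); have := w0 N; case: ifP => _; first lra.
by move=> w0N _; have : 0 <= q * w N by [rewrite mulr_ge0]; lra.
Qed.

Lemma powR_prod n (F : 'I_n -> R) p : (forall i, 0 <= F i) ->
  (\prod_i F i) `^ p = \prod_i F i `^ p.
Proof.
elim: n F => [|n IH] F F0; first by rewrite !big_ord0 powR1.
by rewrite !big_ord_recl powRM ?IH// prodr_ge0.
Qed.

Lemma exists_max_coord n (x : 'rV[R]_n.+1) :
  exists j, forall i, `|x ord0 i| <= `|x ord0 j|.
Proof.
case: (@arg_maxP _ _ _ (ord0 : 'I_n.+1) predT (fun i => `|x ord0 i|)) => // j _ h.
by exists j => i; exact: h.
Qed.

Lemma two_le (y : R) : 0 <= y -> y <= 1 -> 1 <= 2 / (1 + y).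
Proof. by move=> y0 y1; rewrite ler_pdivlMr; lra. Qed.

Lemma two_ge (y : R) d : 1 < y -> (y^-1) ^+ d <= (2 / (1 + y)) ^+ d.
Proof.
move=> y1; have y0 : 0 < y by lra.
have h : y^-1 <= 2 / (1 + y) by rewrite ler_pdivlMr; [rewrite mulrC ler_pdivrMr//|]; lra.
by apply: lerXn2r => //; rewrite nnegrE ?divr_ge0 ?invr_ge0//; lra.
Qed.

Lemma two_anti (y z : R) : 0 <= z -> z <= y -> 0 <= 2 / (1 + y) <= 2 / (1 + z).
Proof.
move=> z0 zy; rewrite divr_ge0//=; last lra.
by rewrite ler_wpM2l// lef_pV2 ?posrE; lra.
Qed.

Section cLnorm_bound.
Variable n : nat.
Local Notation d := n.+1.
Local Notation mu := (lebesgue_rV R d).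

(** The p-th power is dominated by a sum of products over the coordinates, the form
    in which an integral over R^d reduces to integrals over the line. *)
Lemma cLnorm_le_sum p N (F : 'rV[R]_d -> R[i]) (A c : R) (h : 'I_N -> 'I_d -> R -> R) :
  0 < p -> 0 <= A -> 0 <= c ->
  (forall k j, measurable_fun [set: R] (h k j)) -> (forall k j v, 0 <= h k j v) ->
  (forall k j, (\int[leb]_v (h k j v)%:E <= c%:E)%E) ->
  (forall x, normc (F x) `^ p <= A `^ p * \sum_k \prod_j h k j (x ord0 j)) ->
  (cLnorm p%:E F <= (A * (N%:R * c ^+ d) `^ p^-1)%:E)%E.
Proof.
move=> p0 A0 c0 mh h0 hc HF.
have pN : p != 0 by rewrite gt_eqF.
rewrite /cLnorm unlock.
have -> : (A * (N%:R * c ^+ d) `^ p^-1)%:E = ((A `^ p * (N%:R * c ^+ d))%:E `^ p^-1)%E.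
  have B0 : 0 <= N%:R * c ^+ d by rewrite mulr_ge0// exprn_ge0.
  by rewrite poweR_EFin (powRM _ (powR_ge0 A p) B0) -powRrM mulfV// powRr1.
have mP k : measurable_fun [set: 'rV[R]_d] (fun x => \prod_j h k j (x ord0 j)).
  exact: measurable_prod_coord.
have P0 k (x : 'rV[R]_d) : 0 <= \prod_j h k j (x ord0 j) by exact: prodr_ge0.
have I : (\int[mu]_x (`|(normc (F x))%:E| `^ p) <= (A `^ p * (N%:R * c ^+ d))%:E)%E.
  apply: (@le_trans _ _ (\int[mu]_x ((A `^ p)%:E *
      (\sum_(k < N) (\prod_j h k j (x ord0 j))%:E)))%E).
    apply: ge0_integral_mono => x _; first exact: poweR_ge0.
    by rewrite sumEFin -EFinM /= ger0_norm ?normc_ge0// lee_fin.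
  rewrite ge0_integralZl//; last 3 first.
  - apply: emeasurable_sum => k; exact: measurable_funE (mP k).
  - by move=> x _; apply: sume_ge0 => k _; rewrite lee_fin.
  - by rewrite lee_fin powR_ge0.
  rewrite EFinM lee_wpmul2l ?lee_fin ?powR_ge0//.
  rewrite ge0_integral_sum//; last 2 first.
  - by move=> k; exact: measurable_funE (mP k).
  - by move=> k x _; rewrite lee_fin.
  apply: (@le_trans _ _ (\sum_(k < N) (c ^+ d)%:E)%E).
    apply: lee_sum => k _; have := ge0_integral_prod_le (mh k) (h0 k) (hc k).
    by rewrite prodr_const card_ord.
  by rewrite sumEFin sumr_const card_ord lee_fin mulr_natl.
have J0 : (0 <= \int[mu]_x (`|(normc (F x))%:E| `^ p))%E.
  by apply: integral_ge0 => x _; exact: poweR_ge0.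
have hp : 0 <= p^-1 by rewrite invr_ge0 ltW.
apply: (gt0_ler_poweR hp) => //; rewrite in_itv /= ?J0 ?leey// andbT.
by rewrite lee_fin mulr_ge0 ?powR_ge0// mulr_ge0// exprn_ge0.
Qed.

(** N bumps at the scales 2^-k, normalized in L^p. At each point they form a sequence
    that first grows and then decays geometrically, so that the p-th power of the sum
    is comparable to the sum of the p-th powers: the norm is of order N^(1/p) and not N. *)
Lemma cLnorm_lacunary p : 1 < p -> exists2 C : R, 0 <= C &
  forall N (F : 'rV[R]_d -> R[i]) (A : R), 0 <= A ->
  (forall x j, normc (F x) <= A * \sum_(k < N)
     (2 ^+ k) `^ (d%:R / p) / (1 + 2 ^+ k * `|x ord0 j|) ^+ d) ->
  (cLnorm p%:E F <= (C * A * N%:R `^ p^-1)%:E)%E.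
Proof.
move=> p1; have p0 : 0 < p by lra.
have d0 : 0 < d%:R :> R by rewrite ltr0n.
pose g := d%:R / p.
have g0 : 0 < g by rewrite divr_gt0.
have gd : g < d%:R by rewrite /g ltr_pdivrMr// ltr_pMr.
have gp : g * p = d%:R by rewrite /g divfK// gt_eqF.
pose q := Num.max (2 `^ (- g)) (2 `^ (g - d%:R)).
have q01 : 0 <= q < 1.
  have two (e : R) : 0 < e -> 2 `^ (- e) < 1 :> R.
    move=> e0; rewrite powRN invf_lt1 ?powR_gt0//.
    have := @gt0_ltr_powR R _ e0 1 2; rewrite powR1; apply; rewrite ?nnegrE//; lra.
  rewrite /q le_max powR_ge0 /= gt_max two//= -opprB two//; lra.
have q1 : 0 < 1 - q by lra.
pose c : R := 2 `^ p * (2 / (p - 1)).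
have c0 : 0 <= c by rewrite /c mulr_ge0 ?powR_ge0 ?divr_ge0//; lra.
exists (2 / (1 - q) * (c ^+ d) `^ p^-1) => [|N F A A0 HF].
  by rewrite mulr_ge0 ?powR_ge0 ?divr_ge0// ltW.
pose b (k : 'I_N) (j : 'I_d) (v : R) := 2 ^+ k * (2 `^ p * (1 + 2 ^+ k * `|v|) `^ (- p)).
have e0 k : 0 < 2 ^+ k :> R by rewrite exprn_gt0.
have b0 k j v : 0 <= b k j v.
  by rewrite /b mulr_ge0 ?(ltW (e0 _))// mulr_ge0 ?powR_ge0.
have mb k j : measurable_fun [set: R] (b k j).
  apply: measurable_funM => //; apply: measurable_funM => //.
  by apply: continuous_measurable_fun; apply: continuous_norm_powR => //; exact: ltW.
have Ib k j : (\int[leb]_v (b k j v)%:E <= c%:E)%E.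
  have r0 : 0 < (2 ^+ k)^-1 :> R by rewrite invr_gt0.
  rewrite /b; under eq_integral do rewrite mulrA EFinM.
  rewrite ge0_integralZl//; last first.
    exact: measurable_funE (continuous_measurable_fun
      (@continuous_norm_powR R 1 (2 ^+ k) (- p) ltr01 (ltW (e0 k)))).
  have := integral_powR_decay p1 r0; rewrite invrK => I.
  apply: le_trans (lee_wpmul2l _ I) _; first by rewrite lee_fin mulr_ge0 ?powR_ge0// ltW.
  rewrite -EFinM lee_fin /c [leLHS](_ : _ = 2 `^ p * (2 / (p - 1)) * (2 ^+ k / 2 ^+ k)); last by ring.
  by rewrite divff ?mulr1// gt_eqF.
have -> : 2 / (1 - q) * (c ^+ d) `^ p^-1 * A * N%:R `^ p^-1 =
    (A * (2 / (1 - q))) * (N%:R * c ^+ d) `^ p^-1.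
  by rewrite (powRM _ _ (exprn_ge0 d c0))//; ring.
apply: (@cLnorm_le_sum p N F _ c b) => //.
  by rewrite mulr_ge0// divr_ge0// ltW.
move=> x; have [j jM] := exists_max_coord x.
pose X := `|x ord0 j|; have X0 : 0 <= X by exact: normr_ge0.
pose P k := 2 ^+ k * X <= 1.
pose m k : R := if P k then 1 else (2 ^+ k * X) ^- d.
(* X is the sup norm of x, and w k the size of the k-th bump up to constants *)
pose w k := (2 ^+ k) `^ g * m k.
have y0 k : 0 <= 2 ^+ k * X by rewrite mulr_ge0// ltW.
have m0 k : 0 <= m k by rewrite /m; case: ifP => // _; rewrite invr_ge0 exprn_ge0.
have w0 k : 0 <= w k by rewrite mulr_ge0 ?powR_ge0.
have PS k : P k.+1 -> P k.
  by rewrite /P exprS -mulrA; have := y0 k; lra.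
have gS k : (2 ^+ k.+1) `^ g = 2 `^ g * (2 ^+ k) `^ g :> R.
  by rewrite exprS powRM// ltW.
have up k : P k.+1 -> w k <= q * w k.+1.
  move=> Pk1; rewrite /w /m Pk1 (PS _ Pk1) !mulr1 gS mulrA ler_peMl ?powR_ge0//.
  apply: (@le_trans _ _ (2 `^ (- g) * 2 `^ g)).
    by rewrite powRN mulVf// gt_eqF// powR_gt0.
  by rewrite ler_wpM2r ?powR_ge0// /q le_max lexx.
have down k : ~~ P k -> w k.+1 <= q * w k.
  move=> Pk; have Pk1 : ~~ P k.+1 by apply: contra Pk; exact: PS.
  rewrite /w /m (negbTE Pk) (negbTE Pk1) gS [2 ^+ k.+1]exprS -(mulrA 2) (exprMn _ 2) invfM.
  rewrite [leLHS](_ : _ = 2 `^ g * 2 ^- d * ((2 ^+ k) `^ g * (2 ^+ k * X) ^- d)); last by ring.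
  rewrite ler_wpM2r ?mulr_ge0 ?powR_ge0 ?invr_ge0 ?exprn_ge0//.
  by rewrite -powR_mulrn// -powRN -powRD ?pnatr_eq0 ?implybT// /q le_max lexx orbT.
pose S := \sum_(k < N) w k `^ p.
have S0 : 0 <= S by apply: sumr_ge0 => k _; exact: powR_ge0.
have wS k : (k < N)%N -> w k <= S `^ p^-1.
  move=> kN; rewrite -[leLHS](powRr1 (w0 k)) -(mulfV (_ : p != 0)) ?gt_eqF// powRrM.
  rewrite ge0_ler_powR ?nnegrE ?invr_ge0 ?powR_ge0 ?(ltW p0)//.
  rewrite /S (bigD1 (Ordinal kN)) //= lerDl sumr_ge0// => i _; exact: powR_ge0.
have Sw := unimodal_sum_le q01 (powR_ge0 _ _) w0 PS up down wS.
have FS : normc (F x) <= A * (2 / (1 - q)) * S `^ p^-1.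
  apply: le_trans (HF x j) _; rewrite -mulrA ler_wpM2l//.
  rewrite [leRHS](_ : _ = 2 * S `^ p^-1 / (1 - q)); last by ring.
  apply: le_trans Sw; apply: ler_sum => k _; rewrite ler_wpM2l ?powR_ge0// -/X.
  have y1 : 0 < 1 + 2 ^+ k * X by have := y0 k; lra.
  rewrite /m; case: ifP => Pk.
    by rewrite invf_le1 ?exprn_gt0// exprn_ege1//; have := y0 k; lra.
  have z0 : 0 < 2 ^+ k * X by move/negbT: Pk; rewrite -ltNge; lra.
  by rewrite lef_pV2 ?posrE ?exprn_gt0// lerXn2r ?nnegrE//; lra.
apply: (@le_trans _ _ ((A * (2 / (1 - q)) * S `^ p^-1) `^ p)).
  by apply: (ge0_ler_powR _ _ _ FS); rewrite ?nnegrE ?normc_ge0 ?(ltW p0)//; exact: le_trans (normc_ge0 _) FS.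
have A20 : 0 <= A * (2 / (1 - q)) by rewrite mulr_ge0 ?divr_ge0// ltW.
rewrite (powRM _ A20 (powR_ge0 _ _)) -powRrM mulVf ?gt_eqF// powRr1// ler_wpM2l ?powR_ge0//.
apply: ler_sum => k _.
have mk : m k <= \prod_(i < d) (2 / (1 + 2 ^+ k * `|x ord0 i|)).
  apply: (@le_trans _ _ (\prod_(i < d) (2 / (1 + 2 ^+ k * X)))).
    rewrite prodr_const card_ord /m; case: ifP => Pk.
      exact/exprn_ege1/two_le.
    by rewrite -exprVn; apply: two_ge; move/negbT: Pk; rewrite -ltNge.
  apply: ler_prod => i _; have z0 : 0 <= 2 ^+ k * `|x ord0 i| by rewrite mulr_ge0// ltW.
  have zX : 2 ^+ k * `|x ord0 i| <= 2 ^+ k * X by rewrite ler_wpM2l ?(ltW (e0 _))// jM.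
  exact: two_anti.
rewrite /w powRM ?powR_ge0// -powRrM gp powR_mulrn ?(ltW (e0 _))//.
apply: (@le_trans _ _ ((2 ^+ k) ^+ d * (\prod_(i < d) (2 / (1 + 2 ^+ k * `|x ord0 i|))) `^ p)).
  rewrite ler_wpM2l ?exprn_ge0// ge0_ler_powR ?nnegrE ?(ltW p0)//.
  exact: le_trans mk.
have z0 i : 0 <= 2 ^+ k * `|x ord0 i| by rewrite mulr_ge0// ltW.
rewrite powR_prod => [|i]; last by rewrite divr_ge0//; have := z0 i; lra.
have -> : (2 ^+ k) ^+ d = \prod_(i < d) 2 ^+ k :> R by rewrite prodr_const card_ord.
rewrite -big_split /=.
apply: ler_prod => i _; have z1 := z0 i.
rewrite mulr_ge0 ?powR_ge0 ?(ltW (e0 _))//= /b ler_wpM2l ?(ltW (e0 _))//.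
have y1 : 0 <= 1 + 2 ^+ k * `|x ord0 i| by lra.
by rewrite powRM ?invr_ge0// -powR_inv1// -powRrM mulN1r.
Qed.

End cLnorm_bound.
End lp_sums.

(** * Cubes and norms *)

Section cube_norms.
Variable R : realType.
Local Notation leb := (@lebesgue_measure R).
Local Notation normc := ComplexField.Normc.normc.
Local Notation mu n := (lebesgue_rV R n).
Implicit Types (p l A r : R).

(** The [measurableTypeR] of the reals carries the sigma-algebra of the Lebesgue
    measure. *)
Definition segment (b l : R) : set (measurableTypeR R) := [set v | b <= v <= b + l].

Lemma measurable_segment b l : measurable_fun [set: R] (\1_(segment b l) : R -> R).
Proof.
by apply: measurable_indic; rewrite /segment -set_itvcc; exact: measurable_itv.
Qed.

Lemma integral_segment b l : 0 <= l -> (\int[leb]_v (\1_(segment b l) v)%:E = l%:E)%E.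
Proof.
move=> l0; have mS : measurable (segment b l).
  by rewrite /segment -set_itvcc; exact: measurable_itv.
rewrite (integral_indic _ measurableT mS).
have := @lebesgue_measure_itv R `[b, b + l]; rewrite set_itvcc setIT => E.
apply: etrans E _; rewrite /= lte_fin.
by case: ltP => h; rewrite -?EFinB; congr (_%:E); lra.
Qed.

Section measure_cube.
Variables (n : nat) (a : 'rV[R]_n) (l : R).

Let side j := segment (a ord0 j) l.

Lemma indic_cube x : \1_(cube a l) x = \prod_j \1_(side j) (x ord0 j) :> R.
Proof.
have [h|h] := pselect (cube a l x).
  rewrite indicE mem_set// big1// => j _; rewrite indicE mem_set//=.
  exact: h.
rewrite indicE memNset//; apply/esym/eqP/prodf_eq0.
have [j hj] : exists j, ~ (a ord0 j <= x ord0 j <= a ord0 j + l) by exact/existsNP.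
exists j => //; by rewrite indicE memNset.
Qed.

Let measurable_prod_side :
  measurable_fun [set: 'rV[R]_n] (fun x => \prod_j \1_(side j) (x ord0 j) : R).
Proof.
apply: (@measurable_prod_coord _ _ (fun j => \1_(side j))) => j.
exact: measurable_segment.
Qed.

Lemma measurable_cube : measurable (cube a l).
Proof.
have -> : cube a l = [set: 'rV[R]_n] `&`
    (fun x => \prod_j \1_(side j) (x ord0 j) : R) @^-1` [set 1].
  rewrite setTI; apply/seteqP; split => x /=; rewrite -indic_cube indicE.
    by move=> h; rewrite mem_set.
  by case: (boolP (x \in cube a l)) => [/set_mem//|_ /eqP]; rewrite eq_sym oner_eq0.
by apply: measurable_prod_side => //; exact: measurable_set1.
Qed.

Lemma measure_cube : 0 <= l -> mu n (cube a l) = (l ^+ n)%:E.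
Proof.
move=> l0; rewrite -[cube a l]setIT -integral_indic//; last exact: measurable_cube.
under eq_integral do rewrite indic_cube.
rewrite (@ge0_integral_prod _ _ (fun j => \1_(side j)) (fun=> l)).
- by rewrite prodr_const card_ord.
- by move=> j; exact: measurable_segment.
- by move=> j v; rewrite indicE.
- by move=> j; exact: integral_segment.
Qed.

End measure_cube.

Variable n : nat.
Local Notation d := n.+1.

Lemma cLnorm_bump p : 1 < p -> exists2 C : R, 0 <= C &
  forall r A (F : 'rV[R]_d -> R[i]), 0 < r -> 0 <= A ->
  (forall x j, normc (F x) * (1 + r^-1 * `|x ord0 j|) ^+ d <= A) ->
  (cLnorm p%:E F <= (C * A * r `^ (d%:R / p))%:E)%E.
Proof.
move=> p1; have p0 : 0 < p by lra.
pose c : R := 2 / (p - 1); have c0 : 0 <= c by rewrite divr_ge0//; lra.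
exists ((c ^+ d) `^ p^-1) => [|r A F r0 A0 HF]; first exact: powR_ge0.
have ri0 : 0 < r^-1 by rewrite invr_gt0.
have -> : (c ^+ d) `^ p^-1 * A * r `^ (d%:R / p) = A * (1%:R * (c * r) ^+ d) `^ p^-1.
  rewrite mul1r [(c * r) ^+ d]exprMn (powRM _ (exprn_ge0 d c0) (exprn_ge0 d (ltW r0))) powRrM.
  by rewrite powR_mulrn ?(ltW r0)//; ring.
apply: (@cLnorm_le_sum _ _ p 1 F A (c * r)
    (fun=> fun=> fun v => (1 + r^-1 * `|v|) `^ (- p))) => //.
- by rewrite mulr_ge0// ltW.
- move=> _ _; apply: continuous_measurable_fun; apply: continuous_norm_powR => //.
  exact: ltW.
- by move=> *; exact: powR_ge0.
- by move=> _ _; exact: integral_powR_decay.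
move=> x; rewrite big_ord1 -powR_prod => [|i]; last by rewrite addr_ge0// mulr_ge0// ltW.
have [j jM] := exists_max_coord x.
have h i : 1 <= 1 + r^-1 * `|x ord0 i| by rewrite lerDl mulr_ge0// ltW.
have P1 : 0 < \prod_i (1 + r^-1 * `|x ord0 i|).
  by apply: prodr_gt0 => i _; have := h i; lra.
have FA : normc (F x) <= A * (\prod_i (1 + r^-1 * `|x ord0 i|))^-1.
  rewrite ler_pdivlMr//; apply: le_trans (HF x j); rewrite ler_wpM2l ?normc_ge0//.
  rewrite -[X in _ <= _ ^+ X](card_ord d) -prodr_const; apply: ler_prod => i _.
  have := h i; have : r^-1 * `|x ord0 i| <= r^-1 * `|x ord0 j| by rewrite ler_wpM2l ?(ltW ri0).
  by move=> *; apply/andP; split; lra.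
rewrite powRN -powR_inv1 ?powR_ge0// powRAC powR_inv1 ?(ltW P1)//.
rewrite -powRM ?invr_ge0 ?(ltW P1)//; apply: ge0_ler_powR => //; rewrite ?nnegrE ?normc_ge0 ?(ltW p0)//.
by rewrite mulr_ge0 ?invr_ge0 ?(ltW P1).
Qed.

Lemma cLnorm_ge_cube p A (a : 'rV[R]_d) l (F : 'rV[R]_d -> R[i]) : 0 < p -> 0 <= A -> 0 <= l ->
  (forall x, cube a l x -> A <= normc (F x)) ->
  ((A * l `^ (d%:R / p))%:E <= cLnorm p%:E F)%E.
Proof.
move=> p0 A0 l0 AF; rewrite /cLnorm unlock.
have -> : (A * l `^ (d%:R / p))%:E = ((A `^ p * l ^+ d)%:E `^ p^-1)%E.
  rewrite poweR_EFin (powRM _ (powR_ge0 A p) (exprn_ge0 d l0)) -powRrM mulfV ?gt_eqF//.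
  by rewrite powRr1// powRrM powR_mulrn.
have hp : 0 <= p^-1 by rewrite invr_ge0 ltW.
apply: (gt0_ler_poweR hp); rewrite ?in_itv /= ?leey ?andbT.
- by rewrite lee_fin mulr_ge0 ?powR_ge0// exprn_ge0.
- by apply: integral_ge0 => x _; rewrite lee_fin powR_ge0.
rewrite EFinM -(measure_cube a l0) -[X in mu d X]setIT -integral_indic//; last exact: measurable_cube.
rewrite -ge0_integralZl//; last 2 first.
- by apply: measurable_funE; apply: measurable_indic; exact: measurable_cube.
- by rewrite lee_fin powR_ge0.
apply: ge0_integral_mono => x _; first by rewrite mule_ge0// lee_fin ?powR_ge0// indicE.
rewrite /= -EFinM lee_fin indicE; case: (boolP (x \in cube a l)) => [/set_mem|] h.
  by rewrite mulr1 ger0_norm ?normc_ge0// ge0_ler_powR ?nnegrE ?normc_ge0 ?(ltW p0)//; exact: AF.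
by rewrite mulr0 powR_ge0.
Qed.

Lemma cLnorm_sup_le A (F : 'rV[R]_d -> R[i]) : 0 <= A -> (forall x, normc (F x) <= A) ->
  (cLnorm +oo F <= A%:E)%E.
Proof.
move=> A0 FA; rewrite /cLnorm unlock; case: ifP => // _.
apply/ess_supP; apply: (@aeW _ _ _ (lebesgue_rV R d)) => x /=.
by rewrite lee_fin ger0_norm ?normc_ge0.
Qed.

End cube_norms.

(** * Mean oscillation *)

Section oscillation.
Variables (R : realType) (n : nat).
Local Notation d := n.+1.
Local Notation mu := (lebesgue_rV R d).
Local Notation leb := (@lebesgue_measure R).
Local Notation normc := ComplexField.Normc.normc.
Implicit Types (a x y : 'rV[R]_d) (l K : R).

Lemma creN (z : R[i]) : complex.Re (- z) = - complex.Re z.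
Proof. by case: z. Qed.

Lemma cimN (z : R[i]) : complex.Im (- z) = - complex.Im z.
Proof. by case: z. Qed.

Section average.
Variables (a : 'rV[R]_d) (l K : R) (H : 'rV[R]_d -> R).
Local Notation Q := (cube a l).
Hypotheses (l0 : 0 < l) (K0 : 0 <= K).
Hypotheses (mH : measurable_fun [set: 'rV[R]_d] H) (H0 : forall x, 0 <= H x).
Hypothesis IH : (\int[mu]_(x in Q) (H x)%:E <= (K * l ^+ d)%:E)%E.

Let mQ : measurable Q := measurable_cube a l.

Let muQ : mu Q = (l ^+ d)%:E := measure_cube a (ltW l0).

Let iH : mu.-integrable Q (EFin \o H).
Proof.
apply/integrableP; split; first by apply: measurable_funTS; exact: measurable_funE.
apply: (@le_lt_trans _ _ (K * l ^+ d)%:E); last exact: ltry.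
by under eq_integral do rewrite /= ger0_norm//.
Qed.

Let icst (z : R) : mu.-integrable Q (EFin \o cst z).
Proof.
apply/integrableP; split; first by apply: measurable_funE; exact: measurable_cst.
rewrite [ltLHS](_ : _ = (`|z|%:E * (l ^+ d)%:E)%E); first by rewrite -EFinM ltry.
by rewrite -muQ; exact: (integral_cst mu mQ `|z|%:E).
Qed.

Lemma average_close (f : 'rV[R]_d -> R) (z : R) : measurable_fun [set: 'rV[R]_d] f ->
  (forall x, Q x -> `|f x - z| <= H x) -> `|(l ^+ d)^-1 * Rintegral mu Q f - z| <= K.
Proof.
move=> mf fH; have ld : 0 < l ^+ d by rewrite exprn_gt0.
have ih : mu.-integrable Q (EFin \o (fun x => f x - z)).
  apply: (le_integrable mQ _ _ iH) => [|x Qx].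
    by apply: measurable_funTS; apply: measurable_funE; exact: measurable_funB.
  by rewrite /= lee_fin (ger0_norm (H0 x)); exact: fH.
have E : Rintegral mu Q f = Rintegral mu Q (fun x => f x - z) + z * l ^+ d.
  rewrite [LHS](_ : _ = Rintegral mu Q (fun x => (f x - z) + cst z x)); last first.
    by apply: eq_Rintegral => x _; rewrite subrK.
  rewrite (RintegralD mQ ih (icst z)); congr (_ + _).
  rewrite (Rintegral_cst mu mQ); congr (_ * _); exact: (congr1 (@fine R) muQ).
rewrite E mulrDr [X in _ + X - _](_ : _ = z); last by field; rewrite gt_eqF.
rewrite addrK normrM ger0_norm ?invr_ge0 ?(ltW ld)// ler_pdivrMl// mulrC.
apply: le_trans (le_normr_Rintegral mQ ih) _.
apply: (@le_trans _ _ (Rintegral mu Q H)).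
  apply: le_Rintegral => //; rewrite (_ : _ \o _ = abse \o (EFin \o (fun x => f x - z)))//.
  exact: integrable_abse.
rewrite /Rintegral -lee_fin fineK//; exact: integrable_fin_num.
Qed.

(** The average is within 2 K of z, K for the real part and K for the imaginary part:
    hence the factor 3. *)
Lemma mean_oscillation_le (f : 'rV[R]_d -> R[i]) (z : R[i]) :
  measurable_fun [set: 'rV[R]_d] (fun x => complex.Re (f x)) ->
  measurable_fun [set: 'rV[R]_d] (fun x => complex.Im (f x)) ->
  (forall x, Q x -> normc (f x - z) <= H x) ->
  (mean_oscillation Q f <= (3 * K)%:E)%E.
Proof.
move=> mre mim fH; have ld : 0 < l ^+ d by rewrite exprn_gt0.
have re : `|complex.Re (average Q f - z)| <= K.
  rewrite /average muQ creD creN creZ; apply: (average_close mre) => x Qx.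
  by apply: le_trans (fH x Qx); rewrite -creN -creD; exact: normc_Re.
have im : `|complex.Im (average Q f - z)| <= K.
  rewrite /average muQ cimD cimN cimZ; apply: (average_close mim) => x Qx.
  by apply: le_trans (fH x Qx); rewrite -cimN -cimD; exact: normc_Im.
have I : (\int[mu]_(x in Q) (normc (f x - average Q f))%:E <= (3 * K * l ^+ d)%:E)%E.
  apply: (@le_trans _ _ (\int[mu]_(x in Q) ((H x)%:E + (2 * K)%:E))%E).
    apply: ge0_integral_mono => x Qx; first by rewrite lee_fin normc_ge0.
    rewrite -EFinD lee_fin (_ : f x - average Q f = (f x - z) + - (average Q f - z)); last by ring.
    apply: le_trans (le_normcD _ _) _; apply: lerD; first exact: fH.
    by rewrite normcN; apply: le_trans (normc_le_ReIm _) _; lra.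
  rewrite ge0_integralD//; last 3 first.
  - by move=> x _; rewrite lee_fin.
  - by apply: measurable_funTS; exact: measurable_funE.
  - by move=> x _; rewrite lee_fin mulr_ge0.
  rewrite (_ : \int[mu]_(x in Q) (2 * K)%:E = (2 * K)%:E * (l ^+ d)%:E)%E; last first.
    by rewrite -muQ; exact: (integral_cst mu mQ (2 * K)%:E).
  by apply: le_trans (leeD2r _ IH) _; rewrite -EFinM -EFinD lee_fin; lra.
rewrite /mean_oscillation muQ inver gt_eqF//.
apply: le_trans (lee_wpmul2l _ I) _; first by rewrite lee_fin invr_ge0 ltW.
by rewrite -EFinM lee_fin [leLHS]mulrC mulfK ?gt_eqF.
Qed.

End average.

End oscillation.

(** * Lipschitz bounds and decay for sums of wave packets *)

Section lipschitz.
Variables (R : realType) (n : nat).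
Local Notation d := n.+1.
Implicit Types (x y : 'rV[R]_d) (j : 'I_d) (F : 'rV[R]_d -> R).

Lemma is_derive_slice F x j v df :
  is_derive (upd x j v) (delta_mx ord0 j) F df ->
  is_derive v (1 : R) (fun v => F (upd x j v)) df.
Proof.
have E : (fun h : R => h^-1 *: (F (upd x j (h *: 1 + v)) - F (upd x j v))) =
    (fun h : R => h^-1 *: (F (h *: delta_mx ord0 j + upd x j v) - F (upd x j v))).
  apply/funext => h; congr (_ *: (F _ - _)).
  apply: rV_ext => i; rewrite updE !mxE eqxx /=.
  by case: eqP => _; rewrite ?mulr1 ?mulr0 ?add0r// /GRing.scale /= mulr1.
move=> [h1 h2]; split; first by rewrite /derivable E; exact: h1.
by rewrite -h2 /derive E.
Qed.

Lemma lipschitz_slice F (G : 'I_d -> 'rV[R]_d -> R) (L : R) x j u v :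
  (forall x j, is_derive x (delta_mx ord0 j) F (G j x)) ->
  (forall j x, `|G j x| <= L) ->
  `|F (upd x j v) - F (upd x j u)| <= L * `|v - u|.
Proof.
move=> dF GL; wlog uv : u v / u <= v.
  move=> H; have [uv|/ltW vu] := leP u v; first exact: H.
  by rewrite distrC (distrC v); exact: H.
have dS w : is_derive w (1 : R) (fun v => F (upd x j v)) (G j (upd x j w)).
  by apply: is_derive_slice; exact: dF.
have [|w _ ->] := @MVT_segment R _ _ u v uv (fun w _ => dS w).
  apply: continuous_subspaceT; exact: (is_derive_continuous dS).
by rewrite normrM ler_wpM2r.
Qed.

(** From y to x one coordinate at a time, with the mean value theorem at each step. *)
Lemma lipschitz_coord F (G : 'I_d -> 'rV[R]_d -> R) (L D : R) x y :
  (forall x j, is_derive x (delta_mx ord0 j) F (G j x)) ->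
  (forall j x, `|G j x| <= L) -> (forall j, `|x ord0 j - y ord0 j| <= D) ->
  `|F x - F y| <= d%:R * (L * D).
Proof.
move=> dF GL xyD.
pose mix m : 'rV[R]_d := \row_i (if (i < m)%N then x ord0 i else y ord0 i).
have L0 : 0 <= L by exact: le_trans (normr_ge0 _) (GL ord0 x).
have H m : (m <= d)%N -> `|F (mix m) - F y| <= m%:R * (L * D).
  elim: m => [_|m IH md].
    rewrite (_ : mix 0%N = y) ?subrr ?normr0 ?mul0r//.
    by apply/rV_ext => i; rewrite mxE.
  pose j := Ordinal md.
  have E1 : mix m.+1 = upd (mix m) j (x ord0 j).
    apply/rV_ext => i; rewrite updE !mxE ltnS leq_eqVlt -val_eqE /=.
    by case: eqP => // e; congr (x _ _); exact/val_inj.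
  have E2 : mix m = upd (mix m) j (y ord0 j).
    rewrite -[LHS](upd_id _ j); congr upd; rewrite mxE ltnn//.
  rewrite -(subrK (F (mix m)) (F (mix m.+1))) -addrA -natr1 mulrDl mul1r addrC.
  apply: le_trans (ler_normD _ _) (lerD (IH (ltnW md)) _).
  rewrite E1 [X in _ - F X]E2; apply: le_trans (lipschitz_slice _ _ _ _ dF GL) _.
  by rewrite ler_wpM2l.
rewrite (_ : x = mix d); first exact: H.
by apply/rV_ext => i; rewrite mxE ltn_ord.
Qed.

Section wsum.
Variables (N : nat) (a t : 'I_N -> R) (t0 : forall k, 0 < t k).

Lemma lipschitz_wsum e : exists2 L : R, 0 <= L & forall x y D,
  (forall j, `|x ord0 j - y ord0 j| <= D) -> `|wsum a t e x - wsum a t e y| <= L * D.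
Proof.
pose G j := wsum a t (fun k => wderE (t k) (a k) j (e k)).
have H j : exists2 C : R, 0 <= C & forall x, `|G j x| <= C.
  have [C C0 HC] := wsum_bound a t0 (fun k => wderE (t k) (a k) j (e k)) 0.
  by exists C => // x; have := HC x; rewrite expr0 mul1r.
pose C j := sval (cid2 (H j)).
have C0 j : 0 <= C j by rewrite /C; case: cid2.
have HC j x : `|G j x| <= \sum_i C i.
  rewrite (bigD1 j)//=; apply: (@le_trans _ _ (C j)).
    by rewrite /C; case: cid2 => /= c _; exact.
  by rewrite lerDl sumr_ge0.
exists (d%:R * \sum_i C i) => [|x y D xyD]; first by rewrite mulr_ge0// sumr_ge0.
by rewrite -mulrA; apply: (@lipschitz_coord _ G) => // ? ?; exact: is_derive_wsum.
Qed.

Lemma decay_wsum e : exists2 C : R, 0 <= C & forall x,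
  `|wsum a t e x| <= C * (1 + `|x ord0 ord0|) `^ (- 2%:R).
Proof.
have [C C0 HC] := wsum_bound a t0 e 2; exists (4 * C) => [|x]; first by rewrite mulr_ge0.
have y1 : 0 < 1 + `|x ord0 ord0| by rewrite ltr_pwDl.
rewrite powR_invn ?(ltW y1)// ler_pdivlMr ?exprn_gt0//.
have h := coord_le_sqnorm x ord0; have q0 := dot_ge0 x.
have h2 : (1 + `|x ord0 ord0|) ^+ 2 <= (2 * (1 + dot x x)) ^+ 2.
  by rewrite lerXn2r ?nnegrE; lra.
apply: le_trans (ler_wpM2l (normr_ge0 _) h2) _.
rewrite exprMn mulrCA (_ : 2 ^+ 2 = 4 :> R); last by ring.
by rewrite ler_wpM2l// mulrC.
Qed.

Lemma measurable_weval c e : measurable_fun [set: 'rV[R]_d] (weval c e).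
Proof.
have mc : measurable_fun [set: 'rV[R]_d] (fun x => c * x ord0 ord0).
  by apply: measurable_funM => //; exact: (measurable_coord ord0).
elim: e => [k|i|||e1 IH1 e2 IH2|e1 IH1 e2 IH2] /=.
- exact: measurable_cst.
- exact: measurable_coord.
- exact: measurable_cos_fun.
- exact: measurable_sin_fun.
- exact: measurable_funD.
- exact: measurable_funM.
Qed.

Lemma measurable_wsum e : measurable_fun [set: 'rV[R]_d] (wsum a t e).
Proof.
rewrite /wsum; apply: measurable_sum => k; apply: measurable_funM; last exact: measurable_weval.
apply: measurableT_comp => //; apply: measurableT_comp => //.
by apply: measurable_funM => //; exact: (@measurable_sqnorm R d).
Qed.

End wsum.
End lipschitz.


(** * Oscillation of lacunary sums *)

Section lacunary_bmo.
Variables (R : realType) (n : nat).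
Local Notation d := n.+1.
Local Notation mu := (lebesgue_rV R d).
Local Notation leb := (@lebesgue_measure R).
Local Notation normc := ComplexField.Normc.normc.
Implicit Types (a x y : 'rV[R]_d) (l K : R).

Lemma integral_cube_le a l (g : R -> R) (c : R) : 0 <= l ->
  measurable_fun [set: R] g -> (forall v, 0 <= g v) ->
  (\int[leb]_v (g v)%:E <= c%:E)%E ->
  (\int[mu]_(x in cube a l) (g (x ord0 ord0))%:E <= (c * l ^+ n)%:E)%E.
Proof.
move=> l0 mg g0 gc.
pose h (j : 'I_d) v : R := if j == ord0 then g v else \1_(segment (a ord0 j) l) v.
have := @ge0_integral_prod_le R d h (fun j => if j == ord0 then c else l).
rewrite big_ord_recl eqxx /= (eq_bigr (fun=> l)) => [|j _]; last by [].
rewrite prodr_const card_ord => H; rewrite integral_mkcond; apply: le_trans (H _ _ _).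
- apply: ge0_integral_mono => x _; first by apply: erestrict_ge0 => y _; rewrite lee_fin.
  rewrite /patch; case: ifP => [/set_mem xQ|_]; last first.
    by rewrite lee_fin prodr_ge0// => j _; rewrite /h; case: ifP => // _; rewrite indicE.
  rewrite lee_fin big_ord_recl /h eqxx /= big1 ?mulr1// => j _.
  by rewrite indicE mem_set//; exact: xQ.
- by move=> j; rewrite /h; case: (j == ord0) => //; exact: measurable_segment.
- by move=> j v; rewrite /h; case: ifP => // _; rewrite indicE.
- by move=> j; rewrite /h; case: (j == ord0) => //; rewrite integral_segment.
Qed.

Section profile.
Variables (V : 'rV[R]_d -> R[i]) (L C : R).
Hypotheses (L0 : 0 <= L) (C0 : 0 <= C).
Hypothesis mre : measurable_fun [set: 'rV[R]_d] (fun x => complex.Re (V x)).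
Hypothesis mim : measurable_fun [set: 'rV[R]_d] (fun x => complex.Im (V x)).
Hypothesis lip : forall x y D, (forall j, `|x ord0 j - y ord0 j| <= D) ->
  normc (V x - V y) <= L * D.
Hypothesis decay : forall x, normc (V x) <= C * (1 + `|x ord0 ord0|) `^ (- 2%:R).

Definition lacunary N (c : R) x : R[i] := \sum_(k < N) c%:C * V (2 ^+ k *: x).

Let measurable_lacunary (f : R[i] -> R) N c :
  (forall z w, f (z + w) = f z + f w) -> f 0 = 0 -> (forall z, f (c%:C * z) = c * f z) ->
  measurable_fun [set: 'rV[R]_d] (fun x => f (V x)) ->
  measurable_fun [set: 'rV[R]_d] (fun x => f (lacunary N c x)).
Proof.
move=> fD f0 fZ mf.
rewrite (_ : (fun x => _) = fun x => \sum_(k < N) c * f (V (2 ^+ k *: x))); last first.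
  by apply/funext => x; rewrite /lacunary (big_morph f fD f0); apply: eq_bigr => k _.
apply: measurable_sum => k; apply: measurable_funM => //.
apply: (measurableT_comp mf); apply: measurable_fun_rV => i.
under eq_fun do rewrite mxE; apply: measurable_funM => //; exact: measurable_coord.
Qed.

(** At scale 2^-k the oscillation on a cube of side l is at most of order
    min(2^k l, 1 / (2^k l)): by the Lipschitz bound for small cubes, by the decay of
    the profile for large ones. These numbers are summable uniformly in l. *)
Lemma lacunary_oscillation N c a l : 0 <= c -> 0 < l ->
  (mean_oscillation (cube a l) (lacunary N c) <= (12 * (L + 2 * C) * c)%:E)%E.
Proof.
move=> c0 l0; have e0 k : 0 < 2 ^+ k :> R by rewrite exprn_gt0.
pose P k := 2 ^+ k * l <= 1.
pose w k := if P k then 2 ^+ k * l else (2 ^+ k * l)^-1.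
have y0 k : 0 < 2 ^+ k * l by rewrite mulr_gt0.
have w0 k : 0 <= w k by rewrite /w; case: ifP => _; rewrite ?invr_ge0 ltW.
have yS k : 2 ^+ k.+1 * l = 2 * (2 ^+ k * l) by rewrite exprS mulrA.
have PS k : P k.+1 -> P k by rewrite /P yS; have := y0 k; lra.
have w4 : \sum_(k < N) w k <= 4.
  have := @unimodal_sum_le R w P 2^-1 1 N.
  rewrite (_ : 2 * 1 / (1 - 2^-1) = 4 :> R); last by field.
  apply => //; first by apply/andP; split; lra.
  - by move=> k Pk; rewrite /w Pk (PS _ Pk) yS; lra.
  - move=> k Pk; rewrite /w (negbTE Pk) (_ : P k.+1 = false) ?yS ?invfM//.
    by apply: contraNF Pk; exact: PS.
  move=> k _; rewrite /w; case: ifPn => //; rewrite /P -ltNge => h.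
  by rewrite invf_le1// ltW.
pose z := \sum_(k < N) c%:C * (if P k then V (2 ^+ k *: a) else 0).
pose h k (v : R) := c * (if P k then L * (2 ^+ k * l) else C * (1 + 2 ^+ k * `|v|) `^ (- 2%:R)).
have h0 k v : 0 <= h k v.
  rewrite /h mulr_ge0//; case: ifP => _; first by rewrite mulr_ge0// ltW.
  by rewrite mulr_ge0// powR_ge0.
have cdecay k : continuous (fun v : R => (1 + 2 ^+ k * `|v|) `^ (- 2%:R)).
  by apply: continuous_norm_powR => //; exact: ltW.
have mh k : measurable_fun [set: R] (h k).
  rewrite /h; case: (P k); first exact: measurable_cst.
  by do 2 apply: measurable_funM => //; exact: continuous_measurable_fun.
have ih k : (\int[mu]_(x in cube a l) (h k (x ord0 ord0))%:E <=
    (c * (L + 2 * C) * w k * l ^+ d)%:E)%E.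
  rewrite /h /w; case: (boolP (P k)) => Pk.
    rewrite (_ : \int[mu]_(x in _) _ = (c * (L * (2 ^+ k * l)))%:E * mu (cube a l))%E; last first.
      exact: (integral_cst mu (measurable_cube a l) (c * (L * (2 ^+ k * l)))%:E).
    rewrite (measure_cube a (ltW l0)) -EFinM lee_fin ler_wpM2r ?exprn_ge0 ?(ltW l0)//.
    rewrite -[leRHS]mulrA; apply: ler_wpM2l => //; apply: ler_wpM2r; [exact: ltW|rewrite lerDl mulr_ge0//].
  have r0 : 0 < (2 ^+ k)^-1 :> R by rewrite invr_gt0.
  have I := @integral_powR_decay R 2 _ _ r0; rewrite invrK in I.
  have I2 : (\int[leb]_v (c * (C * (1 + 2 ^+ k * `|v|) `^ (- 2%:R)))%:E <=
      (c * C * (2 / (2 - 1) * (2 ^+ k)^-1))%:E)%E.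
    under eq_integral do rewrite mulrA EFinM.
    rewrite ge0_integralZl//;
      [|exact: measurable_funE (continuous_measurable_fun (cdecay k))|by rewrite lee_fin mulr_ge0].
    have I1 := I (ltac:(lra) : 1 < 2 :> R); apply: le_trans (lee_wpmul2l _ I1) _.
      by rewrite lee_fin mulr_ge0.
    by rewrite -EFinM.
  apply: le_trans (integral_cube_le a (ltW l0) _ _ I2) _.
  - by do 2 apply: measurable_funM => //; exact: continuous_measurable_fun.
  - by move=> v; rewrite !mulr_ge0// powR_ge0.
  rewrite lee_fin [leLHS](_ : _ = c * (2 * C) * (2 ^+ k * l)^-1 * l ^+ d); last first.
    by rewrite exprS; field; rewrite !gt_eqF.
  rewrite ler_wpM2r ?exprn_ge0 ?(ltW l0)// ler_wpM2r ?invr_ge0 ?(ltW (y0 k))//.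
  by apply: ler_wpM2l => //; rewrite lerDr.
have := @mean_oscillation_le R n a l (4 * (c * (L + 2 * C)))
  (fun x => \sum_(k < N) h k (x ord0 ord0)) l0.
have LC0 : 0 <= c * (L + 2 * C) by apply: mulr_ge0 => //; rewrite addr_ge0// mulr_ge0.
rewrite (_ : 3 * _ = 12 * (L + 2 * C) * c); last by ring.
move=> /(_ _ _ _ _ (lacunary N c) z); apply.
- by rewrite mulr_ge0.
- by apply: measurable_sum => k; exact: (measurableT_comp (mh k) (measurable_coord ord0)).
- by move=> x; rewrite sumr_ge0.
- under eq_integral do rewrite -sumEFin.
  rewrite ge0_integral_sum//; last 3 first.
  + exact: measurable_cube.
  + move=> k; apply: measurable_funTS; apply: measurable_funE.
    exact: (measurableT_comp (mh k) (measurable_coord ord0)).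
  + by move=> k x _; rewrite lee_fin.
  apply: (@le_trans _ _ (\sum_(k < N) (c * (L + 2 * C) * w k * l ^+ d)%:E)%E).
    by apply: lee_sum => k _; exact: ih.
  rewrite sumEFin lee_fin -mulr_suml ler_wpM2r ?exprn_ge0 ?(ltW l0)//.
  by rewrite -mulr_sumr mulrC ler_wpM2r.
- by apply: (@measurable_lacunary (@complex.Re R) _ _ (@creD R) erefl _ mre) => ?; exact: creZ.
- by apply: (@measurable_lacunary (@complex.Im R) _ _ (@cimD R) erefl _ mim) => ?; exact: cimZ.
move=> x xQ; rewrite /lacunary /z -sumrB; apply: le_trans (normc_sum _ _) _.
apply: ler_sum => k _; rewrite -mulrBr normcZ ger0_norm// /h ler_wpM2l//.
case: ifP => Pk; last first.
  by rewrite subr0; apply: le_trans (decay _) _; rewrite mxE normrM ger0_norm ?(ltW (e0 k)).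
apply: lip => j; rewrite !mxE -mulrBr normrM ger0_norm ?(ltW (e0 k))// ler_wpM2l ?(ltW (e0 k))//.
by have /andP[? ?] := xQ j; rewrite ger0_norm; lra.
Qed.

End profile.
End lacunary_bmo.

(** * The two functions *)

Section packet.
Variables (R : realType) (n : nat).
Local Notation d := n.+1.
Local Notation normc := ComplexField.Normc.normc.
Implicit Types (x y : 'rV[R]_d) (c : R).

Lemma dotZ (k : R) x : dot (k *: x) (k *: x) = k ^+ 2 * dot x x.
Proof. by rewrite /dot mulr_sumr; apply: eq_bigr => i _; rewrite !mxE; ring. Qed.

Lemma bessel_wave_sum sig N (z a t : 'I_N -> R) x : (forall k, 0 < t k) ->
  bessel sig (wave_sum z a t) x = \sum_k (z k)%:C * bwave sig (a k) (t k) x.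
Proof. by move=> t0; exact: bessel_sum_wave. Qed.

(** The function f: lacunary wave packets, the k-th of width 2^-k and frequency 2^k,
    scaled so that the gradients of all packets have the same height. *)
Definition packet N c : 'rV[R]_d -> R[i] := wave_sum (fun k : 'I_N => c * (2 ^+ k)^-1)
  (fun k => 2 ^+ k) (fun k => (2 ^+ k)^-1 ^- 2).

Lemma packet_tau_gt0 k : 0 < (2 ^+ k)^-1 ^- 2 :> R.
Proof. by rewrite invr_gt0 exprn_gt0// invr_gt0 exprn_gt0. Qed.

(** The gradient of a single packet of width and frequency 1; the terms of the
    gradient of [packet] are dilates of it. *)
Definition profile j : 'rV[R]_d -> R[i] :=
  partial j (wave_sum (fun _ : 'I_1 => 1) (fun=> 1) (fun=> 1)).

Lemma partial_packet N c j : partial j (packet N c) = lacunary (profile j) N c.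
Proof.
apply/funext => x; rewrite partial_wave_sum /lacunary; apply: eq_bigr => k _.
rewrite /profile partial_wave_sum big_ord1 mul1r.
have e0 : 2 ^+ k != 0 :> R by rewrite expf_neq0.
have -> : wave (2 ^+ k) ((2 ^+ k)^-1 ^- 2) x = wave 1 1 (2 ^+ k *: x).
  rewrite /wave dotZ mxE; congr ((expR (- _))%:C * expi _); last by rewrite mul1r.
  by rewrite exprVn invrK; ring.
 rewrite realCM -!mulrA; congr (_ * _); rewrite mulrA; congr (_ * _).
rewrite [(2 ^+ k *: x) _ _]mxE; apply: complex_ext; rewrite ?creZ ?cimZ /=.
  by rewrite exprVn invrK; field.
by rewrite /freq; case: ifP => _; rewrite ?mulr0// mulVf.
Qed.

Lemma bmo_norm_packet j : exists2 K : R, 0 <= K & forall N c, 0 <= c ->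
  (bmo_norm (partial j (packet N c)) <= (K * c)%:E)%E.
Proof.
have t0 (k : 'I_1) : 0 < 1 :> R by [].
have [e1 [e2 hV]] : exists e1 e2, profile j = cwsum (fun _ : 'I_1 => 1) (fun=> 1) e1 e2.
  by rewrite /profile wave_sum_cwsum partial_cwsum; do 2 eexists.
have [L1 L10 HL1] := lipschitz_wsum (fun=> 1) t0 e1.
have [L2 L20 HL2] := lipschitz_wsum (fun=> 1) t0 e2.
have [C1 C10 HC1] := decay_wsum (fun=> 1) t0 e1.
have [C2 C20 HC2] := decay_wsum (fun=> 1) t0 e2.
pose L := L1 + L2; pose C := C1 + C2.
exists (12 * (L + 2 * C)) => [|N c c0].
  by rewrite mulr_ge0// addr_ge0 ?mulr_ge0// addr_ge0.
rewrite partial_packet; apply: ge_ereal_sup => _ [a [l [l0 ->]]].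
apply: lacunary_oscillation => //; rewrite ?addr_ge0//.
- by rewrite hV; exact: measurable_wsum.
- by rewrite hV; exact: measurable_wsum.
- move=> x y D xyD; rewrite hV; apply: le_trans (normc_le_ReIm _) _.
  by rewrite /cwsum /= /L mulrDl lerD// ?HL1// HL2.
- move=> x; rewrite hV; apply: le_trans (normc_le_ReIm _) _.
  by rewrite /cwsum /= /C mulrDl lerD.
Qed.

Lemma bmo_grad_packet : exists2 K : R, 0 <= K & forall N c, 0 <= c ->
  (bmo_grad (packet N c) <= (K * c)%:E)%E.
Proof.
pose K j := sval (cid2 (bmo_norm_packet j)).
exists (\sum_j K j) => [|N c c0].
  by apply: sumr_ge0 => j _; rewrite /K; case: cid2.
rewrite mulr_suml -sumEFin; apply: lee_sum => j _.
by rewrite /K; case: cid2 => /= k _; exact.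
Qed.

(** The k-th packet contributes a bump of height c (2^k)^(s-1), which is at most
    c (2^k)^(d/p) because s <= 1 + d/p: the height of a bump normalized in L^p. *)
Lemma cLnorm_bessel_packet p s : 1 < p -> 0 < s -> s <= 1 + d%:R / p ->
  exists2 K : R, 0 <= K & forall N c, 0 <= c ->
  (cLnorm p%:E (bessel s (packet N c)) <= (K * c * N%:R `^ p^-1)%:E)%E.
Proof.
move=> p1 s0 sp; have [C C0 HC] := bwave_decay n s0.
have [K K0 HK] := @cLnorm_lacunary R n p p1.
exists (K * C) => [|N c c0]; first exact: mulr_ge0.
rewrite -(mulrA K); apply: HK => [|x j]; first exact: mulr_ge0.
rewrite bessel_wave_sum => [|k]; last exact: packet_tau_gt0.
apply: le_trans (normc_sum _ _) _; rewrite mulr_sumr; apply: ler_sum => k _.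
have e1 : 1 <= 2 ^+ k :> R by rewrite exprn_ege1//; lra.
have e0 : 0 < 2 ^+ k :> R by exact: lt_le_trans e1.
have y0 : 0 < (1 + 2 ^+ k * `|x ord0 j|) ^+ d.
  by rewrite exprn_gt0// ltr_pwDl// mulr_ge0// ltW.
have := HC (2 ^+ k)^-1 (2 ^+ k) x j; rewrite invr_gt0 e0 invf_le1// e1 mulVf ?gt_eqF// invrK.
move=> /(_ isT (lexx _)) H.
rewrite normcZ ger0_norm; last by rewrite mulr_ge0// invr_ge0 ltW.
rewrite mulrA ler_pdivlMr//.
apply: (@le_trans _ _ (c * (2 ^+ k)^-1 * (C * (2 ^+ k) `^ s))).
  by rewrite -[leLHS]mulrA; apply: ler_wpM2l => //; rewrite mulr_ge0// invr_ge0 ltW.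
rewrite [leLHS](_ : _ = C * c * ((2 ^+ k) `^ s * (2 ^+ k)^-1)); last by ring.
apply: ler_wpM2l; first exact: mulr_ge0.
rewrite -[(2 ^+ k)^-1]powR_inv1 ?(ltW e0)// -powRD; last by rewrite (gt_eqF e0) implybT.
by apply: ler_powR => //; lra.
Qed.

(** The function g: one wave packet of width del, of very high frequency lam. *)
Definition probe (kap lam del : R) : 'rV[R]_d -> R[i] :=
  wave_sum (fun _ : 'I_1 => kap) (fun=> lam) (fun=> (del ^+ 2)^-1).

Lemma cLnorm_bessel_probe p sig : 1 < p -> 0 < sig -> exists2 K : R, 0 <= K &
  forall kap lam del, 0 <= kap -> 0 < del <= 1 -> 1 <= del * lam ->
  (cLnorm p%:E (bessel sig (probe kap lam del)) <=
    (K * (kap * lam `^ sig * del `^ (d%:R / p)))%:E)%E.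
Proof.
move=> p1 s0; have [C C0 HC] := bwave_decay n s0.
have [K K0 HK] := @cLnorm_bump R n p p1.
exists (K * C) => [|kap lam del kap0 /andP[d0 d1] dl]; first exact: mulr_ge0.
rewrite [X in (_ <= X%:E)%E](_ : _ = K * (kap * (C * lam `^ sig)) * del `^ (d%:R / p)); last by ring.
apply: HK => //; first by rewrite !mulr_ge0// powR_ge0.
move=> x j; rewrite bessel_wave_sum => [|_]; last by rewrite invr_gt0 exprn_gt0.
rewrite big_ord1 normcZ (ger0_norm kap0) -mulrA ler_wpM2l//.
by apply: HC => //; rewrite d0.
Qed.

Lemma normc_wave a t x : normc (wave a t x) = expR (- (t / 2 * dot x x)).
Proof. by rewrite /wave normcZ normc_expi mulr1 gtr0_norm// expR_gt0. Qed.

Lemma normc_wave_le1 a t x : 0 <= t -> normc (wave a t x) <= 1.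
Proof.
by move=> t0; rewrite normc_wave -expR0 ler_expR oppr_le0 mulr_ge0 ?divr_ge0// dot_ge0.
Qed.

Lemma cLnorm_probe kap lam del : 0 <= kap -> (cLnorm +oo (probe kap lam del) <= kap%:E)%E.
Proof.
move=> k0; apply: cLnorm_sup_le => // x.
rewrite /probe /wave_sum big_ord1 normcZ (ger0_norm k0) -[leRHS]mulr1 ler_wpM2l//.
by apply: normc_wave_le1; rewrite invr_ge0 sqr_ge0.
Qed.

End packet.

(** * The commutator *)

Section commutator.
Variables (R : realType) (n : nat).
Local Notation d := n.+1.
Local Notation normc := ComplexField.Normc.normc.
Implicit Types (x y : 'rV[R]_d) (c s lam : R).

Lemma wave_mul a b t u x : wave a t x * wave b u x = wave (a + b) (t + u) x.
Proof.
rewrite /wave mulrACA -realCM -expRD -expiD -mulrDl; congr ((expR _)%:C * _).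
by field.
Qed.

(** The difference of the expansions of [bwave_asymp] at the frequencies lam + b and
    lam: the terms of order lam^s cancel, and the first-order term that falls on the
    slow packet remains. *)
Lemma bwave_commutator s b t u : 0 < s -> 0 <= t -> 0 < u -> exists2 C : R, 0 <= C &
  forall lam x, 1 <= lam ->
    normc (bwave s (lam + b) (t + u) x - wave b t x * bwave s lam u x -
      (s * lam `^ (s - 1))%:C * ((b +i* (t * x ord0 ord0)) * wave b t x * wave lam u x))
    <= C * lam `^ (s - 2).
Proof.
move=> s0 t0 u0.
have tu0 : 0 < t + u by rewrite ltr_wpDl.
have [C1 C10 H1] := bwave_asymp n b s0 tu0.
have [C2 C20 H2] := bwave_asymp n 0 s0 u0.
exists (C1 + C2) => [|lam x lam1]; first exact: addr_ge0.
have := H1 lam x lam1; have := H2 lam x lam1; rewrite addr0.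
set A2 := (X in normc X <= C2 * _); set A1 := (X in normc X <= C1 * _) => h2 h1.
rewrite [X in normc X](_ : _ = A1 + - (wave b t x * A2)).
  apply: le_trans (le_normcD _ _) _; rewrite normcN ComplexField.Normc.normcM mulrDl.
  apply: lerD => //; apply: le_trans h2; rewrite -[leRHS]mul1r ler_wpM2r ?normc_ge0//.
  exact: normc_wave_le1.
rewrite /A1 /A2 -(addrC b) -wave_mul [(s * _)%:C]realCM.
have -> : b +i* ((t + u) * x ord0 ord0) = (b +i* (t * x ord0 ord0)) + (0 +i* (u * x ord0 ord0)).
  by apply: complex_ext => /=; ring.
move: (bwave s _ _ _) (bwave s lam _ _) (wave b t x) (wave lam u x) (_ +i* _) (_ +i* _)
  (lam `^ s)%:C (_ `^ _)%:C => *; ring.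
Qed.

(** The derivative along x_0 of [packet], divided by i c. *)
Definition packet_head N x : R[i] := \sum_(k < N)
  (1 +i* (2 ^+ k * x ord0 ord0)) * wave (2 ^+ k) ((2 ^+ k)^-1 ^- 2) x.

(** At the origin all N packets are in phase. *)
Lemma packet_head_ge N : (0 < N)%N -> exists2 del : R, 0 < del <= 1 &
  forall x, cube 0 del x -> N%:R / 2 <= complex.Re (packet_head N x).
Proof.
move=> N0; pose a (k : 'I_N) : R := 2 ^+ k; pose t (k : 'I_N) : R := (2 ^+ k)^-1 ^- 2.
pose e (k : 'I_N) : wexp R n :=
  Wadd (Wcos _ _) (Wmul (Wconst _ (- 2 ^+ k)) (Wmul (Wcoord _ ord0) (Wsin _ _))).
have E x : complex.Re (packet_head N x) = wsum a t e x.
  rewrite Re_sum; apply: eq_bigr => k _.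
  by rewrite creM /wave creZ cimZ /envelope /=; ring.
have t0 k : 0 < t k by exact: packet_tau_gt0.
have [L L0 HL] := lipschitz_wsum a t0 e.
have N1 : 1 <= N%:R :> R by rewrite ler1n.
pose del := (2 * (L + 1))^-1.
have L1 : 0 < 2 * (L + 1) by lra.
have del0 : 0 < del by rewrite invr_gt0.
exists del => [|x xQ]; first by rewrite del0 invf_le1//; lra.
rewrite E; have E0 : wsum a t e 0 = N%:R.
  rewrite /wsum (eq_bigr (fun=> 1)) => [|k _].
    by rewrite sumr_const card_ord.
  rewrite /envelope /dot big1 => [|i _]; last by rewrite mxE mul0r.
  by rewrite /= mulr0 oppr0 expR0 mxE mulr0 cos0 mul0r mulr0 addr0 mulr1.
have h : `|wsum a t e x - wsum a t e 0| <= L * del.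
  apply: HL => j; have := xQ j; rewrite !mxE subr0 add0r => /andP[x0 x1].
  by rewrite ger0_norm.
have Ld : L * del <= 2^-1.
  by rewrite /del invfM mulrCA ler_piMr// ler_pdivrMr; lra.
move: h; rewrite E0 ler_norml => /andP[h _]; lra.
Qed.

Lemma commutator_expansion s N c u : 0 < s -> 0 <= c -> 0 < u ->
  exists2 C : R, 0 <= C & forall kap lam x (f g : 'rV[R]_d -> R[i]), 0 <= kap -> 1 <= lam ->
  f = packet N c -> g = wave_sum (fun _ : 'I_1 => kap) (fun=> lam) (fun=> u) ->
  normc (bessel s (f \* g) x - f x * bessel s g x -
    (kap * (s * lam `^ (s - 1)) * c)%:C * (packet_head N x * wave lam u x))
  <= kap * (C * lam `^ (s - 2)).
Proof.
move=> s0 c0 u0.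
pose b k : R := 2 ^+ k; pose t k : R := (2 ^+ k)^-1 ^- 2.
have b0 k : 0 < b k by rewrite exprn_gt0.
have t0 k : 0 < t k by exact: packet_tau_gt0.
pose C k := sval (cid2 (bwave_commutator (b k) s0 (ltW (t0 k)) u0)).
have C0 k : 0 <= C k by rewrite /C; case: cid2.
have HC k lam x : 1 <= lam ->
    normc (bwave s (lam + b k) (t k + u) x - wave (b k) (t k) x * bwave s lam u x -
      (s * lam `^ (s - 1))%:C *
        ((b k +i* (t k * x ord0 ord0)) * wave (b k) (t k) x * wave lam u x))
    <= C k * lam `^ (s - 2).
  by rewrite /C; case: cid2 => /= C' _; exact.
exists (\sum_(k < N) c * (b k)^-1 * C k) => [|kap lam x f g kap0 lam1 fE gE].
  by apply: sumr_ge0 => k _; rewrite !mulr_ge0// invr_ge0 ltW.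
have fg : f \* g = wave_sum (fun k : 'I_N => kap * (c * (b k)^-1))
    (fun k => lam + b k) (fun k => t k + u).
  apply/funext => y; rewrite fE gE /packet /wave_sum /= big_ord1 mulr_suml.
  by apply: eq_bigr => k _; rewrite realCM (addrC lam) -wave_mul; ring.
rewrite fg bessel_wave_sum => [|k]; last by rewrite addr_gt0.
rewrite gE bessel_wave_sum// big_ord1 fE /packet /wave_sum /packet_head.
rewrite !mulr_suml mulr_sumr -!sumrB; apply: le_trans (normc_sum _ _) _.
rewrite mulr_sumr; apply: ler_sum => k _.
set D := (X in normc X).
have -> : D = (kap * (c * (b k)^-1))%:C *
   (bwave s (lam + b k) (t k + u) x - wave (b k) (t k) x * bwave s lam u x -
      (s * lam `^ (s - 1))%:C *
        ((b k +i* (t k * x ord0 ord0)) * wave (b k) (t k) x * wave lam u x)).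
  have Z : (1 +i* (b k * x ord0 ord0)) = ((b k)^-1)%:C * (b k +i* (t k * x ord0 ord0)).
    have bN : b k != 0 by rewrite gt_eqF.
    apply: complex_ext; rewrite ?creZ ?cimZ /=; first by rewrite mulVf.
    by rewrite /t exprVn invrK -/(b k); field.
  rewrite /D -/(b k) -/(t k) Z !realCM.
  move: (bwave s _ _ _) (bwave s lam _ _) (wave (b k) (t k) x) (wave lam u x) (_ +i* _)
    (lam `^ _)%:C kap%:C c%:C s%:C ((b k)^-1)%:C => *; ring.
have z0 : 0 <= kap * (c * (b k)^-1) by rewrite !mulr_ge0// invr_ge0 ltW.
rewrite normcZ ger0_norm// [leRHS](_ : _ = kap * (c * (b k)^-1) * (C k * lam `^ (s - 2))).
  by rewrite ler_wpM2l// HC.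
ring.
Qed.

(** On the cube of side del the derivative of the packet is of size c N and the
    modulus of the probe is at least exp(-d/2) times its maximum; lam0 is such that the
    error of the expansion is at most half of the main term. *)
Lemma commutator_lower (p : R) s N c : 0 < p -> 0 < s -> (0 < N)%N -> 0 < c ->
  exists del lam0 : R, [/\ 0 < del <= 1, 1 <= lam0 &
  forall kap lam (f g : 'rV[R]_d -> R[i]), 0 <= kap -> lam0 <= lam ->
  f = packet N c -> g = probe kap lam del ->
  ((s / 4 * expR (- (d%:R / 2)) * (c * N%:R) * (kap * lam `^ (s - 1) * del `^ (d%:R / p)))%:E <=
    cLnorm p%:E (bessel s (f \* g) \- f \* bessel s g)%R)%E].
Proof.
move=> p0 s0 N0 c0.
have [del /andP[del0 del1] Hdel] := packet_head_ge N0.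
pose u := (del ^+ 2)^-1; have u0 : 0 < u by rewrite invr_gt0 exprn_gt0.
have [C C0 HC] := commutator_expansion N s0 (ltW c0) u0.
pose ex := expR (- (d%:R / 2)) : R; have ex0 : 0 < ex by exact: expR_gt0.
pose B := s / 4 * ex * (c * N%:R).
have B0 : 0 < B by rewrite !mulr_gt0// ltr0n.
exists del, (Num.max 1 (C / B)); split; [by rewrite del0|by rewrite le_max lexx|].
move=> kap lam f g kap0; rewrite ge_max => /andP[lam1 lamC] fE gE.
have l0 : 0 < lam by exact: lt_le_trans lam1.
rewrite -/ex -/B [X in (X%:E <= _)%E](_ : _ = B * (kap * lam `^ (s - 1)) * del `^ (d%:R / p)); last by ring.
have A0 : 0 <= kap * lam `^ (s - 1) by rewrite mulr_ge0 ?powR_ge0.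
apply: (@cLnorm_ge_cube R n p _ 0 del) => //; [by rewrite mulr_ge0// ltW|exact: ltW|].
move=> x xQ; set m := (kap * (s * lam `^ (s - 1)) * c)%:C * (packet_head N x * wave lam u x).
set D := (X in normc X).
have hD : normc (D - m) <= kap * (C * lam `^ (s - 2)) by exact: HC.
have hm : 2 * (B * (kap * lam `^ (s - 1))) <= normc m.
  rewrite /m normcZ ger0_norm; last by rewrite !mulr_ge0 ?powR_ge0// ltW.
  rewrite ComplexField.Normc.normcM.
  have hh : N%:R / 2 <= normc (packet_head N x).
    by apply: le_trans (Hdel x xQ) _; apply: le_trans (ler_norm _) (normc_Re _).
  have hw : ex <= normc (wave lam u x).
    rewrite normc_wave ler_expR lerN2 mulrAC ler_wpM2r//.
    rewrite /u mulrC ler_pdivrMr ?exprn_gt0// mulr_natl -[in leRHS](card_ord d) -sumr_const.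
    apply: ler_sum => j _; have := xQ j; rewrite mxE add0r => /andP[x0 x1].
    by rewrite -expr2 lerXn2r ?nnegrE// ltW.
  rewrite [leLHS](_ : _ = kap * (s * lam `^ (s - 1)) * c * (N%:R / 2 * ex)); last by rewrite /B; field.
  apply: ler_wpM2l; first by rewrite !mulr_ge0 ?powR_ge0// ltW.
  by apply: ler_pM => //; exact: ltW.
have hE : kap * (C * lam `^ (s - 2)) <= B * (kap * lam `^ (s - 1)).
  have -> : lam `^ (s - 1) = lam `^ (s - 2) * lam.
    rewrite -[X in _ * X](powRr1 (ltW l0)) -powRD; last by rewrite (gt_eqF l0) implybT.
    by congr powR; lra.
  rewrite [leRHS](_ : _ = kap * (lam * B * lam `^ (s - 2))); last by ring.
  by rewrite ler_wpM2l// ler_wpM2r ?powR_ge0// -ler_pdivrMr.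
have : normc m <= normc D + normc (D - m).
  by rewrite -[in leLHS](subKr D m) -(normcN (D - m)) le_normcD.
lra.
Qed.

End commutator.

(** * Choice of the parameters *)

Section conclusion.
Variables (R : realType) (n : nat).
Local Notation d := n.+1.
Implicit Types (p s M : R).

Lemma powRVK (x e : R) : 0 <= x -> e != 0 -> (x `^ e^-1) `^ e = x.
Proof. by move=> x0 eN; rewrite -powRrM mulVf// powRr1. Qed.

Lemma natr_powR_unbounded (e M : R) : 0 < e -> exists2 N : nat, (0 < N)%N & M <= N%:R `^ e.
Proof.
move=> e0; pose M1 := Num.max M 1.
have M10 : 0 < M1 by rewrite lt_max ltr01 orbT.
exists (Num.bound (M1 `^ e^-1)).+1 => //.
have h : M1 `^ e^-1 <= (Num.bound (M1 `^ e^-1)).+1%:R.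
  apply: le_trans (ltW (archi_boundP (powR_ge0 _ _))) _; by rewrite ler_nat.
apply: (@le_trans _ _ M1); first by rewrite le_max lexx.
rewrite -[leLHS](powRVK (ltW M10) (lt0r_neq0 e0)).
by apply: ge0_ler_powR => //; rewrite ?nnegrE ?powR_ge0 ?(ltW e0).
Qed.

(** With c = c0 N^(-1/p) and kap lam^(s-1) del^(d/p) = k0, each norm in the first
    bound is at most 1/4, and the lower bound for the commutator is a constant times
    N^(1 - 1/p). *)
Lemma commutator_unbounded p s M : 1 < p -> 1 < s -> s <= 1 + d%:R / p ->
  exists f g : 'rV[R]_d -> R[i],
    [/\ schwartz f, schwartz g,
        (cLnorm p%:E (bessel s f) + cLnorm +oo g + cLnorm p%:E (bessel (s - 1) g)
          + bmo_grad f <= 1)%E &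
        (M%:E < cLnorm p%:E (bessel s (f \* g) \- f \* bessel s g)%R)%E].
Proof.
move=> p1 s1 sp; have p0 : 0 < p by lra. have s0 : 0 < s by lra.
have s10 : 0 < s - 1 by lra.
have [K1 K10 HK1] := cLnorm_bessel_packet p1 s0 sp.
have [K2 K20 HK2] := bmo_grad_packet R n.
have [K3 K30 HK3] := @cLnorm_bessel_probe R n p _ p1 s10.
pose c0 := (4 * (K1 + K2 + 1))^-1; pose k0 := (4 * (K3 + 1))^-1.
have c00 : 0 < c0 by rewrite invr_gt0; lra.
have k00 : 0 < k0 by rewrite invr_gt0; lra.
pose B := s / 4 * expR (- (d%:R / 2)).
have B0 : 0 < B by rewrite mulr_gt0 ?expR_gt0//; lra.
have e0 : 0 < 1 - p^-1 by rewrite subr_gt0 invf_lt1.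
have [N N0 HN] := natr_powR_unbounded ((M + 1) / (B * c0 * k0)) e0.
have NR : 0 < N%:R :> R by rewrite ltr0n.
pose c := c0 * N%:R `^ (- p^-1).
have cpos : 0 < c by rewrite mulr_gt0// powR_gt0.
have cN : c * N%:R `^ p^-1 = c0.
  rewrite /c -mulrA -powRD; last by rewrite (gt_eqF NR) implybT.
  by rewrite addNr powRr0 mulr1.
have cc0 : c <= c0.
  rewrite -cN ler_peMr ?(ltW cpos)// -[leLHS](powRr0 N%:R).
  by apply: ler_powR; rewrite ?ler1n// invr_ge0 ltW.
have cNN : c * N%:R = c0 * N%:R `^ (1 - p^-1).
  rewrite /c -mulrA -[X in _ * (_ * X)](powRr1 (ltW NR)) -powRD; last by rewrite (gt_eqF NR) implybT.
  by rewrite addrC.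
have [del [lam0 [/andP[del0 del1] lam01 HL]]] := commutator_lower n p0 s0 N0 cpos.
pose dp := del `^ (d%:R / p); have dp0 : 0 < dp by rewrite powR_gt0.
(* the last bound makes the sup norm of the probe at most 1/4 *)
pose lam := Num.max lam0 (Num.max del^-1 ((4 * k0 / dp) `^ (s - 1)^-1)).
have lamA : lam0 <= lam by rewrite le_max lexx.
have lamB : 1 <= del * lam.
  rewrite -(mulfV (_ : del != 0)) ?gt_eqF// ler_pM2l//.
  by rewrite /lam !le_max lexx !orbT.
have l0 : 0 < lam by apply: lt_le_trans lamA; lra.
have lamC : 4 * k0 / dp <= lam `^ (s - 1).
  have q0 : 0 < 4 * k0 / dp by rewrite divr_gt0// mulr_gt0.
  rewrite -[leLHS](powRVK (ltW q0) (lt0r_neq0 s10)).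
  apply: ge0_ler_powR; rewrite ?nnegrE ?powR_ge0 ?(ltW s10) ?(ltW l0)//.
  by rewrite /lam !le_max lexx !orbT.
have ls0 : 0 < lam `^ (s - 1) by rewrite powR_gt0.
pose kap := k0 / (lam `^ (s - 1) * dp).
have kap0 : 0 < kap by rewrite divr_gt0// mulr_gt0.
have kapE : kap * lam `^ (s - 1) * dp = k0.
  by rewrite /kap -mulrA divfK// gt_eqF// mulr_gt0.
have kap4 : kap <= 4^-1.
  rewrite /kap ler_pdivrMr ?mulr_gt0//.
  by move: lamC; rewrite ler_pdivrMr//; lra.
exists (packet N c), (probe kap lam del); split.
- by apply: schwartz_wave_sum => k; exact: packet_tau_gt0.
- by apply: schwartz_wave_sum => k; rewrite invr_gt0 exprn_gt0.
- have h1 := HK1 N c (ltW cpos); have h2 := HK2 N c (ltW cpos).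
  have := HK3 kap lam del (ltW kap0) _ lamB; rewrite del0 del1 kapE => /(_ isT) h3.
  have h4 := @cLnorm_probe R n kap lam del (ltW kap0).
  apply: le_trans (leeD (leeD (leeD h1 h4) h3) h2) _.
  rewrite -!EFinD lee_fin -mulrA cN.
  have i1 : K1 * c0 + K2 * c <= 4^-1.
    apply: (@le_trans _ _ ((K1 + K2 + 1) * c0)).
      have : K2 * c <= K2 * c0 by exact: ler_wpM2l.
      lra.
    by rewrite /c0 invfM mulrCA mulfV ?mulr1//; apply/eqP; lra.
  have i3 : K3 * k0 <= 4^-1.
    apply: (@le_trans _ _ ((K3 + 1) * k0)); first lra.
    by rewrite /k0 invfM mulrCA mulfV ?mulr1//; apply/eqP; lra.
  lra.
apply: lt_le_trans (HL kap lam _ _ (ltW kap0) lamA erefl erefl).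
rewrite lte_fin kapE -/B cNN.
apply: (@lt_le_trans _ _ (M + 1)); first lra.
move: HN; rewrite ler_pdivrMr ?mulr_gt0//; lra.
Qed.

End conclusion.

Local Open Scope ring_scope.
Local Open Scope ereal_scope.

Theorem proposition7p7 (R : realType) (d : nat) (p s M : R) :
  (1 <= d)%N -> (1 < p)%R -> (1 < s)%R -> (s <= 1 + d%:R / p)%R -> (0 < M)%R ->
  exists f g : 'rV[R]_d -> R[i],
    [/\ schwartz f, schwartz g,
        cLnorm p%:E (bessel s f) + cLnorm +oo g + cLnorm p%:E (bessel (s - 1)%R g)
          + bmo_grad f <= 1 &
        cLnorm p%:E (bessel s (f \* g)%R \- f \* bessel s g)%R > M%:E].
Proof.
case: d => [//|n] _ p1 s1 sp _; exact: commutator_unbounded.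
Qed.
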